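(* Let $u,v\in W^{1,p}(\mathbb{R}^N)$ be such that $-H_pu+(-\Delta_p)^su\le-H_pv+(-\Delta_p)^sv$ in $\Omega$ in the weak sense, that is, $$\int_\Omega H(\nabla u)^{p-1}\nabla H(\nabla u)\cdot\nabla\phi\,dx+\iint_{\mathbb{R}^{2N}}|u(x)-u(y)|^{p-2}(u(x)-u(y))(\phi(x)-\phi(y))\,d\mu$$ $$\le\int_\Omega H(\nabla v)^{p-1}\nabla H(\nabla v)\cdot\nabla\phi\,dx+\iint_{\mathbb{R}^{2N}}|v(x)-v(y)|^{p-2}(v(x)-v(y))(\phi(x)-\phi(y))\,d\mu$$ for every $\phi\in W_0^{1,p}(\Omega)$ with $\phi\ge0$. If $u\le v$ a.e. in $\mathbb{R}^N\setminus\Omega$, then $u\le v$ a.e. in $\Omega$.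
   Context: $\Omega\subset\mathbb{R}^N$, $N\ge2$, is a bounded $C^1$ domain, $1<p<\infty$, $0<s<1$, and $d\mu=|x-y|^{-N-ps}\,dx\,dy$. $H:\mathbb{R}^N\to[0,\infty)$ is a Finsler–Minkowski norm: $H\in C^1(\mathbb{R}^N\setminus\{0\})$; $H(x)=0$ iff $x=0$; $H(tx)=|t|H(x)$ for all $t\in\mathbb{R}$, $x\in\mathbb{R}^N$; there are constants $C_1,C_2>0$ with $C_1|x|\le H(x)\le C_2|x|$ for all $x$; and $H$ is strictly convex as a norm, i.e. $H(x+y)<H(x)+H(y)$ for linearly independent $x,y$. The vector field $H(\xi)^{p-1}\nabla H(\xi)$ is understood as $0$ at $\xi=0$. $H_pu=\mathrm{div}(H(\nabla u)^{p-1}\nabla H(\nabla u))$ and $(-\Delta_p)^su(x)=\mathrm{P.V.}\int_{\mathbb{R}^N}|u(x)-u(y)|^{p-2}(u(x)-u(y))|x-y|^{-N-ps}\,dy$. $W_0^{1,p}(\Omega)=\{u\in W^{1,p}(\mathbb{R}^N):u=0\text{ in }\mathbb{R}^N\setminus\Omega\}$. *)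

(* Defs.v *)
From HB Require Import structures.
From mathcomp Require Import all_boot all_order all_algebra.
From mathcomp Require Import all_classical all_reals all_analysis.

Set Implicit Arguments.
Unset Strict Implicit.
Unset Printing Implicit Defensive.

Import Order.TTheory GRing.Theory Num.Theory.
Import numFieldNormedType.Exports.

Local Open Scope classical_set_scope.
Local Open Scope ring_scope.

(* R^N is 'rV[R]_N, whose library topology and norm are those of the sup norm.
   It is given the product sigma-algebra of the Borel sets of R, generated by
   the coordinates, in the same way as the library does for n.-tuple. *)
Definition rV_display : measure_display.
Proof. exact: default_measure_display. Qed.

Section measurable_rV.
Context {R : realType} (n : nat).

Let coord : 'I_n -> 'rV[R]_n -> measurableTypeR R := fun i x => x ord0 i.

Let rV_set0 : g_sigma_preimage coord set0.
Proof. exact: sigma_algebra0. Qed.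

Let rV_setC A : g_sigma_preimage coord A -> g_sigma_preimage coord (~` A).
Proof. exact: sigma_algebraC. Qed.

Let rV_bigcup (F : (set 'rV[R]_n)^nat) :
  (forall i, g_sigma_preimage coord (F i)) ->
  g_sigma_preimage coord (\bigcup_i F i).
Proof. exact: sigma_algebra_bigcup. Qed.

HB.instance Definition _ := @isMeasurable.Build rV_display
  'rV[R]_n (g_sigma_preimage coord) rV_set0 rV_setC rV_bigcup.

Lemma measurable_coord (i : 'I_n) :
  measurable_fun setT (fun x : 'rV[R]_n => x ord0 i : measurableTypeR R).
Proof.
move=> _ Y mY; rewrite setTI; apply: sub_sigma_algebra => /=.
rewrite -bigcup_seq/=; exists i => /=; first by rewrite mem_index_enum.
by exists Y => //; rewrite setTI.
Qed.

Lemma measurable_fun_coordP d (T : measurableType d) (f : T -> 'rV[R]_n) :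
  measurable_fun setT f <->
  forall i, measurable_fun setT (fun x => f x ord0 i : measurableTypeR R).
Proof.
split=> [mf i|mf].
  exact: (measurableT_comp (measurable_coord i) mf).
move=> _ A; rewrite setTI; move: A.
have [sf0 sfC sfU] : sigma_algebra setT [set A | measurable (f @^-1` A)].
  split => /=.
  - by rewrite preimage_set0.
  - by move=> A mA; rewrite setTD preimage_setC; exact: measurableC.
  - by move=> F mF; rewrite preimage_bigcup; exact: bigcup_measurable.
apply: smallest_sub; first by split.
move=> A; rewrite -bigcup_seq/= => -[i _ [B mB <-]] /=.
by rewrite setTI; have := mf i measurableT B mB; rewrite setTI.
Qed.

End measurable_rV.

Definition cons_rV {R : realType} n (z : measurableTypeR R * 'rV[R]_n)
  : 'rV[R]_n.+1 := row_mx z.1%:M z.2.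

(* Lebesgue measure on R^n: the iterated product of the one-dimensional one. *)
Fixpoint lebesgue_rV {R : realType} n : set 'rV[R]_n -> \bar R :=
  match n return set 'rV[R]_n -> \bar R with
  | 0 => \d_(0 : 'rV[R]_0)
  | n'.+1 => pushforward (lebesgue_measure \x @lebesgue_rV R n')%E
               (@cons_rV R n')
  end.

Section lebesgue_rV_measure.
Context {R : realType}.

Let uncons n (x : 'rV[R]_n.+1) : measurableTypeR R * 'rV[R]_n :=
  (x ord0 ord0, @rsubmx R 1 1 n x).

Let consK n : cancel (@cons_rV R n) (@uncons n).
Proof.
case=> a x; rewrite /uncons /cons_rV row_mxKr/=; congr pair.
have -> : (ord0 : 'I_n.+1) = @lshift 1 n ord0 by exact/val_inj.
by rewrite (@row_mxEl _ 1 1 n) mxE.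
Qed.

Lemma measurable_cons_rV n : measurable_fun setT (@cons_rV R n).
Proof.
apply/measurable_fun_coordP => i; rewrite /cons_rV.
case: (@splitP 1 n i) => j ij.
  rewrite (_ : (fun _ => _) = fst) //; apply/funext => -[a x] /=.
  have -> : i = @lshift 1 n j by exact/val_inj.
  by rewrite (@row_mxEl _ 1 1 n) mxE !ord1.
rewrite (_ : (fun _ => _) = (fun x : 'rV[R]_n => x ord0 j) \o snd).
  by apply: measurableT_comp => //; exact: measurable_coord.
apply/funext => -[a x] /=.
have -> : i = @rshift 1 n j by exact/val_inj.
by rewrite (@row_mxEr _ 1 1 n).
Qed.

Let measurable_uncons n : measurable_fun setT (@uncons n).
Proof.
apply/measurable_fun_pairP; split; first exact: measurable_coord.
apply/measurable_fun_coordP => i /=.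
rewrite (_ : (fun _ => _) = fun x : 'rV[R]_n.+1 => x ord0 (rshift 1 i)).
  exact: measurable_coord.
by apply/funext => x; rewrite mxE.
Qed.

Let sigma_finite_prod n (mu : {sigma_finite_measure set 'rV[R]_n -> \bar R}) :
  sigma_finite setT (@lebesgue_measure R \x mu)%E.
Proof.
have /sigma_finiteP[F [TF ndF Foo]] := sigma_finiteT (@lebesgue_measure R).
have /sigma_finiteP[G [TG ndG Goo]] := sigma_finiteT mu.
exists (fun k => F k `*` G k).
  rewrite -setXTT TF TG predeqE => -[x y]; split=> [[/= [i _ Fx] [j _ Gy]]|].
    exists (maxn i j) => //; split.
    - by move: x Fx; exact/subsetPset/ndF/leq_maxl.
    - by move: y Gy; exact/subsetPset/ndG/leq_maxr.
  by move=> [i _ []/= Fx Gy]; split; exists i.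
move=> k; have [mF Fk] := Foo k; have [mG Gk] := Goo k.
split; first exact: measurableX.
by rewrite product_measure1E// lte_mul_pinfty// ge0_fin_numE.
Qed.

Lemma lebesgue_rV_sigma_finite n :
  exists mu : {sigma_finite_measure set 'rV[R]_n -> \bar R},
    mu = @lebesgue_rV R n :> (set 'rV[R]_n -> \bar R).
Proof.
elim: n => [|n [mu muE]] /=; first by exists \d_(0 : 'rV[R]_0).
rewrite -muE.
pose m : {measure set 'rV[R]_n.+1 -> \bar R} :=
  measure_function_pushforward__canonical__measure_function_Measure
    (lebesgue_measure \x mu)%E (@measurable_cons_rV n).
have sm : sigma_finite setT m.
  have [F FT mF] := sigma_finite_prod mu.
  exists (fun k => @uncons n @^-1` F k).
    by rewrite -preimage_bigcup -FT preimage_setT.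
  move=> k; have [mFk Fkoo] := mF k; split.
    by rewrite -[X in measurable X]setTI; exact: measurable_uncons.
  rewrite /m/= /pushforward -comp_preimage (_ : _ \o _ = id)//.
  by apply/funext => z; exact: consK.
pose b := Measure_isSigmaFinite.Build _ _ _ m sm.
pose m' : {sigma_finite_measure set 'rV[R]_n.+1 -> \bar R} :=
  HB.pack (m : set _ -> \bar R) m b.
by exists m'.
Qed.

Let lebesgue_rV0 n : @lebesgue_rV R n set0 = 0%E.
Proof. by have [mu <-] := lebesgue_rV_sigma_finite n; exact: measure0. Qed.

Let lebesgue_rV_ge0 n A : (0 <= @lebesgue_rV R n A)%E.
Proof. by have [mu <-] := lebesgue_rV_sigma_finite n; exact: measure_ge0. Qed.

Let lebesgue_rV_sigma_additive n : semi_sigma_additive (@lebesgue_rV R n).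
Proof.
have [mu <-] := lebesgue_rV_sigma_finite n.
exact: measure_semi_sigma_additive.
Qed.

Let lebesgue_rV_sigma_finiteT n : sigma_finite setT (@lebesgue_rV R n).
Proof. by have [mu <-] := lebesgue_rV_sigma_finite n; exact: sigma_finiteT. Qed.

HB.instance Definition _ n := isMeasure.Build _ _ _ (@lebesgue_rV R n)
  (@lebesgue_rV0 n) (@lebesgue_rV_ge0 n) (@lebesgue_rV_sigma_additive n).

HB.instance Definition _ n := Measure_isSigmaFinite.Build _ _ _
  (@lebesgue_rV R n) (@lebesgue_rV_sigma_finiteT n).

End lebesgue_rV_measure.

Section calculus.
Context {R : realType} {N : nat}.
Implicit Types (f : 'rV[R]_N -> R) (x y : 'rV[R]_N).

Definition dot x y : R := \sum_i x ord0 i * y ord0 i.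

Definition enorm x : R := Num.sqrt (dot x x).

Definition partial (i : 'I_N) f : 'rV[R]_N -> R := 'D_(delta_mx ord0 i) f.

Definition grad f x : 'rV[R]_N := \row_i partial i f x.

Definition C1_on (D : set 'rV[R]_N) f :=
  forall x, D x -> differentiable f x /\
    forall i, {for x, continuous (partial i f)}.

(* Every iterated partial derivative is differentiable. *)
Definition smooth f :=
  forall (s : seq 'I_N) x, differentiable (foldr partial f s) x.

Definition test_function f :=
  smooth f /\ compact (closure [set x | f x != 0]).

End calculus.

(* Open, connected, nonempty, bounded, and locally on one side of the graph of
   a C^1 function of N - 1 variables, up to relabelling (i) and reorienting (e)
   the coordinate axes. *)
Definition bounded_C1_domain {R : realType} {N : nat} (Omega : set 'rV[R]_N) :=
  [/\ open Omega, connected Omega, Omega !=set0, bounded_set Omega &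
      forall x0, (closure Omega `\` Omega) x0 ->
        exists (i : 'I_N) (e : bool) (gamma : 'rV[R]_N.-1 -> R),
          C1_on setT gamma /\
          \forall x \near x0,
            Omega x <-> gamma (col' i x) < (-1) ^+ e * x ord0 i].

Section sobolev.
Context {R : realType} {N : nat}.
Implicit Types (u : 'rV[R]_N -> R) (G : 'rV[R]_N -> 'rV[R]_N).

Local Notation leb := (@lebesgue_rV R N).

Definition locally_integrable_rV u :=
  measurable_fun setT u /\
  forall K, compact K -> leb.-integrable K (EFin \o u).

Definition is_weak_gradient u G :=
  forall i, locally_integrable_rV (fun x => G x ord0 i) /\
    forall phi, test_function phi ->
      \int[leb]_x (u x * partial i phi x) = - \int[leb]_x (G x ord0 i * phi x).

(* A chosen representative; weak gradients are unique up to null sets. *)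
Definition weak_grad u : 'rV[R]_N -> 'rV[R]_N :=
  xget (fun=> 0) [set G | is_weak_gradient u G].

Definition W1p (p : R) u :=
  [/\ u \in Lfun leb p%:E, exists G, is_weak_gradient u G &
      forall i, (fun x => weak_grad u x ord0 i) \in Lfun leb p%:E].

Definition W01p (p : R) (Omega : set 'rV[R]_N) u :=
  W1p p u /\ {ae leb, forall x, ~ Omega x -> u x = 0}.

End sobolev.

Section operators.
Context {R : realType} {N : nat}.
Implicit Types (H u phi : 'rV[R]_N -> R) (Omega : set 'rV[R]_N) (p s : R).

Local Notation leb := (@lebesgue_rV R N).

Definition finsler_minkowski H :=
  [/\ (forall x, 0 <= H x),
      C1_on (~` [set 0]) H,
      (forall x, H x = 0 <-> x = 0) &
      (forall t x, H (t *: x) = `|t| * H x)] /\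
  (exists C1 C2 : R, [/\ 0 < C1, 0 < C2 &
      forall x, C1 * enorm x <= H x <= C2 * enorm x]) /\
  (forall x y, free [:: x; y] -> H (x + y) < H x + H y).

Definition finsler_field H p (xi : 'rV[R]_N) : 'rV[R]_N :=
  if xi == 0 then 0 else (H xi `^ (p - 1)) *: grad H xi.

Definition local_form H p Omega u phi : R :=
  \int[leb]_(x in Omega)
    dot (finsler_field H p (weak_grad u x)) (weak_grad phi x).

(* The density of d mu is written inside the integral; on the null set x = y,
   where it is infinite, the library value 0 `^ (- _) = 0 is used. *)
Definition nonlocal_form p s u phi : R :=
  \int[(leb \x leb)%E]_z
    (`|u z.1 - u z.2| `^ (p - 2) * (u z.1 - u z.2) * (phi z.1 - phi z.2)
      * enorm (z.1 - z.2) `^ (- (N%:R + p * s))).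

Definition weak_le H p s Omega u v :=
  forall phi, W01p p Omega phi -> {ae leb, forall x, 0 <= phi x} ->
    local_form H p Omega u phi + nonlocal_form p s u phi
    <= local_form H p Omega v phi + nonlocal_form p s v phi.

End operators.

(* Main.v *)
Require Import Defs.
From mathcomp Require Import all_boot all_order all_algebra.
From mathcomp Require Import all_classical all_reals all_analysis.
From mathcomp Require Import measurable_realfun ring lra.

(** Write w = u - v and test the inequality with phi = (u - v)^+ = (w + |w|) / 2.
    This function is nonnegative, and it vanishes outside Omega because u <= v
    there. The inequality then says that the sum of two differences, a local one
    and a nonlocal one, is at most 0, and each of them is nonnegative.

    The local difference is the integral over Omega of
    (A(grad u) - A(grad v)) . grad phi, with A(xi) = H(xi)^(p-1) grad H(xi).
    Since grad phi = ((1 + sg w) / 2) (grad u - grad v), a nonnegative multiple of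
    grad u - grad v, the integrand is nonnegative by the monotonicity of A
    (finsler_monotone), a consequence of A(xi) . xi = H(xi)^p and
    A(xi) . eta <= H(xi)^(p-1) H(eta).

    In the nonlocal difference the kernel multiplies
    (J(a - b) - J(c - d)) (f(a - c) - f(b - d)), where (a, b) and (c, d) are the
    values of u and v at (x, y), J(t) = |t|^(p-2) t is increasing and f(t) = t^+
    is nondecreasing. The two factors have the same sign, and the product vanishes
    only if phi x = phi y (pfield_pos_part). Both differences are therefore 0, so
    phi x = phi y for almost all (x, y). As phi = 0 on the complement of the
    bounded set Omega, which has positive measure, phi = 0 almost everywhere
    (ae_diff_eq0), that is, u <= v.

    Two facts about W^{1,p} make the argument legitimate: that phi belongs to it,
    with the gradient above, and that the double integrals converge absolutely, so
    that their difference is the integral of the difference. Both come from one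
    identity: if g is the weak i-th derivative of w, then for almost every x
      w(x + h e_i) - w(x) = h * (the average of g on the segment [x, x + h e_i])
    (weakD_line). It is proved by testing the weak derivative with segment
    averages of products of one-variable functions, which are again such products;
    these products are sufficient to recognize a null function
    (fundamental_lemma).
    - With the Jensen inequality it bounds the L^p norm of a translation increment
      by |h| times that of the gradient (pint_translate); summing over dyadic
      scales gives the finiteness of the Gagliardo seminorm (gagliardo_finite),
      and the Young inequality the integrability of the nonlocal density
      (integrable_nonlocal).
    - It also gives the chain rule for |w| (weakD_abs), through difference
      quotients of the smooth approximations sqrt(w^2 + eps^2) - eps. *)

Set Implicit Arguments.
Unset Strict Implicit.
Unset Printing Implicit Defensive.

Import Order.TTheory GRing.Theory Num.Theory.
Import numFieldNormedType.Exports.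

Local Open Scope classical_set_scope.
Local Open Scope ring_scope.

(** * Lebesgue measure on row vectors *)

Lemma lebesgue_measure_shift {R : realType} (a : R) (A : set R) : measurable A ->
  lebesgue_measure ((fun t => t + a) @^-1` A) = lebesgue_measure A.
Proof.
move=> mA.
have mf : measurable_fun setT (fun t : measurableTypeR R => t + a : measurableTypeR R).
  exact: measurable_funD.
pose m := measure_function_pushforward__canonical__measure_function_Measure
  (@lebesgue_measure R) mf.
rewrite -[LHS]/(m A); apply/esym/(@lebesgue_measure_unique R m) => //= _ [[c d]] _ <-.
rewrite /m/= /pushforward.
have -> : ((fun t : R => t + a) @^-1` `]c, d]) = `]c - a, d - a]%classic.
  by apply/seteqP; split=> x /=; rewrite !in_itv/=; lra.
rewrite !lebesgue_measure_itv/= !lte_fin ltrBlDr subrK -!EFinB.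
by case: ifP => // _; congr (_%:E); ring.
Qed.

Section translation.
Context {R : realType}.

Lemma lebesgue_rVS_integral n (f : 'rV[R]_n.+1 -> \bar R) :
  measurable_fun setT f -> (forall x, (0 <= f x)%E) ->
  (\int[@lebesgue_rV R n.+1]_x f x =
   \int[lebesgue_measure]_a \int[@lebesgue_rV R n]_x f (cons_rV (a, x)))%E.
Proof.
move=> mf f0.
have mc := @measurable_cons_rV R n.
rewrite (_ : (\int[lebesgue_rV (n:=n.+1)]_x f x)%E = (\int[pushforward
   (lebesgue_measure \x @lebesgue_rV R n)%E (@cons_rV R n)]_x f x)%E) //.
rewrite ge0_integral_pushforward//= preimage_setT.
by rewrite fubini_tonelli1//=; exact: measurableT_comp.
Qed.
End translation.

Section measure_preserving.
Context {d} {X : measurableType d} {R : realType}.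
Variables (mu : {measure set X -> \bar R}) (T : X -> X).
Hypothesis mT : measurable_fun setT T.
Hypothesis HT : forall A, measurable A -> mu (T @^-1` A) = mu A.

Lemma preserving_ge0_integral (f : X -> \bar R) : measurable_fun setT f ->
  (forall x, (0 <= f x)%E) -> (\int[mu]_x f (T x) = \int[mu]_x f x)%E.
Proof.
move=> mf f0; transitivity (\int[pushforward mu T]_x f x)%E.
  by rewrite ge0_integral_pushforward//= preimage_setT.
apply: eq_measure_integral => A mA _; exact: HT.
Qed.

Lemma preserving_integral (f : X -> \bar R) : measurable_fun setT f ->
  (\int[mu]_x f (T x) = \int[mu]_x f x)%E.
Proof.
move=> mf; rewrite [LHS]integralE [RHS]integralE; congr (_ - _)%E.
  rewrite -[RHS]preserving_ge0_integral//; last exact: measurable_funepos.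
  by apply: eq_integral => x _; rewrite !funeposE.
rewrite -[RHS]preserving_ge0_integral//; last exact: measurable_funeneg.
by apply: eq_integral => x _; rewrite !funenegE.
Qed.

Lemma preserving_integrable (f : X -> \bar R) :
  mu.-integrable setT f -> mu.-integrable setT (f \o T).
Proof.
move=> /integrableP[mf fi]; apply/integrableP; split.
  exact: measurableT_comp.
rewrite (le_lt_trans _ fi)//.
by rewrite -[leRHS]preserving_ge0_integral//; exact: measurableT_comp.
Qed.

End measure_preserving.

Lemma cons_rV_add {R : realType} n (a b : R) (x y : 'rV[R]_n) :
  cons_rV (a, x) + cons_rV (b, y) = cons_rV (a + b, x + y).
Proof.
apply: (etrans (@add_row_mx _ 1 1 n a%:M x b%:M y)).
by rewrite /cons_rV /= -raddfD.
Qed.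

Lemma cons_rV_surj {R : realType} n (c : 'rV[R]_n.+1) :
  exists a x, c = cons_rV (a, x).
Proof.
exists ((@lsubmx R 1 1 n c) ord0 ord0), (@rsubmx R 1 1 n c).
rewrite /cons_rV /=; apply: (etrans (esym (@hsubmxK R 1 1 n c))).
congr (@row_mx R 1 1 n _ _).
by apply/matrixP => i j; rewrite !ord1 [RHS]mxE mulr1n.
Qed.

Lemma measurable_addr_rV {R : realType} n (c : 'rV[R]_n) :
  measurable_fun setT (fun x : 'rV[R]_n => x + c).
Proof.
apply/measurable_fun_coordP => i.
rewrite (_ : (fun _ => _) = fun x : 'rV[R]_n => x ord0 i + c ord0 i).
  by apply: measurable_funD => //; exact: measurable_coord.
by apply/funext => x; rewrite mxE.
Qed.

(** By induction on the dimension: the measure is an iterated product, so the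
    translation acts first in the remaining coordinates, then in the leading one. *)
Lemma lebesgue_rV_shift {R : realType} n (c : 'rV[R]_n) (A : set 'rV[R]_n) :
  measurable A -> lebesgue_rV ((fun x => x + c) @^-1` A) = lebesgue_rV A.
Proof.
elim: n c A => [|n IH] c A mA.
  rewrite (_ : (fun x => x + c) = id)//.
  by apply/funext => x; apply/rowP => -[].
have mS := measurable_addr_rV c.
have mA' : measurable ((fun x => x + c) @^-1` A).
  by rewrite -[X in measurable X]setTI; exact: mS.
rewrite -[_ @^-1` A]setIT -[A in RHS]setIT -!integral_indic//.
rewrite [LHS]lebesgue_rVS_integral; first last.
- by move=> x; rewrite lee_fin.
- exact/measurable_EFinP/measurable_indic.
rewrite [RHS]lebesgue_rVS_integral; first last.
- by move=> x; rewrite lee_fin.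
- exact/measurable_EFinP/measurable_indic.
have [a [y ->]] := cons_rV_surj c.
have mf : measurable_fun setT
    (fun z : measurableTypeR R * 'rV[R]_n => (\1_A (cons_rV z))%:E : \bar R).
  apply/measurable_EFinP; apply: (measurableT_comp _ (@measurable_cons_rV R n)).
  exact: measurable_indic.
pose F b := (\int[lebesgue_rV (n:=n)]_x (\1_A (cons_rV (b, x)))%:E)%E.
transitivity (\int[lebesgue_measure]_b F (b + a)%R)%E.
  apply: eq_integral => b _.
  rewrite /F -[RHS](@preserving_integral _ _ _ (@lebesgue_rV R n) (fun x : 'rV[R]_n => x + y)) //.
  - by apply: eq_integral => x _; rewrite !indicE /= -cons_rV_add.
  - exact: measurable_addr_rV.
  - by move=> B mB; exact: IH.
  - exact: measurableT_comp mf (measurable_pair1 _).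
rewrite (@preserving_ge0_integral _ _ _ lebesgue_measure (fun b : measurableTypeR R => b + a : measurableTypeR R))//.
- exact: measurable_funD.
- by move=> B mB; exact: lebesgue_measure_shift.
- by apply: (measurable_fun_fubini_tonelli_F (fun z => (\1_A (cons_rV z))%:E)) => // z; rewrite lee_fin.
- by move=> b; apply: integral_ge0 => x _; rewrite lee_fin.
Qed.

Definition cube {R : realType} n (r : R) := [set x : 'rV[R]_n | `|x| <= r].
Arguments cube {R} n r _.

Section cube.
Context {R : realType}.

Lemma ler_norm_rV n (x : 'rV[R]_n) r : 0 <= r ->
  (`|x| <= r) = [forall i, `|x ord0 i| <= r].
Proof.
move=> r0; have -> : `|x| = \big[Num.max/0]_ij `|x ij.1 ij.2|.
  by rewrite [LHS]/Num.norm/= mx_normrE.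
apply/bigmax_leP/forallP => /=.
  by move=> [_ h] i; exact: (h (ord0, i) isT).
by move=> h; split => // -[i j] _ /=; rewrite (ord1 i).
Qed.

Lemma norm_coord_le n (x : 'rV[R]_n) i : `|x ord0 i| <= `|x|.
Proof. by have := lexx `|x|; rewrite {1}(ler_norm_rV x)// => /forallP. Qed.

Lemma cubeE n (r : R) : 0 <= r ->
  cube n r = [set x : 'rV[R]_n | forall i, `|x ord0 i| <= r].
Proof.
move=> r0; apply/seteqP; split => x; rewrite /cube/= ler_norm_rV//.
  by move/forallP.
by move=> ?; apply/forallP.
Qed.

Lemma measurable_norm_rV n : measurable_fun setT (fun x : 'rV[R]_n => `|x|).
Proof.
have -> : (fun x : 'rV[R]_n => `|x|) =
    (fun x => \big[Num.max/0]_(i < n) `|x ord0 i|).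
  apply/funext => x; apply/eqP; rewrite eq_le; apply/andP; split.
    rewrite ler_norm_rV; last by apply: bigmax_ge_id.
    by apply/forallP => i; apply: le_bigmax.
  by apply/bigmax_leP; split => // i _; exact: norm_coord_le.
elim: (index_enum _) => [|i s IH].
  by under eq_fun do rewrite big_nil; exact: measurable_cst.
under eq_fun do rewrite big_cons.
apply: measurable_maxr => //.
by apply: measurableT_comp => //; exact: measurable_coord.
Qed.

Lemma measurable_cube n (r : R) : measurable (cube n r).
Proof.
rewrite /cube; have -> : [set x : 'rV[R]_n | `|x| <= r] =
   (fun x => `|x|) @^-1` `]-oo, r] by apply/seteqP; split => x; rewrite /= in_itv.
by rewrite -[X in measurable X]setTI; exact: measurable_norm_rV.
Qed.

Lemma cube_cons n (r a : R) (x : 'rV[R]_n) : 0 <= r ->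
  cube n.+1 r (cons_rV (a, x)) <-> (-r <= a <= r /\ cube n r x).
Proof.
move=> r0; rewrite !cubeE//=; split.
  move=> h; split.
    by have := h (@lshift 1 n ord0); rewrite (@row_mxEl _ 1 1 n) mxE mulr1n ler_norml.
  by move=> i; have := h (@rshift 1 n i); rewrite (@row_mxEr _ 1 1 n).
move=> [h1 h2] i; case: (@splitP 1 n i) => j ij.
  have -> : i = @lshift 1 n j by exact/val_inj.
  by rewrite (@row_mxEl _ 1 1 n) mxE !ord1 mulr1n ler_norml.
have -> : i = @rshift 1 n j by exact/val_inj.
by rewrite (@row_mxEr _ 1 1 n).
Qed.

Lemma lebesgue_cube n (r : R) : 0 <= r -> lebesgue_rV (cube n r) = ((2 * r) ^+ n)%:E.
Proof.
move=> r0; elim: n => [|n IH].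
  by rewrite /= expr0 diracE mem_set//= /cube/= normr0.
rewrite /= /pushforward.
have -> : @cons_rV R n @^-1` cube n.+1 r = `[-r, r]%classic `*` cube n r.
  apply/seteqP; split=> -[a x] /=; rewrite in_itv/=.
    by move/(cube_cons a x r0).
  by move=> [? ?]; apply/(cube_cons a x r0).
rewrite product_measure1E//; last exact: measurable_cube.
rewrite [X in (_ * X)%E]IH. rewrite [X in (X * _)%E](lebesgue_measure_itv `[-r, r])/= lte_fin.
case: ltP => h.
  by rewrite -EFinB -EFinM exprS; congr (_%:E); ring.
have -> : r = 0 by lra.
by rewrite mul0e mulr0 exprS mul0r.
Qed.

(** The sigma-algebra is generated by the coordinates, so openness enters only
    through second countability: an open set is the union of the countably many
    closed cubes with rational centre and radius 1 / (k + 1) that it contains. *)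
Lemma open_measurable_rV n (A : set 'rV[R]_n) : open A -> measurable A.
Proof.
move=> oA.
pose Q (q : 'rV[rat]_n) (k : nat) : set 'rV[R]_n :=
  (fun x => x - map_mx ratr q) @^-1` cube n k.+1%:R^-1.
have -> : A = \bigcup_(z in [set z : 'rV[rat]_n * nat | Q z.1 z.2 `<=` A]) Q z.1 z.2.
  apply/seteqP; split => x; last by move=> [z /= h] /h.
  move=> Ax; have : nbhs x A by move: oA; rewrite openE; exact.
  move=> /nbhs_ballP[e /= e0 xe].
  have [k ke] : exists k, k.+1%:R^-1 < e / 2.
    exists (Num.truncn (e / 2)^-1).
    rewrite invf_plt ?posrE//; last by lra.
    by rewrite truncnS_gt.
  have [q hq] : exists q : 'rV[rat]_n, forall i, `|x ord0 i - ratr (q ord0 i)| < k.+1%:R^-1.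
    have h i : exists q : rat, `|x ord0 i - ratr q| < k.+1%:R^-1.
      have k0 : x ord0 i - k.+1%:R^-1 < x ord0 i + k.+1%:R^-1.
        by rewrite ltrD2l gtrN// invr_gt0.
      have [q /=] := rat_in_itvoo k0.
      by rewrite in_itv/= => h; exists q; rewrite ltr_distlC.
    have [f fh] := choice h.
    by exists (\row_i f i) => i; rewrite mxE.
  exists (q, k) => /=; last first.
    rewrite /Q /= cubeE//= => i.
    by rewrite !mxE ltW.
  move=> y; rewrite /Q /cube /= => yq; apply: xe.
  rewrite mx_norm_ball /ball_/=.
  have xq : `|x - map_mx ratr q| <= k.+1%:R^-1.
    by rewrite ler_norm_rV//; apply/forallP => i; rewrite !mxE ltW.
  rewrite (_ : x - y = (x - map_mx ratr q) - (y - map_mx ratr q)).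
    by rewrite (le_lt_trans (ler_normB _ _))// (splitr e) ltrD// (le_lt_trans _ ke).
  by rewrite opprB addrA subrK.
rewrite bigcup_mkcond; apply: countable_bigcupT_measurable.
  exact: countableP.
move=> z; case: ifP => // _; rewrite /Q -[X in measurable X]setTI.
by apply: measurable_addr_rV => //; exact: measurable_cube.
Qed.

Lemma continuous_measurable_rV n (A : set 'rV[R]_n) (f : 'rV[R]_n -> R) : open A ->
  (forall x, A x -> {for x, continuous f}) -> measurable_fun A f.
Proof.
move=> oA cf; apply: (measurability _ (RGenOpens.measurableE R)).
move=> _ [_ [a [b ->] <-]].
apply: open_measurable_rV.
rewrite openE => x [Ax fx]; apply: filterI.
  by move: oA; rewrite openE => /(_ _ Ax).
apply: (cf _ Ax); apply: open_nbhs_nbhs; split => //.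
Qed.

End cube.

Section lebesgue_shift.
Context {R : realType} {n : nat}.
Notation leb := (@lebesgue_rV R n).
Variable c : 'rV[R]_n.

Lemma shift_ge0_integral (f : 'rV[R]_n -> \bar R) : measurable_fun setT f ->
  (forall x, (0 <= f x)%E) -> (\int[leb]_x f (x + c)%R = \int[leb]_x f x)%E.
Proof.
exact: (preserving_ge0_integral (measurable_addr_rV c)
  (@lebesgue_rV_shift R n c)).
Qed.

Lemma shift_integral (f : 'rV[R]_n -> \bar R) : measurable_fun setT f ->
  (\int[leb]_x f (x + c)%R = \int[leb]_x f x)%E.
Proof.
exact: (preserving_integral (measurable_addr_rV c) (@lebesgue_rV_shift R n c)).
Qed.

Lemma shift_Rintegral (f : 'rV[R]_n -> R) : measurable_fun setT f ->
  \int[leb]_x f (x + c) = \int[leb]_x f x.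
Proof.
move=> mf; rewrite /Rintegral (@shift_integral (EFin \o f))//.
exact/measurable_EFinP.
Qed.

Lemma shift_integrable (f : 'rV[R]_n -> \bar R) : leb.-integrable setT f ->
  leb.-integrable setT (fun x => f (x + c)).
Proof.
exact: (preserving_integrable (measurable_addr_rV c)
  (@lebesgue_rV_shift R n c)).
Qed.

End lebesgue_shift.

(** * Smooth tensor products *)

Section flat.
Context {R : realType}.

(** All the derivatives of exp (-1/x), continued by 0, are linear combinations of
    these functions, which is why the power of 1/x is a parameter. *)
Definition flat (k : nat) (x : R) : R :=
  if 0 < x then (x^-1) ^+ k * expR (- x^-1) else 0.

Lemma flat_ge0 k x : 0 <= flat k x.
Proof.
rewrite /flat; case: ifP => // x0.
by rewrite mulr_ge0// ?expR_ge0// exprn_ge0// invr_ge0 ltW.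
Qed.

(** This is y^(k+1) / (k+1)! <= e^y at y = 1/x: the bound that makes the
    difference quotient at 0 tend to 0. *)
Lemma flat_le k (x : R) : 0 < x -> flat k x <= (k.+1)`!%:R * x.
Proof.
move=> x0; rewrite /flat x0 expRN.
have y0 : 0 <= x^-1 by rewrite invr_ge0 ltW.
rewrite ler_pdivrMr ?expR_gt0//.
have := expR_ge1Dxn k y0.
rewrite -(@ler_pM2l _ ((k.+1)`!%:R * x)); last first.
  by rewrite mulr_gt0// ltr0n fact_gt0.
apply: le_trans.
rewrite mulrDr mulr1 [X in _ + X](_ : _ = x^-1 ^+ k).
  by rewrite lerDr mulr_ge0// ltW.
have : (k.+1)`!%:R != 0 :> R by rewrite pnatr_eq0 -lt0n fact_gt0.
move: (k.+1)`!%:R => F F0; rewrite exprS; field.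
by rewrite F0 gt_eqF.
Qed.

Lemma is_derive_flat k (x : R) :
  is_derive x 1 (flat k) (flat k.+2 x - k%:R * flat k.+1 x).
Proof.
have [x0|x0|->] := ltgtP x 0.
- have -> : flat k.+2 x - k%:R * flat k.+1 x = 0.
    by rewrite /flat ltNge ltW//= mulr0 subr0.
  apply: (@near_eq_is_derive _ _ _ (cst 0)) => //.
    near=> y; rewrite /flat ltNge ltW//=; near: y; exact: lt_nbhsl.
- have h : is_derive x 1 (fun y : R => (y^-1) ^+ k * expR (- y^-1))
      (flat k.+2 x - k%:R * flat k.+1 x).
    have xn0 : x != 0 by rewrite gt_eqF.
    have d1 : is_derive x 1 (fun y : R => y^-1) (- x ^- 2).
      split; first exact: derivableV.
      rewrite (@deriveV _ _ (fun y : R => y))// derive_id /GRing.scale/=.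
      by rewrite mulr1.
    have d2 := is_deriveX (f:=fun y : R => y^-1) k d1.
    have d3 := is_derive1_comp (is_derive_expR _) (is_deriveN d1).
    have d4 := is_deriveM d2 d3.
    have -> : (fun y : R => (y^-1) ^+ k * expR (- y^-1)) =
        (fun y : R => y^-1) ^+ k * (expR \o - (fun y : R => y^-1)).
      by apply/funext => y; rewrite !fctE.
    apply: (is_derive_eq d4).
    rewrite /flat x0 /GRing.scale/= ?fctE/=.
    rewrite -exprVn; set E := expR _; set y := x^-1.
    by clearbody E y; case: k {d2 d4} => [|k]; rewrite !exprS; ring.
  apply: near_eq_is_derive h.
    near=> y; rewrite /flat ifT//; near: y; exact: lt_nbhsr.
- have -> : flat k.+2 (0 : R) - k%:R * flat k.+1 (0 : R) = 0.
    by rewrite /flat ltxx mulr0 subr0.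
  have h : (fun h : R => h^-1 *: ((flat k \o shift 0) (h *: (1 : R)) - flat k 0)) @ 0^' --> (0 : R).
    apply/cvgr0Pnorm_lt => e e0; near=> h.
    rewrite /= addr0 /flat ltxx subr0 [h *: 1]mulr1.
    have h0 : h != 0 by near: h; exact: nbhs_dnbhs_neq.
    have [hp|hp] := ltP 0 h; last by rewrite /GRing.scale/= mulr0 normr0.
    have he : h < e / (k.+2)`!%:R.
      have : `|h| < e / (k.+2)`!%:R.
        near: h; apply: dnbhs0_lt; rewrite divr_gt0// ltr0n fact_gt0//.
      by rewrite gtr0_norm.
    have := flat_le k.+1 hp.
    rewrite ger0_norm; last first.
      by rewrite /GRing.scale/= !mulr_ge0// ?expR_ge0 ?exprn_ge0 ?invr_ge0// ltW.
    rewrite /flat hp exprS -mulrA => /le_lt_trans; apply.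
    by rewrite mulrC -ltr_pdivlMr// ltr0n fact_gt0.
  split; first by apply/cvg_ex; exists 0.
  exact: cvg_lim.
Unshelve. all: by end_near. Qed.

End flat.

Section smooth1.
Context {R : realType}.

(** A class that contains the bump functions and is closed under differentiation
    by its syntax, so that no n-th derivative has to be computed. *)
Inductive flat_alg : (R -> R) -> Prop :=
| flat_alg_flat k a b : flat_alg (fun x => flat k (a * x + b))
| flat_alg_cst c : flat_alg (fun=> c)
| flat_algD f g : flat_alg f -> flat_alg g -> flat_alg (fun x => f x + g x)
| flat_algM f g : flat_alg f -> flat_alg g -> flat_alg (fun x => f x * g x).

Lemma is_derive_affine (a b x : R) : is_derive x 1 (fun x => a * x + b) a.
Proof.
have h := is_deriveD (is_deriveZ a (is_derive_id x (1 : R)))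
  (is_derive_cst b x (1 : R)).
by apply: (is_derive_eq h); rewrite addr0 /GRing.scale/= mulr1.
Qed.

Lemma flat_alg_derive f : flat_alg f ->
  exists2 f', flat_alg f' & forall x : R, is_derive x 1 f (f' x).
Proof.
elim=> {f} [k a b|c|f g _ [f' Af df] _ [g' Ag dg]|f g Af0 [f' Af df] Ag0 [g' Ag dg]].
- exists (fun x => (flat k.+2 (a * x + b) + - k%:R * flat k.+1 (a * x + b)) * a).
    by do !constructor.
  move=> x; rewrite mulNr; apply: is_derive1_comp.
    exact: is_derive_flat.
  exact: is_derive_affine.
- exists (fun=> 0); first by constructor.
  by move=> x; exact: is_derive_cst.
- exists (fun x => f' x + g' x); first by constructor.
  by move=> x; exact: is_deriveD.
- exists (fun x => f x * g' x + g x * f' x); first by do !constructor.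
  by move=> x; exact: is_deriveM.
Qed.

Lemma flat_alg_shift f c : flat_alg f -> flat_alg (fun x => f (x + c)).
Proof.
elim=> {f} [k a b|d|f g _ Af _ Ag|f g _ Af _ Ag]; try by constructor.
rewrite (_ : (fun x => _) = (fun x => flat k (a * x + (a * c + b)))).
  by constructor.
by apply/funext => x; rewrite mulrDr addrA.
Qed.

(** Smoothness as membership in a set of functions that is stable under
    differentiation: adding an antiderivative to such a set keeps it stable. *)
Definition smooth1 (f : R -> R) := exists S : set (R -> R), S f /\
  forall g, S g -> exists2 g', S g' & forall x : R, is_derive x 1 g (g' x).

Lemma flat_alg_smooth f : flat_alg f -> smooth1 f.
Proof. by move=> Af; exists flat_alg; split => // g /flat_alg_derive. Qed.

Lemma smooth1_derive f : smooth1 f ->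
  exists2 f', smooth1 f' & forall x : R, is_derive x 1 f (f' x).
Proof.
move=> [S [Sf SS]]; have [f' Sf' df] := SS _ Sf.
by exists f' => //; exists S.
Qed.

Lemma smooth1_antiderivative f F : smooth1 f ->
  (forall x : R, is_derive x 1 F (f x)) -> smooth1 F.
Proof.
move=> [S [Sf SS]] dF; exists (S `|` [set F]); split; first by right.
move=> g [/SS[g' Sg' dg]|->]; first by exists g' => //; left.
by exists f => //; left.
Qed.

Lemma smooth1_continuous f : smooth1 f -> continuous f.
Proof.
move=> /smooth1_derive[f' _ df] x.
apply: differentiable_continuous; apply/derivable1_diffP.
by have [] := df x.
Qed.

End smooth1.

Section tensor.
Context {R : realType} {N : nat}.
Implicit Types F G : 'I_N -> R -> R.

Definition tensor F (x : 'rV[R]_N) : R := \prod_i F i (x ord0 i).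

Lemma is_derive_line (f : 'rV[R]_N -> R) x v d :
  is_derive (0 : R) 1 (fun h : R => f (h *: v + x)) d -> is_derive x v f d.
Proof.
move=> [df dE]; split; first exact/derivable1P.
rewrite -dE /derive; set g1 := fun h => h^-1 *: _; set g2 := fun h => h^-1 *: _.
suff -> : g1 = g2 by [].
by apply/funext => h; rewrite /g1 /g2 /= addr0 scale0r add0r [_%:A]mulr1.
Qed.

Lemma differentiable_tensor F x :
  (forall i (t : R), derivable (F i) t 1) -> differentiable (tensor F) x.
Proof.
move=> dF; rewrite /tensor; elim: (index_enum _) => [|i s IH].
  by under eq_fun do rewrite big_nil; exact: (differentiable_cst (1 : R) x).
under eq_fun do rewrite big_cons.
apply: differentiableM => //.
apply: differentiable_comp; first exact: differentiable_coord.
by apply/derivable1_diffP; exact: dF.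
Qed.

Definition set_factor F i (g : R -> R) : 'I_N -> R -> R :=
  fun j => if j == i then g else F j.

Lemma tensor_set_factor F i g x :
  tensor (set_factor F i g) x = g (x ord0 i) * \prod_(j | j != i) F j (x ord0 j).
Proof.
rewrite /tensor (bigD1 i)//= /set_factor eqxx; congr (_ * _).
by apply: eq_bigr => j /negbTE ->.
Qed.

Lemma tensor_split F i x :
  tensor F x = F i (x ord0 i) * \prod_(j | j != i) F j (x ord0 j).
Proof. by rewrite /tensor (bigD1 i). Qed.

(** Only the i-th factor depends on the i-th coordinate, so a partial derivative
    of a product of one-variable functions is again such a product. This is what
    makes these products test functions. *)
Lemma is_derive_tensor F i g x : (forall t : R, is_derive t 1 (F i) (g t)) ->
  is_derive x (delta_mx ord0 i) (tensor F) (tensor (set_factor F i g) x).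
Proof.
move=> dF; apply: is_derive_line.
set C := \prod_(j | j != i) F j (x ord0 j).
rewrite (_ : (fun h => _) = C \*: (F i \o (fun h => 1 * h + x ord0 i))).
  rewrite tensor_set_factor -/C.
  have h := is_deriveZ C (@is_derive1_comp _ (F i) (fun h => 1 * h + x ord0 i) 0
    _ _ (dF (1 * 0 + x ord0 i)) (is_derive_affine 1 (x ord0 i) 0)).
  apply: (is_derive_eq h).
  by rewrite /GRing.scale/= !mul1r add0r mulr1 mulrC.
apply/funext => h /=; rewrite (tensor_split _ i) /GRing.scale/= mulrC; congr (_ * _).
  by apply: eq_bigr => j ji; rewrite !mxE/= (negbTE ji) mulr0 add0r.
by rewrite !mxE !eqxx mulr1 mul1r.
Qed.

Lemma partial_tensor F i g : (forall t : R, is_derive t 1 (F i) (g t)) ->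
  partial i (tensor F) = tensor (set_factor F i g).
Proof.
by move=> dF; apply/funext => x; have [_] := is_derive_tensor x dF.
Qed.

Lemma smooth_tensor F : (forall i, smooth1 (F i)) -> smooth (tensor F).
Proof.
move=> sF s; suff [G sG ->] : exists2 G, (forall i, smooth1 (G i)) &
    foldr partial (tensor F) s = tensor G.
  move=> x; apply: differentiable_tensor => i t.
  by have [f' _ df] := smooth1_derive (sG i); have [] := df t.
elim: s => [|i s [G sG IH]] /=; first by exists F.
have [g sg dg] := smooth1_derive (sG i).
exists (set_factor G i g); last by rewrite IH (partial_tensor dg).
by move=> j; rewrite /set_factor; case: ifP.
Qed.

Lemma closed_cube r : closed (cube N r : set 'rV[R]_N).
Proof.
rewrite (_ : cube N r = (fun x => `|x|) @^-1` [set t | t <= r])//.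
by apply: closed_comp; [move=> x _; exact: norm_continuous | exact: closed_le].
Qed.

Lemma compact_cube r : compact (cube N r : set 'rV[R]_N).
Proof.
apply: bounded_closed_compact; last exact: closed_cube.
exists r; split; first exact: num_real.
by move=> M rM x /= xr; rewrite (le_trans xr)// ltW.
Qed.

Lemma closure_support r (f : 'rV[R]_N -> R) : (forall x, f x != 0 -> cube N r x) ->
  closure [set x | f x != 0] `<=` cube N r.
Proof.
move=> fr; have := closed_cube (r:=r) => /closure_id ->.
exact: closure_subset.
Qed.

Lemma test_tensor F r : 0 <= r -> (forall i, smooth1 (F i)) ->
  (forall i t, F i t != 0 -> `|t| <= r) -> test_function (tensor F).
Proof.
move=> r0 sF Fr; split; first exact: smooth_tensor.
apply: (@subclosed_compact _ _ (cube N r)).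
- exact: closed_closure.
- exact: compact_cube.
- apply: closure_support => x; rewrite cubeE// => Tx i; apply: (Fr i).
  apply: contra_neq Tx => Fx; rewrite (tensor_split _ i) Fx mul0r//.
Qed.

End tensor.

(** * The fundamental lemma of the calculus of variations *)

Section boxes.
Context {R : realType} {N : nat}.
Notation leb := (@lebesgue_rV R N).
Implicit Types a b : 'rV[R]_N.

Definition obox a b := [set x : 'rV[R]_N | forall i, a ord0 i < x ord0 i < b ord0 i].

Lemma measurable_obox a b : measurable (obox a b).
Proof.
rewrite (_ : obox a b = \bigcap_(i in [set: 'I_N])
   ((fun x : 'rV[R]_N => x ord0 i) @^-1` `]a ord0 i, b ord0 i[)).
  apply: fin_bigcap_measurable => // i _.
  by rewrite -[X in measurable X]setTI; exact: measurable_coord.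
apply/seteqP; split => x h i; [move=> _|].
  by rewrite /= in_itv/=; exact: h.
by have := h i I; rewrite /= in_itv.
Qed.

Lemma oboxI a b a' b' : obox a b `&` obox a' b' =
  obox (\row_i Num.max (a ord0 i) (a' ord0 i))
       (\row_i Num.min (b ord0 i) (b' ord0 i)).
Proof.
apply/seteqP; split => x.
  move=> [h h'] i; rewrite !mxE gt_max lt_min.
  by case/andP: (h i) => h1 h2; case/andP: (h' i) => h3 h4; rewrite h1 h2 h3 h4.
by move=> h; split=> i; have := h i; rewrite !mxE gt_max lt_min;
  move=> /andP[/andP[h1 h2] /andP[h3 h4]]; rewrite ?h1 ?h2 ?h3 ?h4.
Qed.

Definition oboxes := [set A | exists a b, A = obox a b].

(** The open boxes are stable under intersection, so by this equality a property of
    Borel sets that is stable under Dynkin operations propagates from the boxes. *)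
Lemma measurable_oboxes : @measurable _ 'rV[R]_N = <<s oboxes >>.
Proof.
apply/seteqP; split => A; last first.
  move: A; apply: smallest_sub; first exact: sigma_algebra_measurable.
  by move=> _ [a [b ->]]; exact: measurable_obox.
move=> mA.
pose T := g_sigma_algebraType oboxes.
have mid : measurable_fun [set: T] (fun x : T => x : 'rV[R]_N).
  apply/measurable_fun_coordP => i.
  apply: (measurability _ (RGenOpens.measurableE R)) => _ [_ [c [d ->] <-]].
  rewrite setTI.
  rewrite (_ : _ @^-1` _ = \bigcup_k (obox
    (\row_j if j == i then c else - k%:R) (\row_j if j == i then d else k%:R))).
    apply: bigcup_measurable => k _; apply: sub_sigma_algebra.
    by do 2 eexists; reflexivity.
  apply/seteqP; split => x /=; rewrite in_itv/=.
    move=> cxd; exists (Num.truncn `|x : 'rV[R]_N|).+1 => // j.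
    rewrite !mxE; case: eqVneq => [->//|_].
    by rewrite -ltr_norml (le_lt_trans (norm_coord_le _ _))// truncnS_gt.
  by move=> [k _ /(_ i)]; rewrite !mxE eqxx.
by have := mid measurableT A mA; rewrite setTI.
Qed.

Lemma setI_closed_oboxes : setI_closed oboxes.
Proof.
move=> _ _ [a [b ->]] [a' [b' ->]]; rewrite oboxI.
by do 2 eexists; reflexivity.
Qed.

End boxes.

Definition locint {R : realType} {N : nat} (g : 'rV[R]_N -> R) :=
  measurable_fun setT g /\
  forall r, (@lebesgue_rV R N).-integrable (cube N r) (EFin \o g).

Section fundamental.
Context {R : realType} {N : nat}.
Notation leb := (@lebesgue_rV R N).
Variable g : 'rV[R]_N -> R.
Hypothesis lg : locint g.

Let mg : measurable_fun setT g. Proof. by case: lg. Qed.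

Let integrable_sub (E : set 'rV[R]_N) r : measurable E -> E `<=` cube N r ->
  leb.-integrable E (EFin \o g).
Proof. by move=> mE Er; apply: integrableS (lg.2 r) => //; exact: measurable_cube. Qed.

Let origin_box (r : R) : set 'rV[R]_N := obox (\row__ (- r)) (\row__ r).

Let origin_box_sub r : 0 <= r -> origin_box r `<=` cube N r.
Proof.
move=> r0 x h; rewrite cubeE// => i; have := h i.
by rewrite !mxE -ltr_norml => /ltW.
Qed.

(** The Borel sets whose part inside a fixed box carries a zero integral of g form
    a Dynkin system containing all boxes, hence are all the Borel sets; so g = 0
    almost everywhere in that box, and countably many boxes cover the space. *)
Lemma obox0_ae0 : (forall a b, (\int[leb]_(x in obox a b) (g x)%:E = 0)%E) ->
  {ae leb, forall x, g x = 0}.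
Proof.
move=> h0.
suff h k : {ae leb, forall x, origin_box k.+1%:R x -> g x = 0}.
  have := ae_foralln h; apply: filterS => x hx.
  apply: (hx (Num.truncn `|x|)) => i.
  rewrite !mxE -ltr_norml (le_lt_trans (norm_coord_le _ _))//.
  by rewrite truncnS_gt.
set D := origin_box _.
have mD : measurable D by exact: measurable_obox.
have Dk : D `<=` cube N k.+1%:R by exact: origin_box_sub.
have gD E : measurable E -> leb.-integrable (E `&` D) (EFin \o g).
  move=> mE; apply: (integrable_sub (r := k.+1%:R)); first exact: measurableI.
  by move=> x [_ /Dk].
have P E : measurable E -> (\int[leb]_(x in E `&` D) (g x)%:E = 0)%E.
  rewrite measurable_oboxes => mE; move: E mE.
  apply: (dynkin_induction measurable_oboxes setI_closed_oboxes).
  - by rewrite setTI; exact: h0.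
  - by move=> _ [a [b ->]]; rewrite oboxI; exact: h0.
  - move=> E mE /= PE.
    have := h0 (\row__ (- k.+1%:R)) (\row__ k.+1%:R).
    have DE : D = (E `&` D) `|` (~` E `&` D) by rewrite -setIUl setUv setTI.
    rewrite -/D [X in (\int[_]_(x in X) _)%E]DE.
    rewrite integral_setU//=; first last.
    + apply/disj_setPS => x [[Ex _] [nEx _]]; exact: nEx.
    + by rewrite -setIUl setUv; exact: measurable_int (gD _ measurableT).
    + by apply: measurableI => //; exact: measurableC.
    + exact: measurableI.
    by rewrite PE add0e.
  - move=> F mF tF PF /=; rewrite setI_bigcupl integral_bigcup//.
    + by rewrite eseries0// => i _ _; exact: PF.
    + exact: trivIset_setIr.
    + by move=> i; exact: measurableI.
    + by rewrite -setI_bigcupl; apply: gD; exact: bigcupT_measurable.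
have := @integral_ae_eq _ _ _ leb D mD (cst 0%E) (EFin \o g).
case.
- by rewrite -[D]setTI; exact: gD.
- exact: measurable_cst.
- move=> E ED mE; rewrite integral0.
  by rewrite -(setIidl ED); exact: P.
- move=> A [mA A0 DA]; exists A; split => // x /= ngx; apply: DA => /= gx.
  by apply: ngx => Dx; have [] := gx Dx.
Qed.

End fundamental.

Section dominated_Rintegral.
Context {d} {T : measurableType d} {R : realType}.
Variables (mu : {measure set T -> \bar R}).

Lemma dominated_Rintegral (f_ : nat -> T -> R) (f g : T -> R) :
  (forall n, measurable_fun setT (f_ n)) -> measurable_fun setT f ->
  {ae mu, forall x, f_ n x @[n --> \oo] --> f x} ->
  mu.-integrable setT (EFin \o g) ->
  (forall n x, `|f_ n x| <= g x) ->
  \int[mu]_x f_ n x @[n --> \oo] --> \int[mu]_x f x.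
Proof.
move=> mf_ mf cf ig fg.
have [|||||fi _ cvi] := @dominated_convergence _ _ _ mu setT measurableT
    (fun n x => (f_ n x)%:E) (fun x => (f x)%:E) (EFin \o g).
- by move=> n; exact/measurable_EFinP.
- exact/measurable_EFinP.
- apply: filterS cf => x fx _; apply: cvg_EFin => //.
  by apply: nearW.
- exact: ig.
- by apply: aeW => x n _; rewrite /= lee_fin.
apply: fine_cvg; rewrite fineK//; exact: integrable_fin_num.
Qed.

End dominated_Rintegral.

Section locint.
Context {R : realType} {N : nat}.
Notation leb := (@lebesgue_rV R N).
Implicit Types g : 'rV[R]_N -> R.

Lemma locint_dom g C r : locint g ->
  leb.-integrable setT (fun x => (C * `|g x| * \1_(cube N r) x)%:E).
Proof.
move=> [mg ig].
rewrite (_ : (fun x => _) = (fun x => C%:E * (((abse \o (EFin \o g)) \_ (cube N r)) x))%E).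
  apply: integrableZl => //.
  apply/(integrable_mkcond _ _).1; first exact: measurable_cube.
  by apply: integrable_abse; exact: ig.
apply/funext => x; rewrite /patch indicE; case: ifP => _.
  by rewrite mulr1 EFinM.
by rewrite mulr0 mule0.
Qed.

Lemma le_dom g (eta : 'rV[R]_N -> R) C r x :
  (`|eta x| <= C) -> (eta x != 0 -> cube N r x) ->
  `|g x * eta x| <= C * `|g x| * \1_(cube N r) x.
Proof.
move=> etaC etar; have C0 : 0 <= C by rewrite (le_trans _ etaC).
have [->|/etar cx] := eqVneq (eta x) 0.
  by rewrite mulr0 normr0 !mulr_ge0// indicE ler0n.
by rewrite indicE mem_set// mulr1 normrM mulrC ler_wpM2r.
Qed.

Lemma integrable_locintM g (eta : 'rV[R]_N -> R) C r : locint g ->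
  measurable_fun setT eta -> (forall x, `|eta x| <= C) ->
  (forall x, eta x != 0 -> cube N r x) ->
  leb.-integrable setT (fun x => (g x * eta x)%:E).
Proof.
move=> lg meta etaC etar.
apply: (le_integrable _ _ _ (locint_dom C r lg)) => //.
  by apply/measurable_EFinP; apply: measurable_funM => //; case: lg.
move=> x _; rewrite /= lee_fin (le_trans (le_dom g (etaC x) (etar x)))//.
exact: ler_norm.
Qed.

End locint.

Section bump.
Context {R : realType}.

Lemma flat0_le1 (x : R) : flat 0 x <= 1.
Proof.
rewrite /flat; case: ifP => // x0.
by rewrite expr0 mul1r -expR0 ler_expR oppr_le0 invr_ge0 ltW.
Qed.

Lemma flat_neq0 k (x : R) : flat k x != 0 -> 0 < x.
Proof. by rewrite /flat; case: ifP => //; rewrite eqxx. Qed.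

Lemma flat0_cvg (x : R) : flat 0 (n.+1%:R * x) @[n --> \oo] --> ((0 < x)%R%:R : R).
Proof.
rewrite /flat; have [x0|x0] := ltP 0 x; last first.
  apply: cvg_near_cst; near=> n.
  by rewrite ifF//; apply/negbTE; rewrite -leNgt mulr_ge0_le0.
rewrite (_ : (fun n => _) = (fun n => expR (- (n.+1%:R^-1 * x^-1)))); last first.
  by apply/funext => n; rewrite ifT ?mulr_gt0// expr0 mul1r invfM.
have h1 : - (n.+1%:R^-1 * x^-1) @[n --> \oo] --> - ((0 : R) * x^-1).
  by apply: cvgN; apply: cvgMl; exact: cvg_harmonic.
have := @cvg_comp _ _ _ _ (@expR R) _ _ _ h1 (@continuous_expR R _).
by rewrite mul0r oppr0 expR0.
Unshelve. all: by end_near. Qed.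

(** Smooth on the line, with values in [0, 1], and converging to the indicator of
    ]a, b[ as n grows: the nonzero values of flat 0 tend to 1 at infinity. *)
Definition bump n (a b t : R) :=
  flat 0 (n.+1%:R * t + n.+1%:R * - a) * flat 0 (- n.+1%:R * t + n.+1%:R * b).

Lemma flat_alg_bump n a b : flat_alg (bump n a b).
Proof. by do !constructor. Qed.

Lemma bump_ge0 n a b t : 0 <= bump n a b t.
Proof. by rewrite mulr_ge0// flat_ge0. Qed.

Lemma bump_le1 n a b t : bump n a b t <= 1.
Proof. by rewrite mulr_ile1// ?flat_ge0// flat0_le1. Qed.

Lemma bumpE n a b t : bump n a b t =
  flat 0 (n.+1%:R * (t - a)) * flat 0 (n.+1%:R * (b - t)).
Proof. by rewrite /bump; congr (flat 0 _ * flat 0 _); ring. Qed.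

Lemma bump_neq0 n a b t : bump n a b t != 0 -> a < t < b.
Proof.
rewrite bumpE mulf_eq0 negb_or => /andP[/flat_neq0 + /flat_neq0].
by rewrite !pmulr_rgt0// !subr_gt0 => -> ->.
Qed.

Lemma bump_cvg a b t : bump n a b t @[n --> \oo] --> ((a < t < b)%R%:R : R).
Proof.
under eq_fun do rewrite bumpE.
rewrite -subr_gt0 -(subr_gt0 t) -mulnb natrM.
by apply: cvgM; exact: flat0_cvg.
Qed.

End bump.

Section tensor_bounds.
Context {R : realType} {N : nat}.
Implicit Types F : 'I_N -> R -> R.

Definition tensor_test r F :=
  (forall i, flat_alg (F i)) /\ forall i t, F i t != 0 -> `|t| <= r.

Lemma tensor_test_supp r F x : 0 <= r -> tensor_test r F ->
  tensor F x != 0 -> cube N r x.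
Proof.
move=> r0 [_ Fr] Tx; rewrite cubeE// => i; apply: (Fr i).
by apply: contra_neq Tx => Fx; rewrite (tensor_split _ i) Fx mul0r.
Qed.

Lemma tensor_test_test r F : 0 <= r -> tensor_test r F ->
  test_function (tensor F).
Proof.
move=> r0 [aF Fr]; apply: (test_tensor r0) => // i.
exact: flat_alg_smooth.
Qed.

Lemma continuous_measurable_rVT (f : 'rV[R]_N -> R) :
  continuous f -> measurable_fun setT f.
Proof. by move=> cf; apply: continuous_measurable_rV => [|x _]; [exact: openT|exact: cf]. Qed.

Lemma test_differentiable (f : 'rV[R]_N -> R) x : test_function f -> differentiable f x.
Proof. by move=> [sf _]; exact: (sf [::] x). Qed.

Lemma test_continuous (f : 'rV[R]_N -> R) : test_function f -> continuous f.
Proof. by move=> tf x; exact/differentiable_continuous/test_differentiable. Qed.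

Lemma test_partial (f : 'rV[R]_N -> R) i : test_function f ->
  continuous (partial i f).
Proof. by move=> [sf _] x; exact/differentiable_continuous/(sf [:: i] x). Qed.

Lemma test_supp (f : 'rV[R]_N -> R) : test_function f ->
  exists2 r, 0 <= r & forall x, f x != 0 -> cube N r x.
Proof.
move=> [_ /compact_bounded[M [_ hM]]].
exists (`|M| + 1) => [|x fx]; first by rewrite addr_ge0.
by apply: (hM (`|M| + 1)); [rewrite ltr_pwDr// ler_norm|exact: subset_closure].
Qed.

Lemma continuous_supp_bounded (f : 'rV[R]_N -> R) r : continuous f ->
  (forall x, f x != 0 -> cube N r x) -> exists2 C, 0 <= C & forall x, `|f x| <= C.
Proof.
move=> cf fr.
have /compact_bounded[M [_ hM]] : compact (f @` cube N r).
  apply: continuous_compact; last exact: compact_cube.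
  exact: continuous_subspaceT.
exists (`|M| + 1) => [|x]; first by rewrite addr_ge0.
have [->|/fr cx] := eqVneq (f x) 0; first by rewrite normr0 addr_ge0.
by apply: (hM (`|M| + 1)); [rewrite ltr_pwDr// ler_norm|exists x].
Qed.

End tensor_bounds.

Section fundamental_lemma.
Context {R : realType} {N : nat}.
Notation leb := (@lebesgue_rV R N).

(** Products of bumps converge to the indicator of a box, so by dominated
    convergence the integral of g over every box is 0. *)
Lemma fundamental_lemma (g : 'rV[R]_N -> R) : locint g ->
  (forall r F, 0 <= r -> tensor_test r F ->
    \int[leb]_x (g x * tensor F x) = 0) ->
  {ae leb, forall x, g x = 0}.
Proof.
move=> lg h; apply: obox0_ae0 => // a b.
pose F n i := bump n (a ord0 i) (b ord0 i).
pose r := `|a| + `|b|.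
have r0 : 0 <= r by rewrite addr_ge0.
have tF n : tensor_test r (F n).
  split=> [i|i t]; first exact: flat_alg_bump.
  move=> /bump_neq0 /andP[at_ tb].
  have := norm_coord_le a i; have := norm_coord_le b i.
  rewrite /r !ler_norml => /andP[h1 h2] /andP[h3 h4].
  have := normr_ge0 a; have := normr_ge0 b => h5 h6.
  by apply/andP; split; lra.
have T01 n x : 0 <= tensor (F n) x <= 1.
  rewrite /tensor; apply/andP; split.
    by apply: prodr_ge0 => i _; exact: bump_ge0.
  by apply: prodr_ile1 => i _; rewrite bump_ge0 bump_le1.
have mT n : measurable_fun setT (tensor (F n)).
  by apply: continuous_measurable_rVT; apply: test_continuous; exact: tensor_test_test (tF n).
have Tcvg x : tensor (F n) x @[n --> \oo] --> (\1_(obox a b) x : R).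
  rewrite (_ : \1_(obox a b) x = \prod_i ((a ord0 i < x ord0 i < b ord0 i)%R%:R : R)).
    rewrite /tensor; elim: (index_enum _) => [|i s IH].
      under eq_fun do rewrite big_nil; rewrite big_nil; exact: cvg_cst.
    under eq_fun do rewrite big_cons; rewrite big_cons.
    by apply: cvgM => //; exact: bump_cvg.
  rewrite indicE; have [xab|xab] := boolP (x \in obox a b).
    by rewrite big1// => i _; move: xab; rewrite inE => ->.
  have [i xi] : exists i, ~~ (a ord0 i < x ord0 i < b ord0 i)%R.
    apply: contrapT => hn; move: xab; rewrite notin_setE; apply => i.
    by apply: contrapT => /negP hi; apply: hn; exists i.
  by rewrite (bigD1 i)//= (negbTE xi) mul0r.
have mg : measurable_fun setT g by case: lg.
have gT : leb.-integrable setT (fun x => (g x * \1_(obox a b) x)%:E).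
  apply: (integrable_locintM (C := 1) (r := r)) => //.
  - by apply: measurable_indic; exact: measurable_obox.
  - by move=> x; rewrite indicE normr_nat lern1 leq_b1.
  - move=> x; rewrite indicE pnatr_eq0 eqb0 negbK inE => xab.
    rewrite cubeE// => i; have /andP[h1 h2] := xab i.
    have := norm_coord_le a i; have := norm_coord_le b i.
    rewrite /r !ler_norml => /andP[h3 h4] /andP[h5 h6].
    have := normr_ge0 a; have := normr_ge0 b => h7 h8.
    by apply/andP; split; lra.
have := @dominated_Rintegral _ _ _ leb (fun n x => g x * tensor (F n) x)
  (fun x => g x * \1_(obox a b) x) (fun x => 1 * `|g x| * \1_(cube N r) x).
have -> : (fun n => \int[leb]_x (g x * tensor (F n) x)) = (fun=> 0).
  by apply/funext => n; exact: h (tF n).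
move=> c0; have {c0} : (fun=> 0) @ \oo --> \int[leb]_x (g x * \1_(obox a b) x).
  apply: c0.
  - by move=> n; exact: measurable_funM.
  - apply: measurable_funM => //.
    by apply: measurable_indic; exact: measurable_obox.
  - by apply: aeW => x; apply: cvgMr; exact: Tcvg.
  - exact: locint_dom.
  - move=> n x; apply: le_dom; last exact: tensor_test_supp.
    by have /andP[? ?] := T01 n x; rewrite ger0_norm.
move=> /(cvg_lim (@Rhausdorff R)); rewrite lim_cst// => /esym I0.
transitivity (\int[leb]_x (g x * \1_(obox a b) x)%:E)%E.
  rewrite integral_mkcond; apply: eq_integral => x _.
  by rewrite /patch indicE; case: ifP; rewrite ?mulr1// mulr0.
by rewrite -[LHS]fineK ?integrable_fin_num//; congr (_%:E); exact: I0.
Qed.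

End fundamental_lemma.

(** * Averages along coordinate segments *)

Section Rfubini.
Context {d1 d2} {T1 : measurableType d1} {T2 : measurableType d2} {R : realType}.
Variables (m1 : {sigma_finite_measure set T1 -> \bar R})
  (m2 : {sigma_finite_measure set T2 -> \bar R}).
Implicit Types f : T1 * T2 -> R.

(** Stated for a function that may fail to be integrable on some fibres: the
    positive and the negative parts are treated separately. *)
Lemma measurable_Rintegral_F f : measurable_fun setT f ->
  measurable_fun setT (fun x => \int[m2]_y f (x, y)).
Proof.
move=> mf; apply: measurableT_comp => //.
rewrite (_ : (fun x => _) = (fun x => \int[m2]_y (fun z => (f z)%:E)^\+ (x, y) -
    \int[m2]_y (fun z => (f z)%:E)^\- (x, y))%E); last first.
  apply/funext => x; rewrite [LHS]integralE; congr (_ - _)%E.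
    by apply: eq_integral => y _; rewrite !funeposE.
  by apply: eq_integral => y _; rewrite !funenegE.
apply: emeasurable_funB.
  apply: measurable_fun_fubini_tonelli_F => //.
  by apply: measurable_funepos; exact/measurable_EFinP.
apply: measurable_fun_fubini_tonelli_F => //.
by apply: measurable_funeneg; exact/measurable_EFinP.
Qed.

Lemma measurable_Rintegral_G f : measurable_fun setT f ->
  measurable_fun setT (fun y => \int[m1]_x f (x, y)).
Proof.
move=> mf; apply: measurableT_comp => //.
rewrite (_ : (fun x => _) = (fun y => \int[m1]_x (fun z => (f z)%:E)^\+ (x, y) -
    \int[m1]_x (fun z => (f z)%:E)^\- (x, y))%E); last first.
  apply/funext => x; rewrite [LHS]integralE; congr (_ - _)%E.
    by apply: eq_integral => y _; rewrite !funeposE.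
  by apply: eq_integral => y _; rewrite !funenegE.
apply: emeasurable_funB.
  apply: measurable_fun_fubini_tonelli_G => //.
  by apply: measurable_funepos; exact/measurable_EFinP.
apply: measurable_fun_fubini_tonelli_G => //.
by apply: measurable_funeneg; exact/measurable_EFinP.
Qed.

Variable f : T1 * T2 -> R.
Hypothesis fi : (m1 \x m2)%E.-integrable setT (EFin \o f).

Let mf : measurable_fun setT f.
Proof. by apply/measurable_EFinP; exact: measurable_int fi. Qed.

Let ae1 : ae_eq m1 setT (fun x => (\int[m2]_y f (x, y))%:E)
  (fun x => \int[m2]_y (f (x, y))%:E)%E.
Proof.
have := ae_integrable1 fi; apply: filterS => x fx _.
by rewrite fineK//; exact: integrable_fin_num.
Qed.

Let ae2 : ae_eq m2 setT (fun y => (\int[m1]_x f (x, y))%:E)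
  (fun y => \int[m1]_x (f (x, y))%:E)%E.
Proof.
have := ae_integrable2 fi; apply: filterS => x fx _.
by rewrite fineK//; exact: integrable_fin_num.
Qed.

Let mF1 : measurable_fun setT (fun x => (\int[m2]_y f (x, y))%:E).
Proof. by apply/measurable_EFinP; exact: measurable_Rintegral_F. Qed.

Lemma integrable_Rfubini_F :
  m1.-integrable setT (EFin \o (fun x => \int[m2]_y f (x, y))).
Proof.
have /integrableP[mF iF] := integrable_fubini_F fi.
apply/integrableP; split => //.
rewrite (ae_eq_integral (fun x => `|fubini_F m2 (EFin \o f) x|)%E)//.
- exact: measurableT_comp.
- exact: measurableT_comp.
- by apply: filterS ae1 => x h _; congr (abse _); exact: h.
Qed.

Lemma Rfubini : \int[m1]_x \int[m2]_y f (x, y) = \int[m2]_y \int[m1]_x f (x, y).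
Proof.
rewrite {1 3}/Rintegral; congr fine.
have mG : measurable_fun setT (fun y => (\int[m1]_x f (x, y))%:E).
  by apply/measurable_EFinP; exact: measurable_Rintegral_G.
have e1 : (\int[m1]_x (\int[m2]_y f (x, y))%:E =
    \int[m1]_x \int[m2]_y (f (x, y))%:E)%E.
  by apply: ae_eq_integral => //; have /integrableP[] := integrable_fubini_F fi.
have e2 : (\int[m2]_y (\int[m1]_x f (x, y))%:E =
    \int[m2]_y \int[m1]_x (f (x, y))%:E)%E.
  by apply: ae_eq_integral => //; exact: (measurable_fubini_G fi).
rewrite e1 e2.
exact: (Fubini fi).
Qed.

End Rfubini.

Section averages.
Context {R : realType} {N : nat}.
Notation leb := (@lebesgue_rV R N).
Notation leb1 := (@lebesgue_measure R).
Variable (i : 'I_N).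
Notation e := (delta_mx ord0 i : 'rV[R]_N).
Implicit Types (g eta : 'rV[R]_N -> R) (h : R).

Definition avg h g (x : 'rV[R]_N) : R :=
  \int[leb1]_(t in `[0, 1]) g (x + (t * h) *: e).

Lemma avgE h g x : avg h g x = \int[leb1]_t (\1_(`[0, 1]%classic : set R) t * g (x + (t * h) *: e)).
Proof.
rewrite /avg Rintegral_mkcond; apply: eq_Rintegral => t _.
by rewrite /patch indicE; case: ifP; rewrite ?mul1r ?mul0r.
Qed.

Lemma measurable_line h : measurable_fun setT
  (fun z : 'rV[R]_N * measurableTypeR R => z.1 + (z.2 * h) *: e).
Proof.
apply/measurable_fun_coordP => j.
rewrite (_ : (fun z => _) = (fun z : 'rV[R]_N * measurableTypeR R =>
  z.1 ord0 j + z.2 * (h * e ord0 j))); last first.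
  by apply/funext => z; rewrite !mxE mulrA.
apply: measurable_funD.
  exact: (measurableT_comp (measurable_coord j) measurable_fst).
apply: measurable_funM => //; exact: measurable_snd.
Qed.

Let ker g eta a b (z : 'rV[R]_N * measurableTypeR R) : R :=
  \1_(`[0, 1]%classic : set R) z.2 *
    (g (z.1 + (z.2 * a) *: e) * eta (z.1 + (z.2 * b) *: e)).

Let measurable_ker g eta a b : measurable_fun setT g -> measurable_fun setT eta ->
  measurable_fun setT (ker g eta a b).
Proof.
move=> mg meta; apply: measurable_funM.
  apply: (measurableT_comp (measurable_indic _)); last exact: measurable_snd.
  exact: measurable_itv.
apply: measurable_funM.
  exact: (measurableT_comp mg (measurable_line a)).
exact: (measurableT_comp meta (measurable_line b)).
Qed.

Lemma measurable_avg g h : measurable_fun setT g ->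
  measurable_fun setT (avg h g).
Proof.
move=> mg; rewrite (_ : avg h g = fun x => \int[leb1]_t ker g (cst 1) h 0 (x, t)).
  by apply: measurable_Rintegral_F; apply: measurable_ker.
apply/funext => x; rewrite avgE; apply: eq_Rintegral => t _.
by rewrite /ker /= mulr1.
Qed.

Lemma norm_delta : `|e| <= 1.
Proof.
rewrite ler_norm_rV//; apply/forallP => j; rewrite !mxE eqxx/=.
by case: eqP => _; rewrite ?normr1 ?normr0.
Qed.

Lemma cube_shift r h (t : R) x : 0 <= t <= 1 -> cube N r (x + (t * h) *: e) ->
  cube N (r + `|h|) x.
Proof.
move=> /andP[t0 t1]; rewrite /cube/= => xr.
rewrite -[x](addrK ((t * h) *: e)) (le_trans (ler_normB _ _))// lerD//.
rewrite normrZ normrM (ger0_norm t0) -[leRHS]mulr1 ler_pM ?norm_delta//.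
  by rewrite mulr_ge0.
by rewrite ler_piMl.
Qed.

Lemma mem_itv01 (t : R) : t \in (`[0, 1]%classic : set R) -> 0 <= t <= 1.
Proof. by rewrite inE /= in_itv. Qed.

Section duality.
Variables (g eta : 'rV[R]_N -> R) (C r : R).
Hypotheses (lg : locint g) (meta : measurable_fun setT eta)
  (etaC : forall x, `|eta x| <= C) (etar : forall x, eta x != 0 -> cube N r x).

Let mg : measurable_fun setT g. Proof. by case: lg. Qed.

(** A product with a bounded, compactly supported factor, which stays so when the
    argument of that factor moves along a segment. *)
Lemma integrable_shiftM (t h : R) : 0 <= t <= 1 ->
  leb.-integrable setT (fun x => (g x * eta (x + (t * h) *: e))%:E).
Proof.
move=> t01; apply: (integrable_locintM (C := C) (r := r + `|h|)) => //.
- exact: measurableT_comp meta (measurable_addr_rV _).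
- by move=> x /etar; exact: cube_shift.
Qed.

Let K h : \bar R := (\int[leb]_x (C * `|g x| * \1_(cube N (r + `|h|)) x)%:E)%E.

Let ker_bound (t a b : R) : 0 <= t <= 1 ->
  (\int[leb]_x `|(g (x + (t * a) *: e) * eta (x + (t * b) *: e))%:E| <= K (b - a))%E.
Proof.
move=> t01.
have m0 : measurable_fun setT (fun x => (g x * eta (x + (t * (b - a)) *: e))%:E).
  exact: measurable_int (integrable_shiftM (b - a) t01).
have m1 : measurable_fun setT (fun x => `|(g x * eta (x + (t * (b - a)) *: e))%:E|%E).
  exact: measurableT_comp.
have := shift_ge0_integral ((t * a) *: e) m1 (fun=> abse_ge0 _).
under eq_integral do rewrite -addrA -scalerDl -mulrDr subrKC.
move=> ->; apply: ge0_le_integral => //.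
  by have /integrableP[] := locint_dom C (r + `|b - a|) lg.
move=> x _; rewrite /= lee_fin.
apply: (@le_dom _ _ g (fun x => eta (x + (t * (b - a)) *: e))) => // /etar.
exact: cube_shift.
Qed.

Let integrable_ker a b : (leb \x leb1)%E.-integrable setT (EFin \o ker g eta a b).
Proof.
have mk : measurable_fun setT (EFin \o ker g eta a b).
  by apply/measurable_EFinP; exact: measurable_ker.
apply/integrable21ltyP => //.
have Kfin : K (b - a) \is a fin_num.
  by apply: integrable_fin_num => //; exact: locint_dom.
have K0 : (0 <= K (b - a))%E.
  apply: integral_ge0 => x _; rewrite lee_fin.
  by rewrite !mulr_ge0// (le_trans _ (etaC 0)).
have mI : measurable_fun setT (EFin \o (\1_(`[0, 1]%classic : set R) : R -> R)).
  by apply/measurable_EFinP; apply: measurable_indic; exact: measurable_itv.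
apply: (@le_lt_trans _ _
    (\int[leb1]_t (K (b - a) * (\1_(`[0, 1]%classic : set R) t)%:E))%E).
  apply: ge0_le_integral => //.
  - by move=> t _; apply: integral_ge0.
  - apply: (measurable_fun_fubini_tonelli_G (abse \o (EFin \o ker g eta a b))) => [|x];
      [exact: measurableT_comp|exact: abse_ge0].
  - exact: emeasurable_funM.
  - move=> t _; rewrite /ker /= indicE.
    have [t01|t01] := boolP (t \in _); last first.
      under eq_integral do rewrite mul0r normr0.
      by rewrite integral0 mule0.
    under eq_integral do rewrite mul1r.
    by rewrite mule1; apply: ker_bound; exact: mem_itv01.
rewrite ge0_integralZl//.
rewrite integral_indic//= setIT.
rewrite lte_mul_pinfty// lebesgue_measure_itv/= lte_fin ltr01 -EFinB ltry//.
Qed.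

Let avg_eta h : {ae leb, forall x,
  \int[leb1]_t ker g eta h 0 (x, t) = avg h g x * eta x}.
Proof.
apply: filterS (ae_integrable1 (integrable_ker h 0)) => x ix.
have [e0|e0] := eqVneq (eta x) 0.
  rewrite e0 mulr0 /ker /=; under eq_Rintegral do rewrite mulr0 scale0r addr0 e0 !mulr0.
  by rewrite /Rintegral integral0.
rewrite avgE -RintegralZr//.
  by apply: eq_Rintegral => t _; rewrite /ker/= mulr0 scale0r addr0 mulrA.
apply: eq_integrable (integrableZr measurableT (eta x)^-1 ix) => // t _.
by rewrite /ker /= mulr0 scale0r addr0 -EFinM !mulrA mulfK.
Qed.

Lemma integrable_avgM h :
  leb.-integrable setT (fun x => (avg h g x * eta x)%:E).
Proof.
have /integrableP[mF iF] := integrable_Rfubini_F (integrable_ker h 0).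
have mA : measurable_fun setT (fun x => (avg h g x * eta x)%:E).
  apply/measurable_EFinP; apply: measurable_funM => //.
  exact: measurable_avg.
apply/integrableP; split => //.
rewrite (_ : (\int[leb]_x _)%E = (\int[leb]_x
   `|(\int[leb1]_t ker g eta h 0 (x, t))%:E|)%E) //.
apply: ae_eq_integral => //; [exact: measurableT_comp..|].
by apply: filterS (avg_eta h) => x hx _; congr (abse (_%:E)); exact/esym.
Qed.

(** Fubini, then the translation by t h e for each t: averaging along a segment
    has the averaging along the opposite segment as its transpose. *)
Lemma avg_dual h : \int[leb]_x (avg h g x * eta x) =
  \int[leb1]_(t in `[0, 1]) \int[leb]_x (g x * eta (x + (t * - h) *: e)).
Proof.
transitivity (\int[leb]_x \int[leb1]_t ker g eta h 0 (x, t)).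
  rewrite /Rintegral; congr fine; apply: ae_eq_integral => //.
  - exact: measurable_int (integrable_avgM h).
  - by have /integrableP[] := integrable_Rfubini_F (integrable_ker h 0).
  - by apply: filterS (avg_eta h) => x hx _; congr (_%:E); exact/esym.
rewrite (Rfubini (integrable_ker h 0)) [RHS]Rintegral_mkcond.
apply: eq_Rintegral => t _; rewrite /ker /= patchE indicE.
case: ifPn => t01; last first.
  by under eq_Rintegral do rewrite mul0r; rewrite /Rintegral integral0.
under eq_Rintegral do rewrite mul1r mulr0 scale0r addr0.
have m0 : measurable_fun setT (fun x => g x * eta (x + (t * - h) *: e)).
  apply/measurable_EFinP.
  exact: measurable_int (integrable_shiftM (- h) (mem_itv01 t01)).
have := shift_Rintegral ((t * h) *: e) m0.
by under eq_Rintegral do rewrite mulrN scaleNr addrK.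
Qed.

(** The same exchange of integrals with the average on the other factor. Together
    with avg_dual it moves an average from one factor to the other. *)
Lemma avg_dualr h : \int[leb]_x (g x * avg h eta x) =
  \int[leb1]_(t in `[0, 1]) \int[leb]_x (g x * eta (x + (t * h) *: e)).
Proof.
transitivity (\int[leb]_x \int[leb1]_t ker g eta 0 h (x, t)).
  apply: eq_Rintegral => x _; rewrite avgE -RintegralZl//.
    apply: eq_Rintegral => t _.
    by rewrite /ker /= mulr0 scale0r addr0 mulrCA.
  have iI : leb1.-integrable setT
      (fun t => C%:E * (\1_(`[0, 1]%classic : set R) t)%:E)%E.
    by apply: integrableZl => //; exact: integrable_indic_itv.
  apply: le_integrable iI => //.
    apply/measurable_EFinP; apply: measurable_funM.
      by apply: measurable_indic; exact: measurable_itv.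
    apply: (measurableT_comp meta).
    exact: (measurableT_comp (measurable_line h) (measurable_pair1 x)).
  move=> t _; rewrite /= lee_fin !normrM mulrC ler_wpM2r//.
  by rewrite (le_trans (etaC _))// ler_norm.
rewrite (Rfubini (integrable_ker 0 h)) [RHS]Rintegral_mkcond.
apply: eq_Rintegral => t _; rewrite /ker /= patchE indicE.
case: ifPn => t01; last first.
  by under eq_Rintegral do rewrite mul0r; rewrite /Rintegral integral0.
by under eq_Rintegral do rewrite mul1r mulr0 scale0r addr0.
Qed.

End duality.

Lemma locint_avg h g : locint g -> locint (avg h g).
Proof.
move=> lg; split=> [|r]; first by apply: measurable_avg; case: lg.
apply/(integrable_mkcond _ (measurable_cube r)).2.
have ic1 (x : 'rV[R]_N) : `|\1_(cube N r) x : R| <= 1.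
  by rewrite indicE normr_nat lern1 leq_b1.
have ics (x : 'rV[R]_N) : \1_(cube N r) x != 0 :> R -> cube N r x.
  by rewrite indicE pnatr_eq0 eqb0 negbK inE.
have mi : measurable_fun setT (\1_(cube N r) : 'rV[R]_N -> R).
  by apply: measurable_indic; exact: measurable_cube.
apply: eq_integrable (integrable_avgM lg mi ic1 ics h) => // x _.
by rewrite /= patchE indicE; case: ifP => _; rewrite ?mulr1 ?mulr0.
Qed.

End averages.

(** * Weak derivatives and increments *)

Section antiderivative.
Context {R : realType}.
Notation leb1 := (@lebesgue_measure R).

(** Primitives of functions with bounded support, obtained by integrating from
    minus infinity so that they exist on the whole line. *)
Lemma antiderivative (f : R -> R) (r : R) : continuous f ->
  (forall t, f t != 0 -> `|t| <= r) ->
  exists P, forall x : R, is_derive x 1 P (f x).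
Proof.
move=> cf fr.
have mf : measurable_fun setT f by exact: continuous_measurable_fun.
have fi : leb1.-integrable setT (EFin \o f).
  have fi : leb1.-integrable `[- r, r] (EFin \o f).
    apply: continuous_compact_integrable; first exact: segment_compact.
    exact: continuous_subspaceT.
  have : leb1.-integrable setT ((EFin \o f) \_ `[- r, r]%classic).
    by apply/(integrable_mkcond _ _).1.
  apply: eq_integrable => // t _.
  rewrite patchE; case: ifPn => //= tr.
  congr (_%:E); apply/esym/eqP; apply: contraNT tr => /fr.
  by rewrite inE /= in_itv/= ler_norml.
pose P x := \int[leb1]_(t in [set` `]-oo, x]]) f t.
exists P => x.
have [||||dP PE] := @continuous_FTC1 R f -oo%O x (x + 1).
- by rewrite ltrDl.
- by apply: integrableS fi.
- by rewrite ltNyr.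
- exact: cf.
by split; [exact: dP|rewrite -derive1E; exact: PE].
Qed.

Lemma Rintegral_line (f P : R -> R) (y h : R) : continuous f -> h != 0 ->
  (forall x : R, is_derive x 1 P (f x)) ->
  \int[leb1]_(t in `[0, 1]) f (y + t * h) = (P (y + h) - P y) / h.
Proof.
move=> cf h0 dP.
pose F (t : R) := h^-1 * P (h * t + y).
have dF (t : R) : is_derive t 1 F (f (y + t * h)).
  have d := is_deriveZ h^-1 (@is_derive1_comp _ P (fun t => h * t + y) t
    _ _ (dP (h * t + y)) (is_derive_affine h y t)).
  apply: (is_derive_eq d); rewrite /GRing.scale/=.
  by rewrite mulrCA mulVf// mulr1 addrC (mulrC h).
have cF : continuous F.
  move=> t; apply: differentiable_continuous; apply/derivable1_diffP.
  by have [] := dF t.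
rewrite /Rintegral (@continuous_FTC2 _ (fun t => f (y + t * h)) F)//.
- rewrite -EFinB /= /F mulr1 mulr0 add0r (addrC h); field.
  by [].
- apply: continuous_subspaceT => t; apply: continuous_comp; last exact: cf.
  by apply: cvgD; [exact: cvg_cst|apply: cvgMl; exact: cvg_id].
- split.
  + by move=> t _; have [] := dF t.
  + by apply: cvg_at_right_filter; exact: cF.
  + by apply: cvg_at_left_filter; exact: cF.
- by move=> t _; rewrite derive1E; have [] := dF t.
Qed.

End antiderivative.

Section locint_ops.
Context {R : realType} {N : nat}.
Notation leb := (@lebesgue_rV R N).
Implicit Types f g : 'rV[R]_N -> R.

Lemma locint_shift f c : locint f -> locint (fun x => f (x + c)).
Proof.
move=> [mf ifr]; split=> [|r]; first exact: measurableT_comp mf (measurable_addr_rV c).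
have h : leb.-integrable setT ((EFin \o f) \_ (cube N (r + `|c|))).
  by apply/(integrable_mkcond _ _).1; [exact: measurable_cube|exact: ifr].
have := integrableS measurableT (measurable_cube r) (@subsetT _ _) (shift_integrable c h).
apply: eq_integrable => [|x]; first exact: measurable_cube.
rewrite inE /cube /= => xr; rewrite patchE ifT//.
by rewrite inE /= (le_trans (ler_normD _ _))// lerD2r.
Qed.

Lemma locintD f g : locint f -> locint g -> locint (fun x => f x + g x).
Proof.
move=> [mf ifr] [mg ig]; split=> [|r]; first exact: measurable_funD.
have := integrableD (measurable_cube r) (ifr r) (ig r).
by apply: eq_integrable => //; exact: measurable_cube.
Qed.

Lemma locintZ f c : locint f -> locint (fun x => c * f x).
Proof.
move=> [mf ifr]; split=> [|r]; first exact: measurable_funM.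
have := integrableZl (measurable_cube r) c (ifr r).
by apply: eq_integrable => //; exact: measurable_cube.
Qed.

End locint_ops.

Section weak_derivative.
Context {R : realType} {N : nat}.
Notation leb := (@lebesgue_rV R N).
Notation leb1 := (@lebesgue_measure R).
Variable (i : 'I_N).
Notation e := (delta_mx ord0 i : 'rV[R]_N).

Definition weakD (w g : 'rV[R]_N -> R) := forall phi, test_function phi ->
  \int[leb]_x (w x * partial i phi x) = - \int[leb]_x (g x * phi x).

Lemma tensor_line F x (t : R) :
  tensor F (x + t *: e) = tensor (set_factor F i (fun y => F i (y + t))) x.
Proof.
rewrite tensor_set_factor (tensor_split _ i) !mxE !eqxx mulr1; congr (_ * _).
apply: eq_bigr => j ji; rewrite !mxE/= (negbTE ji) mulr0 addr0//.
Qed.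

(** Averaging in the direction of e_i only replaces the i-th factor by its average. *)
Lemma avg_tensor F h x : (forall j, smooth1 (F j)) ->
  avg i h (tensor F) x =
  tensor (set_factor F i (fun y => \int[leb1]_(t in `[0, 1]) F i (y + t * h))) x.
Proof.
move=> sF; rewrite /avg.
under eq_Rintegral do rewrite tensor_line tensor_set_factor.
rewrite tensor_set_factor RintegralZr//.
apply: continuous_compact_integrable; first exact: segment_compact.
apply: continuous_subspaceT => t; apply: continuous_comp.
  by apply: cvgD; [exact: cvg_cst|apply: cvgMl; exact: cvg_id].
exact: smooth1_continuous.
Qed.

(** If P is a primitive of the i-th factor, the average of this factor is
    y |-> (P (y + h) - P y) / h: it is smooth because its derivative is a
    difference quotient of the factor, and this is also the partial derivative. *)
Lemma test_avg_tensor r F h : 0 <= r -> tensor_test r F -> h != 0 ->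
  test_function (avg i h (tensor F)) /\
  forall x, partial i (avg i h (tensor F)) x =
    (tensor F (x + h *: e) - tensor F x) / h.
Proof.
move=> r0 [aF Fr] h0.
have sF j : smooth1 (F j) by exact: flat_alg_smooth.
pose K y := \int[leb1]_(t in `[0, 1]) F i (y + t * h).
have -> : avg i h (tensor F) = tensor (set_factor F i K).
  by apply/funext => x; exact: avg_tensor.
have cF : continuous (F i) by exact: smooth1_continuous.
have [P dP] := antiderivative cF (Fr i).
have KE y : K y = h^-1 * (P (y + h) - P y).
  by rewrite /K (Rintegral_line _ cF h0 dP) mulrC.
have dK (y : R) : is_derive y 1 K (h^-1 * (F i (y + h) + -1 * F i y)).
  have -> : K = h^-1 \*: ((P \o (fun y => 1 * y + h)) - P).
    apply/funext => z; rewrite KE fctE /GRing.scale/= mul1r//.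
  have d := is_deriveZ h^-1 (is_deriveB (@is_derive1_comp _ P (fun y => 1 * y + h) y
    _ _ (dP (1 * y + h)) (is_derive_affine 1 h y)) (dP y)).
  by apply: (is_derive_eq d); rewrite /GRing.scale/= mul1r mulr1 mulN1r.
have sK : smooth1 K.
  apply: (smooth1_antiderivative _ dK); apply: flat_alg_smooth.
  have aFi := aF i.
  by do !constructor => //; exact: flat_alg_shift.
split.
  apply: (@test_tensor _ _ _ (r + `|h|)) => [|j|j t]; first by rewrite addr_ge0.
    by rewrite /set_factor; case: ifP.
  rewrite /set_factor; case: ifP => _; last by move=> /Fr/le_trans; apply; rewrite lerDl.
  apply: contra_neqT; rewrite -ltNge => rht.
  rewrite /K (@eq_Rintegral _ _ _ _ _ (fun=> 0)).
    by rewrite /Rintegral integral0.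
  move=> z z01; apply/eqP; apply: contraTT rht => /Fr zr.
  have /andP[z0 z1] := mem_itv01 z01.
  rewrite -leNgt -[t](addrK (z * h)) (le_trans (ler_normB _ _))// lerD//.
  by rewrite normrM ger0_norm// ler_piMl.
have dK' (y : R) : is_derive y 1 (set_factor F i K i) (h^-1 * (F i (y + h) + -1 * F i y)).
  by rewrite /set_factor eqxx.
move=> x; rewrite (partial_tensor dK') tensor_line !tensor_set_factor (tensor_split F i).
rewrite (eq_bigr (fun j => F j (x ord0 j))); first by rewrite mulN1r; ring.
by move=> j /negbTE ji; rewrite /set_factor ji.
Qed.

(** Test the weak derivative with the average of a tensor T along the segment of
    length - h. On the side of w, the derivative of the average is a difference
    quotient of T, which a translation turns into the increment of w; on the side
    of g, the duality of averages moves the average onto g. Hence the difference of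
    the two sides is orthogonal to every tensor. *)
Lemma weakD_line (w g : 'rV[R]_N -> R) h : locint w -> locint g -> weakD w g ->
  {ae leb, forall x, w (x + h *: e) - w x = h * avg i h g x}.
Proof.
move=> lw lg wg.
have [->|h0] := eqVneq h 0.
  by apply: aeW => x; rewrite scale0r addr0 subrr mul0r.
have la := locint_avg i h lg.
have lws := locint_shift (h *: e) lw.
suff : {ae leb, forall x, w (x + h *: e) + (-1 * w x + (- h) * avg i h g x) = 0}.
  apply: filterS => x; rewrite mulN1r mulNr addrA => /eqP.
  by rewrite subr_eq0 => /eqP.
apply: fundamental_lemma; first by do ?[apply: locintD|apply: locintZ].
move=> r F r0 tF.
have tT := tensor_test_test r0 tF.
have cT := test_continuous tT.
have mT := continuous_measurable_rVT cT.
have sT := tensor_test_supp r0 tF.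
have [C C0 TC] := continuous_supp_bounded cT sT.
have IM f : locint f -> leb.-integrable setT (EFin \o (fun x => f x * tensor F x)).
  by move=> lf; exact: integrable_locintM lf mT TC sT.
have hn0 : - h != 0 by rewrite oppr_eq0.
have [tA pA] := test_avg_tensor r0 tF hn0.
have Iws : leb.-integrable setT (EFin \o (fun x => w x * tensor F (x + - h *: e))).
  have := integrable_shiftM i lw mT TC sT (t := 1) (- h).
  by under eq_fun do rewrite mul1r; apply; rewrite ler01 lexx.
have ews : \int[leb]_x (w x * tensor F (x + - h *: e)) =
    \int[leb]_x (w (x + h *: e) * tensor F x).
  have mws : measurable_fun setT (fun x => w x * tensor F (x + - h *: e)).
    by apply/measurable_EFinP; exact: measurable_int Iws.
  rewrite -(shift_Rintegral (h *: e) mws).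
  by apply: eq_Rintegral => x _; rewrite scaleNr addrK.
have := wg _ tA.
rewrite (avg_dualr i lg mT TC sT) -(avg_dual i lg mT TC sT).
have -> : \int[leb]_x (w x * partial i (avg i (- h) (tensor F)) x) =
    (- h)^-1 * (\int[leb]_x (w (x + h *: e) * tensor F x) -
                \int[leb]_x (w x * tensor F x)).
  rewrite -ews -RintegralB//; last exact: IM.
  rewrite -RintegralZl//; last first.
    have := integrableB measurableT Iws (IM _ lw).
    by apply: eq_integrable.
  by apply: eq_Rintegral => x _; rewrite pA; ring.
move=> E0.
have LD f1 f2 : locint f1 -> locint f2 ->
    \int[leb]_x ((f1 x + f2 x) * tensor F x) =
    \int[leb]_x (f1 x * tensor F x) + \int[leb]_x (f2 x * tensor F x).
  move=> l1 l2; rewrite -RintegralD//; [|exact: IM..].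
  by apply: eq_Rintegral => x _; rewrite mulrDl.
have LZ c f : locint f -> \int[leb]_x ((c * f x) * tensor F x) =
    c * \int[leb]_x (f x * tensor F x).
  move=> l; rewrite -RintegralZl//; last exact: IM.
  by apply: eq_Rintegral => x _; rewrite mulrA.
rewrite (LD _ _ lws (locintD (locintZ (-1) lw) (locintZ (- h) la))).
rewrite (LD _ _ (locintZ (-1) lw) (locintZ (- h) la)) !LZ//.
have -> : \int[leb]_x (avg i h g x * tensor F x) =
    - ((- h)^-1 * (\int[leb]_x (w (x + h *: e) * tensor F x) -
                \int[leb]_x (w x * tensor F x))).
  by rewrite E0 opprK.
by field.
Qed.

End weak_derivative.

(** * L^p bounds for translates *)

Section jensen.
Context {R : realType}.
Notation leb1 := (@lebesgue_measure R).

Lemma measurable_powR_norm d (T : measurableType d) (p : R) (f : T -> R) :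
  measurable_fun setT f -> measurable_fun setT (fun x => `|f x| `^ p).
Proof.
move=> mf; apply: (measurableT_comp (measurable_powR p)).
exact: measurableT_comp.
Qed.

Lemma le_normr_RintegralE d (T : measurableType d) (mu : {measure set T -> \bar R})
  (f : T -> R) : measurable_fun setT f ->
  (`|\int[mu]_x f x|%:E <= \int[mu]_x `|f x|%:E)%E.
Proof.
move=> mf; have mF : measurable_fun setT (EFin \o f) by exact/measurable_EFinP.
apply: (le_trans _ (le_abse_integral mu measurableT mF)).
rewrite /Rintegral -[X in (abse X)]/(\int[mu]_x (f x)%:E)%E.
by case: (\int[mu]_x _)%E => [r| |] //=; rewrite ?normr0 ?leey.
Qed.

(** Jensen for the power p on the unit interval, deduced from the Hoelder
    inequality with the indicator of the interval as second factor. *)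
Lemma jensen01 (p : R) (f : R -> R) : 1 < p -> measurable_fun setT f ->
  ((`|\int[leb1]_(t in `[0, 1]) f t| `^ p)%:E <=
   \int[leb1]_t (\1_(`[0, 1]%classic : set R) t * `|f t| `^ p)%:E)%E.
Proof.
move=> p1 mf.
have p0 : 0 < p by rewrite (lt_trans _ p1).
pose I : R -> R := \1_(`[0, 1]%classic).
have mI : measurable_fun setT I by apply: measurable_indic; exact: measurable_itv.
pose f1 (t : R) := f t * I t.
have mf1 : measurable_fun setT f1 by exact: measurable_funM.
have I01 t : I t = 0 \/ I t = 1.
  by rewrite /I indicE; case: (_ \in _); [right|left].
have IE : \int[leb1]_(t in `[0, 1]) f t = \int[leb1]_t f1 t.
  rewrite Rintegral_mkcond; apply: eq_Rintegral => t _.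
  by rewrite /f1 /I patchE indicE; case: ifP; rewrite ?mulr1 ?mulr0.
rewrite IE.
set S := (X in (_ <= X)%E).
have SE : S = (\int[leb1]_t (`|f1 t| `^ p)%:E)%E.
  apply: eq_integral => t _; congr (_%:E); rewrite /f1 -/(I t).
  case: (I01 t) => ->; first by rewrite mul0r mulr0 normr0 powR0// gt_eqF.
  by rewrite mul1r mulr1.
pose q := p / (p - 1).
have q0 : 0 < q by rewrite divr_gt0// subr_gt0.
have pq : p^-1 + q^-1 = 1.
  rewrite /q; field; rewrite !gt_eqF ?subr_gt0//.
have := @hoelder _ _ _ leb1 f1 I p q mf1 mI p0 q0 pq.
rewrite Lnorm1.
have -> : ('N[leb1]_q%:E[EFin \o I] = 1)%E.
  rewrite unlock /Lnorm.
  rewrite (_ : (\int[_]_x _)%E = (\int[leb1]_x (I x)%:E)%E).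
    rewrite integral_indic//= setIT lebesgue_measure_itv/= lte_fin ltr01.
    by rewrite oppr0 adde0 poweR1r.
  apply: eq_integral => t _; rewrite /=; congr (_%:E).
  by case: (I01 t) => ->; rewrite ?normr0 ?normr1 ?powR1// powR0// gt_eqF.
rewrite mule1 => hh.
have h2 : (`|\int[leb1]_t f1 t|%:E <= 'N[leb1]_p%:E[EFin \o f1])%E.
  apply: (le_trans (le_normr_RintegralE leb1 mf1)).
  apply: le_trans hh; rewrite le_eqVlt; apply/orP; left; apply/eqP.
  apply: eq_integral => t _ /=; congr (_%:E); rewrite /f1 -mulrA.
  by case: (I01 t) => ->; rewrite ?mulr0 ?mulr1.
rewrite -[X in (X <= _)%E]poweR_EFin.
have -> : S = ('N[leb1]_p%:E[EFin \o f1] `^ p)%E.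
  by rewrite poweR_Lnorm ?gt_eqF// SE; apply: eq_integral.
apply: gt0_ler_poweR => //; first exact: ltW.
- by rewrite in_itv/= lee_fin normr_ge0 leey.
- by rewrite in_itv/= Lnorm_ge0 leey.
Qed.

End jensen.

Section Lp.
Context {R : realType} {N : nat}.
Notation leb := (@lebesgue_rV R N).
Notation leb1 := (@lebesgue_measure R).
Implicit Types f g w : 'rV[R]_N -> R.

Definition pint (p : R) f : \bar R := (\int[leb]_x (`|f x| `^ p)%:E)%E.

Definition inLp (p : R) f := measurable_fun setT f /\ (pint p f < +oo)%E.

Lemma pint_ge0 p f : (0 <= pint p f)%E.
Proof. by apply: integral_ge0 => x _; rewrite lee_fin powR_ge0. Qed.

Lemma measurable_pint p f : measurable_fun setT f ->
  measurable_fun setT (fun x => (`|f x| `^ p)%:E).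
Proof. by move=> mf; apply/measurable_EFinP; exact: measurable_powR_norm. Qed.

Lemma LfunP_inLp p f : 0 < p -> (f \in Lfun leb p%:E) <-> inLp p f.
Proof.
move=> p0; have pE : pint p f = ('N[leb]_p%:E[EFin \o f] `^ p)%E.
  by rewrite poweR_Lnorm ?gt_eqF//; apply: eq_integral.
rewrite inE; split.
  move=> /andP[/[!inE]/= mf ff]; split => //.
  by rewrite pE poweR_lty.
move=> [mf pf]; apply/andP; split; rewrite inE//=.
rewrite /finite_norm unlock /Lnorm poweR_lty//.
Qed.

Lemma inLp_integrable p f : inLp p f ->
  leb.-integrable setT (fun x => (`|f x| `^ p)%:E).
Proof.
move=> [mf pf]; apply/integrableP; split; first exact: measurable_pint.
by under eq_integral do rewrite gee0_abs ?lee_fin ?powR_ge0//.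
Qed.

Lemma ler_1powR (p a : R) : 1 <= p -> 0 <= a -> a <= 1 + a `^ p.
Proof.
move=> p1 a0; have [a1|a1] := leP a 1.
  by rewrite (le_trans a1)// lerDl powR_ge0.
by rewrite (le_trans (le1r_powR (ltW a1) p1))// lerDr.
Qed.

Lemma lebesgue_cube_lty r : (leb (cube N r) < +oo)%E.
Proof.
apply: (@le_lt_trans _ _ (leb (cube N `|r|))).
  apply: le_measure; rewrite ?inE; [exact: measurable_cube..|].
  by move=> x /le_trans; apply; exact: ler_norm.
by rewrite lebesgue_cube// ltry.
Qed.

Lemma inLp_locint p f : 1 <= p -> inLp p f -> locint f.
Proof.
move=> p1 fp; have [mf pf] := fp; split=> // r.
have mc := @measurable_cube R N r.
have i1 : leb.-integrable (cube N r) (EFin \o cst 1).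
  apply/integrableP; split; first exact/measurable_EFinP.
  under eq_integral do rewrite /= normr1.
  by rewrite integral_cst// mul1e lebesgue_cube_lty.
have i2 := integrableS measurableT mc (@subsetT _ _) (inLp_integrable fp).
apply: le_integrable (integrableD mc i1 i2) => //.
  exact/measurable_funTS/measurable_EFinP.
move=> x _; rewrite /= lee_fin [leRHS]ger0_norm; first exact: ler_1powR.
by rewrite addr_ge0// powR_ge0.
Qed.

Lemma powRD_le (p a b : R) : 0 <= p -> 0 <= a -> 0 <= b ->
  (a + b) `^ p <= 2 `^ p * (a `^ p + b `^ p).
Proof.
move=> p0; wlog ab : a b / a <= b.
  move=> H a0 b0; have [ab|/ltW ba] := leP a b; first exact: H.
  by rewrite addrC [X in _ * X]addrC; exact: H.
move=> a0 b0; apply: (@le_trans _ _ ((2 * b) `^ p)).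
  by rewrite ge0_ler_powR ?nnegrE ?addr_ge0 ?mulr_ge0// mulr2n mulrDl mul1r lerD2r.
by rewrite powRM// ler_wpM2l ?powR_ge0// lerDr powR_ge0.
Qed.

Lemma pintD p f g : 0 <= p -> measurable_fun setT f -> measurable_fun setT g ->
  (pint p (fun x => f x + g x)%R <= (2 `^ p)%:E * (pint p f + pint p g))%E.
Proof.
move=> p0 mf mg.
have n f0 x : (0 <= (`|f0 x| `^ p)%:E :> \bar R)%E by rewrite lee_fin powR_ge0.
have m1 := measurable_pint p mf; have m2 := measurable_pint p mg.
have m12 := emeasurable_funD m1 m2.
have e1 : (pint p f + pint p g = \int[leb]_x ((`|f x| `^ p)%:E + (`|g x| `^ p)%:E))%E.
  by rewrite ge0_integralD.
have e2 : ((2 `^ p)%:E * (pint p f + pint p g) =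
   \int[leb]_x ((2 `^ p)%:E * ((`|f x| `^ p)%:E + (`|g x| `^ p)%:E)))%E.
  rewrite e1 ge0_integralZl//.
  by move=> x _; rewrite adde_ge0.
rewrite e2; apply: ge0_le_integral => //.
- by apply: measurable_pint; exact: measurable_funD.
- exact: emeasurable_funM.
- move=> x _; rewrite -EFinD -EFinM lee_fin.
  apply: (le_trans _ (powRD_le p0 (normr_ge0 _) (normr_ge0 _))).
  by rewrite ge0_ler_powR ?nnegrE ?addr_ge0// ler_normD.
Qed.

Lemma pintN p f : pint p (fun x => - f x) = pint p f.
Proof. by rewrite /pint; under eq_integral do rewrite normrN. Qed.

Lemma pintZ p c f : 0 <= p -> measurable_fun setT f -> pint p (fun x => c * f x) = ((`|c| `^ p)%:E * pint p f)%E.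
Proof.
move=> p0 mf; have n x : (0 <= (`|f x| `^ p)%:E :> \bar R)%E.
  by rewrite lee_fin powR_ge0.
rewrite /pint -ge0_integralZl//; last exact: measurable_pint.
by apply: eq_integral => x _; rewrite normrM powRM// EFinM.
Qed.

Lemma pint_shift p f c : measurable_fun setT f ->
  pint p (fun x => f (x + c)) = pint p f.
Proof.
by move=> mf; rewrite /pint (shift_ge0_integral c (measurable_pint p mf)).
Qed.

Lemma le_pint p f g : 0 <= p -> measurable_fun setT f -> measurable_fun setT g ->
  {ae leb, forall x, `|f x| <= `|g x|} -> (pint p f <= pint p g)%E.
Proof.
move=> p0 mf mg fg; apply: ae_ge0_le_integral => //; [exact: measurable_pint..|].
- apply: filterS fg => x fgx _; rewrite lee_fin.
  by rewrite ge0_ler_powR ?nnegrE.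
Qed.

Lemma inLpD p f g : 0 <= p -> inLp p f -> inLp p g -> inLp p (fun x => f x + g x).
Proof.
move=> p0 [mf pf] [mg pg]; split; first exact: measurable_funD.
apply: (le_lt_trans (pintD p0 mf mg)).
apply: lte_mul_pinfty; [by rewrite lee_fin powR_ge0|by []|exact: lte_add_pinfty pf pg].
Qed.

Lemma inLpZ p c f : 0 <= p -> inLp p f -> inLp p (fun x => c * f x).
Proof.
move=> p0 [mf pf]; split; first exact: measurable_funM.
by rewrite pintZ// lte_mul_pinfty// lee_fin powR_ge0.
Qed.

Lemma inLp_le p f g : 0 <= p -> inLp p g -> measurable_fun setT f ->
  {ae leb, forall x, `|f x| <= `|g x|} -> inLp p f.
Proof.
by move=> p0 [mg pg] mf fg; split; [|exact: le_lt_trans (le_pint p0 mf mg fg) pg].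
Qed.

Variable i : 'I_N.
Notation e := (delta_mx ord0 i : 'rV[R]_N).

Lemma pint_avg p h g : 1 < p -> measurable_fun setT g ->
  (pint p (avg i h g) <= pint p g)%E.
Proof.
move=> p1 mg; have p0 : 0 <= p by rewrite ltW// (lt_trans _ p1).
pose f (z : 'rV[R]_N * measurableTypeR R) : \bar R :=
  (\1_(`[0, 1]%classic : set R) z.2 * `|g (z.1 + (z.2 * h) *: e)| `^ p)%:E.
have f0 z : (0 <= f z)%E by rewrite lee_fin mulr_ge0// powR_ge0.
have mI : measurable_fun setT (\1_(`[0, 1]%classic : set R) : R -> R).
  by apply: measurable_indic; exact: measurable_itv.
have mf : measurable_fun setT f.
  apply/measurable_EFinP; apply: measurable_funM.
    exact: (measurableT_comp mI measurable_snd).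
  by apply: measurable_powR_norm; exact: (measurableT_comp mg (measurable_line i h)).
apply: (@le_trans _ _ (\int[leb]_x \int[leb1]_t f (x, t))%E).
  apply: ge0_le_integral => //.
  - by apply: measurable_pint; exact: measurable_avg.
  - exact: measurable_fun_fubini_tonelli_F.
  - move=> x _; apply: (@jensen01 R p (fun t => g (x + (t * h) *: e))) => //.
    apply: (measurableT_comp mg).
    exact: (measurableT_comp (measurable_line i h) (measurable_pair1 x)).
rewrite fubini_tonelli//.
have fE t : (\int[leb]_x f (x, t) = pint p g * (\1_(`[0, 1]%classic : set R) t)%:E)%E.
  rewrite /f /=; under eq_integral do rewrite mulrC EFinM.
  have gs : measurable_fun setT (fun x : 'rV[R]_N => g (x + (t * h) *: e)).
    exact: measurableT_comp mg (measurable_addr_rV _).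
  rewrite (ge0_integralZr leb measurableT (measurable_pint p gs)).
  - by rewrite -(pint_shift p ((t * h) *: e) mg).
  - by move=> x _; rewrite lee_fin powR_ge0.
  - by rewrite lee_fin.
under eq_integral do rewrite fE.
rewrite ge0_integralZl//; [|exact/measurable_EFinP|exact: pint_ge0].
by rewrite integral_indic//= setIT lebesgue_measure_itv/= lte_fin ltr01 oppr0 adde0 mule1.
Qed.

(** By weakD_line the increment is h times an average of g, and averages do not
    increase the L^p norm. *)
Lemma pint_translate p h w g : 1 < p -> inLp p w -> inLp p g -> weakD i w g ->
  (pint p (fun x => w (x + h *: e) - w x)%R <= (`|h| `^ p)%:E * pint p g)%E.
Proof.
move=> p1 lw lg wg; have p0 : 0 <= p by rewrite ltW// (lt_trans _ p1).
have [mw pw] := lw; have [mg pg] := lg.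
have mA : measurable_fun setT (fun x => h * avg i h g x).
  by apply: measurable_funM => //; exact: measurable_avg.
apply: (@le_trans _ _ (pint p (fun x => h * avg i h g x))).
  apply: le_pint => //.
    by apply: measurable_funB => //; exact: measurableT_comp mw (measurable_addr_rV _).
  have := weakD_line h (inLp_locint (ltW p1) lw) (inLp_locint (ltW p1) lg) wg.
  by apply: filterS => x ->.
rewrite (pintZ h p0 (measurable_avg i h mg)).
by apply: lee_wpmul2l; [rewrite lee_fin powR_ge0|exact: pint_avg].
Qed.

End Lp.

(** * Finiteness of the Gagliardo seminorm *)

Section dyadic.
Context {R : realType} {N : nat}.
Notation leb := (@lebesgue_rV R N).

Lemma geometric_eseries_lty (c z : R) : 0 <= z < 1 ->
  (\sum_(k <oo) (c * z ^+ k)%:E < +oo)%E.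
Proof.
move=> /andP[z0 z1].
have cv : cvgn (series (geometric c z)).
  by apply: is_cvg_geometric_series; rewrite ger0_norm.
rewrite (_ : (fun n => _) = EFin \o series (geometric c z)).
  by rewrite EFin_lim// ltry.
by apply/funext => n; rewrite /= /series /= sumEFin.
Qed.

Lemma le_nneseries_term (f : nat -> \bar R) k : (forall n, (0 <= f n)%E) ->
  (f k <= \sum_(n <oo) f n)%E.
Proof.
move=> f0; apply: (@le_trans _ _ (\sum_(0 <= n < k.+1) f n)%E).
  by rewrite big_nat_recr//= leeDr// sume_ge0.
by apply: nneseries_lim_ge.
Qed.

Lemma exists_dyadic_small (x : R) : 0 < x <= 1 ->
  exists k, 2^-1 ^+ k.+1 < x <= 2^-1 ^+ k.
Proof.
move=> /andP[x0 x1].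
have ex : exists n, 2^-1 ^+ n < x.
  exists (Num.truncn x^-1); rewrite exprVn invf_plt ?posrE ?exprn_gt0//.
  rewrite (lt_le_trans (truncnS_gt _))//.
  by rewrite -natrX ler_nat ltn_expl.
case: (ex_minnP ex) => -[|k]; first by rewrite expr0 ltNge x1.
move=> kx hk; exists k; rewrite kx/= leNgt; apply/negP => /hk.
by rewrite ltnn.
Qed.

Lemma exists_dyadic_large (x : R) : 1 < x -> exists k, 2 ^+ k < x <= 2 ^+ k.+1.
Proof.
move=> x1.
have ex : exists n, x <= 2 ^+ n.
  exists (Num.truncn x).+1; rewrite ltW// (lt_le_trans (truncnS_gt _))//.
  by rewrite -natrX ler_nat ltnW// ltn_expl.
case: (ex_minnP ex) => -[|k]; first by rewrite expr0 leNgt x1.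
move=> kx hk; exists k; rewrite kx/= andbT ltNge; apply/negP => /hk.
by rewrite ltnn.
Qed.

Lemma powR_exprn (x a : R) n : 0 <= x -> (x ^+ n) `^ a = (x `^ a) ^+ n.
Proof.
by move=> x0; rewrite -powR_mulrn// -powRrM mulrC powRrM powR_mulrn// powR_ge0.
Qed.

Lemma norm_le_enorm (x : 'rV[R]_N) : `|x| <= enorm x.
Proof.
rewrite ler_norm_rV ?sqrtr_ge0//; apply/forallP => i.
rewrite -sqrtr_sqr ler_sqrt; last first.
  by apply: sumr_ge0 => j _; rewrite -expr2 sqr_ge0.
by rewrite /dot (bigD1 i)//= -expr2 lerDl sumr_ge0// => j _; rewrite -expr2 sqr_ge0.
Qed.

Lemma measurable_enorm : measurable_fun setT (@enorm R N).
Proof.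
apply: measurableT_comp.
  by apply: continuous_measurable_fun; exact: sqrt_continuous.
rewrite /dot; elim: (index_enum _) => [|i l IH].
  by under eq_fun do rewrite big_nil; exact: measurable_cst.
under eq_fun do rewrite big_cons.
by apply: measurable_funD => //; apply: measurable_funM; exact: measurable_coord.
Qed.

Lemma enorm0 : enorm (0 : 'rV[R]_N) = 0.
Proof. by rewrite /enorm /dot big1 ?sqrtr0// => i _; rewrite mxE mul0r. Qed.

Lemma ler_powR_norm_neg (a x y : R) : 0 <= a -> 0 < x -> x <= y ->
  y `^ (- a) <= x `^ (- a).
Proof.
move=> a0 x0 xy; have y0 := lt_le_trans x0 xy.
rewrite !powRN lef_pV2 ?posrE ?powR_gt0//.
by rewrite ge0_ler_powR// nnegrE ltW.
Qed.

Variables (p s : R) (D : 'rV[R]_N -> \bar R) (C C' : R).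
Hypotheses (p1 : 0 < p) (s0 : 0 < s) (s1 : s < 1).
Hypotheses (mD : measurable_fun setT D) (D0 : forall h, (0 <= D h)%E)
  (C0 : 0 <= C) (C'0 : 0 <= C')
  (DC : forall h, (D h <= (C * `|h| `^ p)%:E)%E)
  (DC' : forall h, (D h <= C'%:E)%E).

Let a : R := N%:R + p * s.
Let A : R := 2 `^ a.
Let P : R := 2 `^ p.
Let T : R := 2 ^+ N.
(** On the shell 2^-(k+1) < |h| <= 2^-k the kernel is at most A^(k+1), and D is at
    most C P^-k; on the shell 2^k < |h| <= 2^(k+1) the kernel is at most A^-k, and D
    is at most C'. The cubes that contain the shells have volume T^(1-k) and T^(k+2),
    so the sums are geometric of ratios A / (P T) = 2^(ps-p) and T / A = 2^(-ps). *)
Let c k := A ^+ k.+1 * (C * P^-1 ^+ k).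
Let d k := A^-1 ^+ k * C'.

Let a0 : 0 <= a. Proof. by rewrite addr_ge0// mulr_ge0// ltW. Qed.
Let A0 : 0 < A. Proof. by rewrite powR_gt0. Qed.
Let P0 : 0 < P. Proof. by rewrite powR_gt0. Qed.
Let T0 : 0 < T. Proof. by rewrite exprn_gt0. Qed.
Let AE : A = T * 2 `^ (p * s).
Proof. by rewrite /A /a powRD ?powR_mulrn// pnatr_eq0 implybT. Qed.

Let ltr_powR2 (x y : R) : x < y -> 2 `^ x < 2 `^ y :> R.
Proof.
by move=> xy; rewrite /powR !gt_eqF// ltr_expR ltr_pM2r// ln_gt0// ltr1n.
Qed.

Let ps1 : 1 < 2 `^ (p * s).
Proof. by rewrite -[ltLHS](@powRr0 _ (2 : R)) ltr_powR2// mulr_gt0. Qed.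

Let psp : 2 `^ (p * s) < P.
Proof. by rewrite ltr_powR2// gtr_pMr. Qed.

Let ck0 k : 0 <= c k.
Proof.
have := ltW A0; have := ltW P0 => ? ?.
by rewrite /c mulr_ge0 ?exprn_ge0// mulr_ge0// exprn_ge0// invr_ge0.
Qed.

Let dk0 k : 0 <= d k.
Proof. by rewrite /d mulr_ge0// exprn_ge0// invr_ge0 ltW. Qed.

Let S1 (h : 'rV[R]_N) := (\sum_(k <oo) (c k * \1_(cube N (2^-1 ^+ k)) h)%:E)%E.
Let S2 (h : 'rV[R]_N) := (\sum_(k <oo) (d k * \1_(cube N (2 ^+ k.+1)) h)%:E)%E.

Let kD_le h : h != 0 -> ((`|h| `^ (- a))%:E * D h <= S1 h + S2 h)%E.
Proof.
move=> hn0; have h0 : 0 < `|h| by rewrite normr_gt0.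
have S10 : (0 <= S1 h)%E by apply: nneseries_ge0 => k _ _; rewrite lee_fin mulr_ge0.
have S20 : (0 <= S2 h)%E by apply: nneseries_ge0 => k _ _; rewrite lee_fin mulr_ge0.
have [h1|h1] := leP `|h| 1.
  have [|k /andP[k1 k2]] := @exists_dyadic_small `|h|; first by rewrite h0.
  apply: (le_trans _ (leeDl _ S20)).
  apply: (le_trans _ (@le_nneseries_term _ k _)); last first.
    by move=> n; rewrite lee_fin mulr_ge0.
  rewrite indicE mem_set// mulr1 /c EFinM lee_pmul ?lee_fin ?powR_ge0//.
    apply: (le_trans (ler_powR_norm_neg a0 _ (ltW k1))).
      by rewrite exprn_gt0// invr_gt0.
    by rewrite powR_exprn ?invr_ge0// -powR_inv1// -powRrM mulN1r opprK.
  apply: (le_trans (DC h)); rewrite lee_fin ler_wpM2l//.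
  have -> : P^-1 = 2^-1 `^ p by rewrite -[in RHS]powR_inv1// -powRrM mulN1r powRN.
  rewrite -powR_exprn ?invr_ge0// ge0_ler_powR ?nnegrE ?exprn_ge0 ?invr_ge0//.
  exact: ltW.
have [k /andP[k1 k2]] := exists_dyadic_large h1.
apply: (le_trans _ (leeDr _ S10)).
apply: (le_trans _ (@le_nneseries_term _ k _)); last first.
  by move=> n; rewrite lee_fin mulr_ge0.
rewrite indicE mem_set// mulr1 /d EFinM lee_pmul ?lee_fin ?powR_ge0//.
apply: (le_trans (ler_powR_norm_neg a0 _ (ltW k1))); first by rewrite exprn_gt0.
by rewrite powR_exprn// powRN.
Qed.

Let int_indic_cube (u : nat -> R) (z : nat -> R) : (forall k, 0 <= u k) ->
    (forall k, 0 <= z k) ->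
  (\int[leb]_h (\sum_(k <oo) (u k * \1_(cube N (z k)) h)%:E) =
   \sum_(k <oo) (u k * (2 * z k) ^+ N)%:E)%E.
Proof.
move=> u0 z0; rewrite integral_nneseries//; first last.
- by move=> k h _; rewrite lee_fin mulr_ge0.
- move=> k; apply/measurable_EFinP; apply: measurable_funM => //.
  by apply: measurable_indic; exact: measurable_cube.
apply: eq_eseriesr => k _.
have mc := @measurable_cube R N (z k).
have mi : measurable_fun setT (fun h => (\1_(cube N (z k)) h)%:E : \bar R).
  by apply/measurable_EFinP; exact: measurable_indic.
under eq_integral do rewrite EFinM.
rewrite ge0_integralZl//; last by rewrite lee_fin.
by rewrite integral_indic//= setIT lebesgue_cube// -EFinM.
Qed.

(** The bound of order p near 0 and the constant bound at infinity make the
    two geometric series of shells converge, since 0 < s < 1. *)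
Lemma dyadic_finite :
  (\int[leb]_h ((enorm h `^ (- a))%:E * D h) < +oo)%E.
Proof.
have mS (u z : nat -> R) : (forall k, 0 <= u k) -> measurable_fun setT
    (fun h => (\sum_(k <oo) (u k * \1_(cube N (z k)) h)%:E)%E).
  move=> u0; apply: ge0_emeasurable_sum.
    by move=> k h _ _; rewrite lee_fin mulr_ge0.
  move=> k _; apply/measurable_EFinP; apply: measurable_funM => //.
  by apply: measurable_indic; exact: measurable_cube.
have S10 h : (0 <= S1 h)%E by apply: nneseries_ge0 => k _ _; rewrite lee_fin mulr_ge0.
have S20 h : (0 <= S2 h)%E by apply: nneseries_ge0 => k _ _; rewrite lee_fin mulr_ge0.
apply: (@le_lt_trans _ _ (\int[leb]_h (S1 h + S2 h))%E).
  apply: ge0_le_integral => //.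
  - by move=> h _; rewrite mule_ge0// lee_fin powR_ge0.
  - apply: emeasurable_funM => //; apply/measurable_EFinP.
    exact: (measurableT_comp (measurable_powR _) measurable_enorm).
  - by apply: emeasurable_funD; exact: mS.
  - move=> h _; have [->|h0] := eqVneq h 0.
      rewrite enorm0 powR0 ?mul0e ?adde_ge0//.
      by rewrite oppr_eq0 gt_eqF// ltr_wpDl// mulr_gt0.
    apply: (le_trans _ (kD_le h0)); rewrite lee_wpmul2r// lee_fin.
    apply: ler_powR_norm_neg => //; first by rewrite normr_gt0.
    exact: norm_le_enorm.
rewrite ge0_integralD//; [|exact: mS..].
have z1 (k : nat) : 0 <= 2^-1 ^+ k :> R by rewrite exprn_ge0// invr_ge0.
have z2 (k : nat) : 0 <= 2 ^+ k.+1 :> R by rewrite exprn_ge0.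
rewrite (int_indic_cube ck0 z1) (int_indic_cube dk0 z2).
apply: lte_add_pinfty.
  rewrite (_ : (fun n => _) = (fun n => (\sum_(0 <= k < n) ((A * C * T) * (A / (P * T)) ^+ k)%:E)%E)).
    apply: geometric_eseries_lty; rewrite divr_ge0 ?mulr_ge0 ?ltW//=.
    by rewrite ltr_pdivrMr ?mulr_gt0// mul1r AE mulrC ltr_pM2r.
  apply/funext => n; apply: eq_bigr => k _; congr (_%:E).
  have -> : (2 * 2^-1 ^+ k) ^+ N = T * T^-1 ^+ k.
    by rewrite exprMn -exprM mulnC exprM !exprVn.
  by rewrite /c exprMn invfM exprMn exprS; ring.
rewrite (_ : (fun n => _) = (fun n => (\sum_(0 <= k < n) ((C' * T * T) * (T / A) ^+ k)%:E)%E)).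
  apply: geometric_eseries_lty; rewrite divr_ge0 ?ltW//=.
  by rewrite ltr_pdivrMr// mul1r AE ltr_pMr.
apply/funext => n; apply: eq_bigr => k _; congr (_%:E).
have -> : (2 * 2 ^+ k.+1) ^+ N = T * (T * T ^+ k).
  by rewrite exprMn -exprM mulnC exprM exprS.
by rewrite /d exprMn; ring.
Qed.

End dyadic.

Section gagliardo.
Context {R : realType} {N : nat}.
Notation leb := (@lebesgue_rV R N).
Notation V := ('rV[R]_N).
Variables (p s : R) (w : V -> R) (G : 'I_N -> V -> R).
Hypotheses (p1 : 1 < p) (s0 : 0 < s) (s1 : s < 1).
Hypotheses (lw : inLp p w) (lG : forall i, inLp p (G i))
  (wG : forall i, weakD i w (G i)).

Let p0 : 0 <= p. Proof. by rewrite ltW// (lt_trans _ p1). Qed.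
Let mw : measurable_fun setT w. Proof. by case: lw. Qed.

Let mshift (c : V) : measurable_fun setT (fun x : V => w (x + c)).
Proof. exact: measurableT_comp mw (measurable_addr_rV c). Qed.

(** A translation by h is a succession of translations along the axes, each of which
    is controlled by the corresponding weak derivative. *)
Let translate_seq (l : seq 'I_N) : exists2 C : R, 0 <= C & forall h : V,
  (pint p (fun x : V => w (x + \sum_(i <- l) h ord0 i *: delta_mx ord0 i) - w x)%R <=
   (C * `|h| `^ p)%:E)%E.
Proof.
elim: l => [|i l [C C0 IH]].
  exists 0 => // h; rewrite mul0r /pint.
  under eq_integral do rewrite big_nil addr0 subrr normr0 powR0 ?gt_eqF// ?(lt_trans _ p1)//.
  by rewrite integral0.
have Gfin : pint p (G i) \is a fin_num.
  by rewrite ge0_fin_numE ?pint_ge0//; case: (lG i).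
pose K := fine (pint p (G i)).
have K0 : 0 <= K by rewrite fine_ge0// pint_ge0.
exists (2 `^ p * (K + C)) => [|h].
  by rewrite mulr_ge0 ?powR_ge0// addr_ge0.
pose S : V := \sum_(j <- l) h ord0 j *: delta_mx ord0 j.
pose f1 (x : V) := w ((x + S) + h ord0 i *: delta_mx ord0 i) - w (x + S).
pose f2 (x : V) := w (x + S) - w x.
rewrite (_ : (fun x => _) = (fun x => f1 x + f2 x)); last first.
  apply/funext => x; rewrite big_cons /f1 /f2 -/S addrA (addrAC x).
  by rewrite addrA subrK.
have m1 : measurable_fun setT f1.
  rewrite /f1; apply: measurable_funB => //.
  by under eq_fun do rewrite -addrA; exact: mshift.
have m2 : measurable_fun setT f2 by exact: measurable_funB.
apply: (le_trans (pintD p0 m1 m2)).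
rewrite -mulrA EFinM lee_wpmul2l ?lee_fin ?powR_ge0// mulrDl EFinD leeD//; last exact: IH.
have mg : measurable_fun setT (fun x : V => w (x + h ord0 i *: delta_mx ord0 i) - w x).
  exact: measurable_funB.
rewrite (pint_shift p S mg).
apply: (le_trans (pint_translate _ p1 lw (lG i) (wG i))).
rewrite -(fineK Gfin) -/K -EFinM lee_fin mulrC ler_wpM2l//.
by rewrite ge0_ler_powR ?nnegrE// norm_coord_le.
Qed.

Let translate : exists2 C : R, 0 <= C & forall h : V,
  (pint p (fun x : V => w (x + h) - w x)%R <= (C * `|h| `^ p)%:E)%E.
Proof.
have [C C0 hC] := translate_seq (index_enum 'I_N).
exists C; [exact: C0|move=> h].
by have := hC h; rewrite -row_sum_delta.
Qed.

Let translate_bound : exists2 C : R, 0 <= C & forall h : V,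
  (pint p (fun x : V => w (x + h) - w x)%R <= C%:E)%E.
Proof.
have wfin : pint p w \is a fin_num by rewrite ge0_fin_numE ?pint_ge0//; case: lw.
pose K := fine (pint p w).
have K0 : 0 <= K by rewrite fine_ge0// pint_ge0.
exists (2 `^ p * (K + K)) => [|h]; first by rewrite mulr_ge0 ?powR_ge0 ?addr_ge0.
have mN : measurable_fun setT (fun x => - w x) by exact: measurable_funN.
apply: (le_trans (pintD p0 (mshift h) mN)).
by rewrite pintN pint_shift// EFinM EFinD (fineK wfin).
Qed.

Let mk : measurable_fun setT (fun h : V => enorm h `^ (- (N%:R + p * s))).
Proof. exact: (measurableT_comp (measurable_powR _) measurable_enorm). Qed.

Lemma measurable_add_rV : measurable_fun setT (fun z : V * V => z.1 + z.2).
Proof.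
apply/measurable_fun_coordP => j.
under eq_fun do rewrite mxE.
apply: measurable_funD.
  exact: (measurableT_comp (measurable_coord j) measurable_fst).
exact: (measurableT_comp (measurable_coord j) measurable_snd).
Qed.

Lemma measurable_sub_rV : measurable_fun setT (fun z : V * V => z.1 - z.2).
Proof.
apply/measurable_fun_coordP => j.
under eq_fun do rewrite !mxE.
apply: measurable_funB.
  exact: (measurableT_comp (measurable_coord j) measurable_fst).
exact: (measurableT_comp (measurable_coord j) measurable_snd).
Qed.

(** With x = y + h the inner integral becomes the p-th power of the L^p norm of a
    translation increment. It is at most C |h|^p by the gradient bound, and bounded
    because w itself is in L^p: the two inputs of dyadic_finite. *)
Lemma gagliardo_finite :
  (\int[(leb \x leb)%E]_z (`|w z.1 - w z.2| `^ p *
     enorm (z.1 - z.2) `^ (- (N%:R + p * s)))%:E < +oo)%E.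
Proof.
set k := - (N%:R + p * s).
pose f (z : V * V) : \bar R :=
  (`|w z.1 - w z.2| `^ p * enorm (z.1 - z.2) `^ k)%:E.
pose g (z : V * V) : \bar R :=
  (enorm z.1 `^ k * `|w (z.2 + z.1) - w z.2| `^ p)%:E.
have f0 z : (0 <= f z)%E by rewrite lee_fin mulr_ge0 ?powR_ge0.
have g0 z : (0 <= g z)%E by rewrite lee_fin mulr_ge0 ?powR_ge0.
have mf : measurable_fun setT f.
  apply/measurable_EFinP; apply: measurable_funM.
    apply: measurable_powR_norm; apply: measurable_funB.
      exact: (measurableT_comp mw measurable_fst).
    exact: (measurableT_comp mw measurable_snd).
  exact: (measurableT_comp mk measurable_sub_rV).
have mg : measurable_fun setT g.
  apply/measurable_EFinP; apply: measurable_funM.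
    exact: (measurableT_comp mk measurable_fst).
  apply: measurable_powR_norm; apply: measurable_funB.
    under eq_fun do rewrite addrC.
    exact: (measurableT_comp mw measurable_add_rV).
  exact: (measurableT_comp mw measurable_snd).
rewrite -/(f _) (fubini_tonelli2 f)//.
rewrite (_ : (\int[leb]_y _)%E = (\int[leb]_y \int[leb]_h g (h, y))%E); last first.
  apply: eq_integral => y _; rewrite /fubini_G.
  have mfy : measurable_fun setT (fun x => f (x, y)).
    exact: (measurableT_comp mf (measurable_pair2 y)).
  rewrite -(shift_ge0_integral y mfy (fun x => f0 (x, y))).
  apply: eq_integral => h _; rewrite /f /g /= addrK mulrC.
  by rewrite (addrC h).
rewrite -(fubini_tonelli g)//.
have [C C0 hC] := translate; have [C' C'0 hC'] := translate_bound.
pose D (h : V) := pint p (fun x : V => w (x + h) - w x).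
have mD : measurable_fun setT D.
  rewrite /D /pint.
  pose g1 (z : V * V) : \bar R := (`|w (z.2 + z.1) - w z.2| `^ p)%:E.
  apply: (measurable_fun_fubini_tonelli_F g1).
    apply/measurable_EFinP; apply: measurable_powR_norm; apply: measurable_funB.
      under eq_fun do rewrite addrC.
      exact: (measurableT_comp mw measurable_add_rV).
    exact: (measurableT_comp mw measurable_snd).
  by move=> z; rewrite lee_fin powR_ge0.
have := @dyadic_finite R N p s D C C' (lt_trans ltr01 p1) s0 s1 mD
  (fun h => pint_ge0 _ _) C0 C'0 hC hC'.
rewrite (_ : (\int[leb]_h _)%E = (\int[leb]_x \int[leb]_y g (x, y))%E)//.
apply: eq_integral => h _.
rewrite /g /=; under [RHS]eq_integral do rewrite EFinM.
rewrite ge0_integralZl//.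
- by apply: measurable_pint; exact: measurable_funB.
- by rewrite lee_fin powR_ge0.
Qed.

End gagliardo.

(** * Difference quotients *)

Lemma difference_cvg {R : realType} {V : normedModType R} (f : V -> R) (x v : V)
    (h : nat -> R) : derivable f x v -> (forall n, h n != 0) ->
  h n @[n --> \oo] --> (0 : R) ->
  (f (x + h n *: v) - f x) / h n @[n --> \oo] --> 'D_v f x.
Proof.
move=> dy hn0 h0.
have h1 : h @ \oo --> (0 : R)^'.
  move=> A [d /= d0 dA]; move/cvgrPdist_lt: h0 => /(_ _ d0) hd.
  by apply: filterS hd => n hn; apply: dA => //=.
have := cvg_comp _ _ h1 dy.
apply: cvg_trans; apply: near_eq_cvg; near=> n => /=.
by rewrite (addrC x) [RHS]mulrC.
Unshelve. all: by end_near. Qed.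

Section test_difference_quotient.
Context {R : realType} {N : nat}.
Notation V := ('rV[R]_N).
Variable i : 'I_N.
Notation e := (delta_mx ord0 i : V).
Variable phi : V -> R.
Hypothesis tphi : test_function phi.

Lemma is_derive_test_line x (t : R) :
  is_derive t 1 (fun t => phi (x + t *: e)) (partial i phi (x + t *: e)).
Proof.
have d0 (y : V) : is_derive (0 : R) 1 (fun h : R => phi (h *: e + y)) (partial i phi y).
  have dy : derivable phi y e by exact/diff_derivable/test_differentiable.
  split; first by move/derivable1P: dy.
  rewrite /partial /derive; set g1 := fun h => h^-1 *: _; set g2 := fun h => h^-1 *: _.
  suff -> : g1 = g2 by [].
  by apply/funext => h; rewrite /g1 /g2 /= addr0 scale0r add0r [_%:A]mulr1.
have dd : is_derive (1 * t + - t) 1 (fun h : R => phi (h *: e + (x + t *: e)))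
    (partial i phi (x + t *: e)).
  by rewrite mul1r subrr; exact: d0.
have := @is_derive1_comp _ _ (fun t' : R => 1 * t' + - t) t _ _ dd
  (is_derive_affine 1 (- t) t).
rewrite mulr1 (_ : _ \o _ = (fun t => phi (x + t *: e)))//.
apply/funext => t' /=; rewrite mul1r scalerBl; congr phi.
by rewrite addrC -addrA (addrC (t *: e)) subrK.
Qed.

Lemma test_difference_le C : (forall x, `|partial i phi x| <= C) ->
  forall x (h : R), 0 < h -> `|(phi (x + h *: e) - phi x) / h| <= C.
Proof.
move=> hC x h h0.
have [||c _] := @MVT_segment _ (fun t : R => phi (x + t *: e))
    (fun t => partial i phi (x + t *: e)) 0 h (ltW h0).
- by move=> t _; exact: is_derive_test_line.
- apply: continuous_subspaceT => t.
  apply: differentiable_continuous; apply/derivable1_diffP.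
  by have [] := is_derive_test_line x t.
by rewrite scale0r addr0 subr0 => ->; rewrite mulfK// gt_eqF.
Qed.

Lemma test_difference_cvg (h : nat -> R) x : (forall n, h n != 0) ->
  h n @[n --> \oo] --> (0 : R) ->
  (phi (x + h n *: e) - phi x) / h n @[n --> \oo] --> partial i phi x.
Proof.
by move=> hn0 h0; apply: difference_cvg => //; exact/diff_derivable/test_differentiable.
Qed.

Lemma partial_supp r : (forall x, phi x != 0 -> cube N r x) ->
  forall x, partial i phi x != 0 -> cube N r x.
Proof.
move=> hr x px; apply: contrapT => ncx.
have nx : \near x, cst (0 : R) x = phi x.
  have : nbhs x (~` cube N r).
    by apply: open_nbhs_nbhs; split => //; apply: closed_openC; exact: closed_cube.
  apply: filterS => y ny; apply/esym/eqP; apply: contra_notT ny; exact: hr.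
have pE : partial i phi x = derive (cst (0 : R)) x e by apply/esym; exact: near_eq_derive.
by move: px; rewrite pE derive_cst eqxx.
Qed.

End test_difference_quotient.

Section ae_convergence.
Context {R : realType} {N : nat}.
Notation leb := (@lebesgue_rV R N).
Notation V := ('rV[R]_N).
Variables (i : 'I_N) (p : R) (w g : V -> R).
Notation e := (delta_mx ord0 i : V).
Hypotheses (p1 : 1 < p) (lw : inLp p w) (lg : inLp p g) (wg : weakD i w g).

Lemma eseries_lty_cvg0 (f : nat -> R) : (forall n, 0 <= f n) ->
  (\sum_(n <oo) (f n)%:E < +oo)%E -> f n @[n --> \oo] --> (0 : R).
Proof.
move=> f0 fs.
have tl : (\sum_(n <= k <oo) (f k)%:E)%E @[n --> \oo] --> (0 : \bar R).
  by apply: nneseries_tail_cvg => // k _; rewrite lee_fin.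
have /fine_cvg : (fun n => (f n)%:E) @ \oo --> (0 : \bar R).
  apply: (@squeeze_cvge _ _ _ _ (cst 0%E) _ (fun n => \sum_(n <= k <oo) (f k)%:E)%E) => //.
  - apply: nearW => n; rewrite /= lee_fin f0/=.
    rewrite (@nneseries_split _ _ n 1); last by move=> k _; rewrite lee_fin.
    by rewrite addn1 big_nat1 leeDl// nneseries_ge0// => k _ _; rewrite lee_fin.
  - exact: cvg_cst.
by [].
Qed.

(** Translations converge in L^p only, but for |c n| <= 2^-n the p-th powers of the
    increments have summable integrals, whence almost everywhere convergence. *)
Lemma ae_cvg_shift (c : nat -> R) : (forall n, `|c n| <= 2^-1 ^+ n) ->
  {ae leb, forall x, w (x + c n *: e) @[n --> \oo] --> w x}.
Proof.
move=> c2; have p0 : 0 <= p by rewrite ltW// (lt_trans _ p1).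
have [mw _] := lw.
pose f n x := `|w (x + c n *: e) - w x| `^ p.
have mf n : measurable_fun setT (fun x => (f n x)%:E).
  apply: measurable_pint; apply: measurable_funB => //.
  exact: measurableT_comp mw (measurable_addr_rV _).
have f0 n x : (0 <= (f n x)%:E)%E by rewrite lee_fin powR_ge0.
have Gfin : pint p g \is a fin_num.
  by rewrite ge0_fin_numE ?pint_ge0//; case: lg.
pose K := fine (pint p g).
have K0 : 0 <= K by rewrite fine_ge0// pint_ge0.
have S : (\int[leb]_x (\sum_(n <oo) (f n x)%:E) < +oo)%E.
  rewrite integral_nneseries//.
  apply: (@le_lt_trans _ _ (\sum_(n <oo) (K * (2^-1 `^ p) ^+ n)%:E)%E).
    apply: lee_nneseries => [n _ _|n _ ]; first by apply: integral_ge0.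
    apply: (le_trans (pint_translate (c n) p1 lw lg wg)).
    rewrite -(fineK Gfin) -/K -EFinM lee_fin mulrC ler_wpM2l//.
    by rewrite -powR_exprn ?invr_ge0// ge0_ler_powR ?nnegrE// exprn_ge0 ?invr_ge0.
  apply: geometric_eseries_lty; rewrite powR_ge0/=.
  have := @gt0_ltr_powR R p (lt_trans ltr01 p1) 2^-1 1.
  by rewrite powR1 !nnegrE invr_ge0; apply => //; rewrite invf_lt1// ltr1n.
have mS : measurable_fun setT (fun x => (\sum_(n <oo) (f n x)%:E)%E).
  by apply: ge0_emeasurable_sum.
have : leb.-integrable setT (fun x => (\sum_(n <oo) (f n x)%:E)%E).
  apply/integrableP; split => //.
  under eq_integral do rewrite gee0_abs ?nneseries_ge0//.
  exact: S.
move=> /integrable_ae => /(_ measurableT); apply: filterS => x /(_ I) fin.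
have fx0 : f n x @[n --> \oo] --> (0 : R).
  apply: eseries_lty_cvg0 => [n|]; first exact: powR_ge0.
  by rewrite -ge0_fin_numE// nneseries_ge0.
apply/cvgrPdist_lt => d d0.
move/cvgrPdist_lt : fx0 => /(_ (d `^ p)); rewrite powR_gt0// => /(_ isT).
apply: filterS => n; rewrite sub0r normrN ger0_norm ?powR_ge0// /f => fd.
rewrite distrC ltNge; apply/negP => dw; move: fd; rewrite ltNge.
by rewrite ge0_ler_powR ?nnegrE// ltW.
Qed.

End ae_convergence.

(** * The weak derivative of an absolute value *)

Section smoothed_abs.
Context {R : realType}.
Implicit Types eps a b r : R.

(** sabs is the smooth approximation of the absolute value, and dabs its difference
    quotient between a and b in a form that has a value for a = b and is continuous. *)
Definition sabs eps r := Num.sqrt (r ^+ 2 + eps ^+ 2).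
Definition dabs eps a b := (a + b) / (sabs eps a + sabs eps b).

Lemma sabs_ge eps r : `|r| <= sabs eps r.
Proof. by rewrite -sqrtr_sqr ler_wsqrtr// lerDl sqr_ge0. Qed.

Lemma sabs_gt0 eps r : 0 < eps -> 0 < sabs eps r.
Proof. by move=> e0; rewrite sqrtr_gt0 ltr_wpDl ?sqr_ge0// exprn_gt0. Qed.

Lemma sabs_le eps r : 0 <= eps -> sabs eps r <= `|r| + eps.
Proof.
move=> e0; rewrite -[leRHS]ger0_norm ?addr_ge0// -sqrtr_sqr ler_wsqrtr//.
by rewrite sqrrD real_normK ?num_real// addrAC lerDl mulrn_wge0// mulr_ge0.
Qed.

Lemma sabs_ge_eps eps r : 0 <= eps -> eps <= sabs eps r.
Proof.
move=> e0; rewrite -[leLHS]ger0_norm// -sqrtr_sqr ler_wsqrtr//.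
by rewrite lerDr sqr_ge0.
Qed.

Lemma sabs_sub eps a b : 0 < eps ->
  sabs eps a - sabs eps b = dabs eps a b * (a - b).
Proof.
move=> e0; have sa := sabs_gt0 a e0; have sb := sabs_gt0 b e0.
have s0 : sabs eps a + sabs eps b != 0 by rewrite gt_eqF// addr_gt0.
apply: (mulIf s0); rewrite /dabs [RHS]mulrAC mulfVK//.
rewrite -subr_sqr /sabs !sqr_sqrtr ?addr_ge0 ?sqr_ge0//.
by ring.
Qed.

Lemma dabs_le1 eps a b : 0 < eps -> `|dabs eps a b| <= 1.
Proof.
move=> e0; have s0 : 0 < sabs eps a + sabs eps b by rewrite addr_gt0 ?sabs_gt0.
rewrite normrM normfV (gtr0_norm s0) ler_pdivrMr// mul1r.
by rewrite (le_trans (ler_normD _ _))// lerD// sabs_ge.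
Qed.

Lemma continuous_sabs eps : continuous (sabs eps).
Proof.
move=> r; apply: (@continuous_comp _ _ _ (fun r => r ^+ 2 + eps ^+ 2) Num.sqrt).
  by apply: cvgD; [exact: exprn_continuous|exact: cvg_cst].
exact: sqrt_continuous.
Qed.

Lemma dabs_cvg eps (a b : nat -> R) c : 0 < eps ->
  a n @[n --> \oo] --> c -> b n @[n --> \oo] --> c ->
  dabs eps (a n) (b n) @[n --> \oo] --> dabs eps c c.
Proof.
move=> e0 ac bc; apply: cvgM; first exact: cvgD.
apply: cvgV; first by rewrite gt_eqF// addr_gt0// sabs_gt0.
apply: cvgD; first exact: (cvg_comp _ _ ac (@continuous_sabs eps c)).
exact: (cvg_comp _ _ bc (@continuous_sabs eps c)).
Qed.

Lemma measurable_sabs eps : measurable_fun setT (sabs eps).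
Proof. by apply: continuous_measurable_fun; exact: continuous_sabs. Qed.

Lemma measurable_dabs d (T : measurableType d) eps (f1 f2 : T -> R) : 0 < eps ->
  measurable_fun setT f1 -> measurable_fun setT f2 ->
  measurable_fun setT (fun x => dabs eps (f1 x) (f2 x)).
Proof.
move=> e0 m1 m2; have ms1 := measurableT_comp (measurable_sabs eps) m1.
have ms2 := measurableT_comp (measurable_sabs eps) m2.
apply: measurable_funM; first exact: measurable_funD.
have := measurable_funD ms1 ms2.
have mi : measurable_fun setT (fun r : R => r `^ (-1)) by exact: measurable_powR.
move=> /(measurableT_comp mi); apply: eq_measurable_fun => x _ /=.
by rewrite powR_inv1// addr_ge0// ltW// sabs_gt0.
Qed.

Lemma sabs_cvg0 r : sabs n.+1%:R^-1 r @[n --> \oo] --> `|r|.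
Proof.
have h : r ^+ 2 + (n.+1%:R^-1) ^+ 2 @[n --> \oo] --> r ^+ 2 + (0 : R) ^+ 2.
  apply: cvgD; first exact: cvg_cst.
  exact: (cvg_comp _ _ (@cvg_harmonic R) (@exprn_continuous R 2 0)).
have := cvg_comp _ _ h (@sqrt_continuous R _).
by rewrite expr0n/= addr0 sqrtr_sqr.
Qed.

Lemma dabs_cvg0 r : dabs n.+1%:R^-1 r r @[n --> \oo] --> Num.sg r.
Proof.
have [->|r0] := eqVneq r 0.
  rewrite sgr0 /dabs; under eq_fun do rewrite addr0 mul0r.
  exact: cvg_cst.
have -> : Num.sg r = (r + r) / (`|r| + `|r|).
  rewrite -mulr2n -[in X in _ / X]mulr2n -mulr_natl -[in X in _ / X]mulr_natl.
  rewrite [in LHS](_ : Num.sg r = r / `|r|).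
    by field; rewrite normr_eq0.
  by rewrite {2}[r]numEsg mulfK// normr_eq0.
apply: cvgM; first exact: cvg_cst.
apply: cvgV; first by rewrite -mulr2n mulrn_eq0 normr_eq0.
by apply: cvgD; exact: sabs_cvg0.
Qed.

Lemma measurable_sg d (T : measurableType d) (f : T -> R) :
  measurable_fun setT f -> measurable_fun setT (fun x => Num.sg (f x)).
Proof.
move=> mf.
apply: (@measurable_fun_cvg _ _ _ _ (fun n x => dabs n.+1%:R^-1 (f x) (f x))).
  by move=> n; apply: measurable_dabs => //; rewrite invr_gt0.
by move=> x _; exact: dabs_cvg0.
Qed.

End smoothed_abs.

Section chain_rule.
Context {R : realType} {N : nat}.
Notation leb := (@lebesgue_rV R N).
Notation leb1 := (@lebesgue_measure R).
Notation V := ('rV[R]_N).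
Variables (i : 'I_N) (p : R) (w g : V -> R).
Notation e := (delta_mx ord0 i : V).
Hypotheses (p1 : 1 < p) (lw : inLp p w) (lg : inLp p g) (wg : weakD i w g).

Let mw : measurable_fun setT w. Proof. by case: lw. Qed.
Let mg : measurable_fun setT g. Proof. by case: lg. Qed.
Let liw : locint w. Proof. exact: inLp_locint (ltW p1) lw. Qed.
Let lig : locint g. Proof. exact: inLp_locint (ltW p1) lg. Qed.

Let hn (n : nat) : R := 2^-1 ^+ n.
Let hn_gt0 n : 0 < hn n. Proof. by rewrite exprn_gt0// invr_gt0. Qed.
Let hn_le1 n : hn n <= 1.
Proof. by rewrite exprn_ile1 ?invr_ge0// invf_le1// ler1n. Qed.
Let hn_cvg : hn n @[n --> \oo] --> (0 : R).
Proof. by apply: cvg_expr; rewrite ger0_norm ?invr_ge0// invf_lt1// ltr1n. Qed.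

Section fixed_eps.
Variables (eps : R) (phi : V -> R).
Hypotheses (e0 : 0 < eps) (tphi : test_function phi).

Let B (x : V) : R := sabs eps (w x) - eps.
Let D (x : V) : R := dabs eps (w x) (w x).

Let mB : measurable_fun setT B.
Proof. by apply: measurable_funB => //; exact: measurableT_comp (measurable_sabs eps) mw. Qed.

Let BE x : `|B x| <= `|w x|.
Proof.
rewrite /B ger0_norm; last by rewrite subr_ge0 sabs_ge_eps// ltW.
by rewrite lerBlDr sabs_le// ltW.
Qed.

Let lB : inLp p B.
Proof.
by apply: (inLp_le _ lw) => //; [rewrite ltW// (lt_trans _ p1)|apply: aeW => x; exact: BE].
Qed.

Let liB : locint B. Proof. exact: inLp_locint (ltW p1) lB. Qed.

Let mphi : measurable_fun setT phi.
Proof. by apply: continuous_measurable_rVT; exact: test_continuous. Qed.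

Let mpart : measurable_fun setT (partial i phi).
Proof. by apply: continuous_measurable_rVT; exact: test_partial. Qed.

Let eta (n : nat) (x : V) : R := dabs eps (w (x + - hn n *: e)) (w x) * phi x.

Let mshift (c : V) : measurable_fun setT (fun x : V => w (x + c)).
Proof. exact: measurableT_comp mw (measurable_addr_rV c). Qed.

Let meta n : measurable_fun setT (eta n).
Proof. by apply: measurable_funM => //; exact: measurable_dabs. Qed.

(** A chain rule without mollification. Replace the derivative of phi by its
    difference quotient of step 2^-n; a translation moves the quotient to B, where
    sabs_sub and weakD_line express it as dabs times an average of g. The average
    is moved to the bounded factor, along which dominated convergence applies: the
    steps 2^-n make the translates of w converge almost everywhere. *)
Lemma weakD_sabs : \int[leb]_x (B x * partial i phi x) =
  - \int[leb]_x ((D x * g x) * phi x).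
Proof.
have [r r0 hr] := test_supp tphi.
have [C C0 hC] := continuous_supp_bounded (test_continuous tphi) hr.
have hr' := partial_supp (i := i) hr.
have [C' C'0 hC'] := continuous_supp_bounded (test_partial (i := i) tphi) hr'.
have etaC n (x : V) : `|eta n x| <= C.
  by rewrite normrM -[leRHS]mul1r ler_pM// dabs_le1.
have etar n (x : V) : eta n x != 0 -> cube N r x.
  by rewrite mulf_eq0 negb_or => /andP[_ /hr].
(* The derivative of phi is reached through quotients, which a translation can carry
   over to B. *)
pose dq n (x : V) : R := (phi (x + hn n *: e) - phi x) / hn n.
have dqr n (x : V) : dq n x != 0 -> cube N (r + 1) x.
  have [p1x|p1x] := eqVneq (phi (x + hn n *: e)) 0; last first.
    move=> _; rewrite -[X in r + X]normr1.
    apply: (@cube_shift _ _ i r 1 (hn n) x); first by rewrite ltW/=.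
    by rewrite mulr1; exact: hr.
  have [p2x|/hr] := eqVneq (phi x) 0; first by rewrite /dq p1x p2x subrr mul0r eqxx.
  by rewrite /cube /= => /le_trans + _; apply; rewrite lerDl.
have mdq n : measurable_fun setT (dq n).
  apply: measurable_funM => //; apply: measurable_funB => //.
  exact: measurableT_comp mphi (measurable_addr_rV _).
have L1 : \int[leb]_x (B x * dq n x) @[n --> \oo] --> \int[leb]_x (B x * partial i phi x).
  apply: (@dominated_Rintegral _ _ _ _ _ _ (fun x => C' * `|B x| * \1_(cube N (r + 1)) x)).
  - by move=> n; exact: measurable_funM.
  - exact: measurable_funM.
  - apply: aeW => x; apply: cvgMr; apply: test_difference_cvg => // n.
    by rewrite gt_eqF.
  - exact: locint_dom.
  - move=> n x; apply: le_dom; last exact: dqr.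
    by apply: test_difference_le.
(* The average of g is traded for an integral over the segment of translates of eta. *)
pose I n (t : R) := \int[leb]_x (g x * eta n (x + (t * hn n) *: e)).
have E n : \int[leb]_x (B x * dq n x) = - \int[leb1]_(t in `[0, 1]) I n t.
  have dual := avg_dual i lig (meta n) (etaC n) (etar n) (- hn n).
  have -> : \int[leb1]_(t in `[0, 1]) I n t =
      \int[leb]_x (avg i (- hn n) g x * eta n x).
    by rewrite dual; apply: eq_Rintegral => t _; rewrite opprK.
  pose c := - hn n *: e.
  have lBc : locint (fun x => B (x + c)) by exact: locint_shift.
  have i1 := integrable_locintM lBc mphi hC hr.
  have i2 := integrable_locintM liB mphi hC hr.
  have m3 : measurable_fun setT (fun x => B x * phi (x + hn n *: e)).
    by apply: measurable_funM => //; exact: measurableT_comp mphi (measurable_addr_rV _).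
  have s1 : \int[leb]_x (B x * phi (x + hn n *: e)) = \int[leb]_x (B (x + c) * phi x).
    rewrite -(shift_Rintegral c m3); apply: eq_Rintegral => x _.
    by rewrite /c scaleNr subrK.
  have i3 : leb.-integrable setT (EFin \o (fun x => B x * phi (x + hn n *: e))).
    have := shift_integrable (- c) i1.
    apply: eq_integrable => // x _ /=.
    by rewrite subrK /c scaleNr opprK.
  have -> : \int[leb]_x (B x * dq n x) =
      (hn n)^-1 * (\int[leb]_x (B (x + c) * phi x) - \int[leb]_x (B x * phi x)).
    rewrite -s1 -RintegralB// -RintegralZl//; last first.
      by have := integrableB measurableT i3 i2; apply: eq_integrable.
    by apply: eq_Rintegral => x _; rewrite /dq; ring.
  rewrite -RintegralB// -RintegralZl//; last first.
    by have := integrableB measurableT i1 i2; apply: eq_integrable.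
  have iA := integrable_avgM i lig (meta n) (etaC n) (etar n) (- hn n).
  rewrite -mulN1r -RintegralZl//.
  rewrite /Rintegral; congr fine; apply: ae_eq_integral => //.
  - apply/measurable_EFinP; apply: measurable_funM => //.
    apply: measurable_funB; apply: measurable_funM => //.
    exact: measurableT_comp mB (measurable_addr_rV _).
  - apply/measurable_EFinP; apply: measurable_funM => //.
    by apply/measurable_EFinP; exact: measurable_int iA.
  - have := weakD_line (- hn n) liw lig wg; apply: filterS => x wx _.
    congr (_%:E); rewrite -mulrBl /B /eta /c.
    have -> : sabs eps (w (x + - hn n *: e)) - eps - (sabs eps (w x) - eps) =
      dabs eps (w (x + - hn n *: e)) (w x) * (w (x + - hn n *: e) - w x).
      by rewrite -sabs_sub//; ring.
    rewrite wx; have := gt_eqF (hn_gt0 n); move: (hn n) => h h0.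
    by field; rewrite h0.
(* For fixed t both arguments of dabs in the translate of eta n converge to w x. *)
have i0 := locint_dom C (r + 1) lig.
have mDg : measurable_fun setT (fun x => (D x * g x) * phi x).
  by apply: measurable_funM => //; apply: measurable_funM => //; exact: measurable_dabs.
pose L := \int[leb]_x ((D x * g x) * phi x).
have IL (t : R) : 0 <= t <= 1 -> I n t @[n --> \oo] --> L.
  move=> t01.
  apply: (@dominated_Rintegral _ _ _ _ _ _ (fun x => C * `|g x| * \1_(cube N (r + 1)) x)) => //.
  - move=> n; apply: measurable_funM => //.
    exact: measurableT_comp (meta n) (measurable_addr_rV _).
  - have c1 n : `|t * hn n| <= 2^-1 ^+ n.
      case/andP: t01 => t0 t1; rewrite -/(hn n) normrM (ger0_norm t0).
      by rewrite (gtr0_norm (hn_gt0 n)) ler_piMl// ltW.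
    have c2 n : `|t * hn n - hn n| <= 2^-1 ^+ n.
      case/andP: t01 => t0 t1; rewrite -/(hn n) -[X in _ - X]mul1r -mulrBl normrM.
      rewrite (gtr0_norm (hn_gt0 n)) ler_piMl//; first by rewrite ltW.
      by rewrite distrC ger0_norm ?subr_ge0// lerBlDr lerDl.
    have a1 := ae_cvg_shift p1 lw lg wg c1.
    have a2 := ae_cvg_shift p1 lw lg wg c2.
    apply: filterS2 a1 a2 => x x1 x2.
    rewrite (_ : D x * g x * phi x = g x * (D x * phi x)); last by ring.
    apply: cvgMr; apply: cvgM.
      rewrite /D; apply: dabs_cvg => //.
      by under eq_fun do rewrite -addrA -scalerDl.
    have hx : x + (t * hn n) *: e @[n --> \oo] --> x + (t * 0) *: e.
      apply: cvgD; first exact: cvg_cst.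
      by apply: cvgZr_tmp; apply: cvgMr; exact: hn_cvg.
    rewrite mulr0 scale0r addr0 in hx.
    exact: (cvg_comp _ _ hx (test_continuous tphi (x:=x))).
  - move=> n x; apply: (@le_dom _ _ g (fun x => eta n (x + (t * hn n) *: e))).
      exact: etaC.
    move=> /etar /(cube_shift t01); rewrite /cube /= => /le_trans; apply.
    by rewrite lerD2l gtr0_norm.
have IK n (t : R) : 0 <= t <= 1 -> `|I n t| <= \int[leb]_x (C * `|g x| * \1_(cube N (r + 1)) x).
  move=> t01.
  have it := integrable_shiftM i lig (meta n) (etaC n) (etar n) (hn n) t01.
  apply: (le_trans (le_normr_Rintegral _ it)) => //.
  apply: le_Rintegral => //.
    by have := integrable_abse it; apply: eq_integrable.
  move=> x _; apply: (@le_dom _ _ g (fun x => eta n (x + (t * hn n) *: e))).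
    exact: etaC.
  move=> /etar /(cube_shift t01); rewrite /cube /= => /le_trans; apply.
  by rewrite lerD2l gtr0_norm.
pose J : R -> R := \1_(`[0, 1]%classic).
have mJ : measurable_fun setT J by apply: measurable_indic; exact: measurable_itv.
have iJ : leb1.-integrable setT (EFin \o J) by exact: integrable_indic_itv.
have EI n : \int[leb1]_(t in `[0, 1]) I n t = \int[leb1]_t (J t * I n t).
  rewrite Rintegral_mkcond; apply: eq_Rintegral => t _.
  by rewrite patchE /J indicE; case: ifP; rewrite ?mul1r ?mul0r.
have EL : L = \int[leb1]_t (J t * L).
  rewrite RintegralZr// /Rintegral [X in fine X](_ : _ = 1%E) ?mul1r//.
  by rewrite integral_indic//= setIT lebesgue_measure_itv/= lte_fin ltr01 oppr0 adde0.
have J01 t : J t = 0 \/ (J t = 1 /\ 0 <= t <= 1).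
  rewrite /J indicE; case: (boolP (t \in _)) => [/mem_itv01 t01|_]; by [right|left].
pose K := \int[leb]_x (C * `|g x| * \1_(cube N (r + 1)) x).
have L2 : \int[leb1]_(t in `[0, 1]) I n t @[n --> \oo] --> L.
  rewrite [X in _ --> X]EL; under eq_fun do rewrite EI.
  apply: (@dominated_Rintegral _ _ _ leb1 (fun n t => J t * I n t)
    (fun t => J t * L) (fun t => K * J t)).
  - move=> n; apply: measurable_funM => //.
    apply: (@measurable_Rintegral_G _ _ _ _ _ leb (fun z : V * measurableTypeR R =>
      g z.1 * eta n (z.1 + (z.2 * hn n) *: e))).
    apply: measurable_funM; first exact: (measurableT_comp mg measurable_fst).
    exact: (measurableT_comp (meta n) (measurable_line i (hn n))).
  - exact: measurable_funM.
  - apply: aeW => t; case: (J01 t) => [->|[-> t01]].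
      by under eq_fun do rewrite mul0r; rewrite mul0r; exact: cvg_cst.
    by apply: cvgMr; exact: IL.
  - by have := integrableZl measurableT K iJ; apply: eq_integrable.
  - move=> n t; case: (J01 t) => [->|[-> t01]]; first by rewrite mul0r mulr0 normr0.
    by rewrite mul1r mulr1; exact: IK.
have L3 : \int[leb]_x (B x * dq n x) @[n --> \oo] --> - L.
  by under eq_fun do rewrite E; exact: cvgN.
exact: (cvg_unique _ L1 L3).
Qed.

End fixed_eps.

(** As eps tends to 0, sabs - eps tends to the absolute value and dabs at equal
    arguments to the sign, with bounds uniform in eps. *)
Lemma weakD_abs : weakD i (fun x => `|w x|) (fun x => Num.sg (w x) * g x).
Proof.
move=> phi tphi.
have [r r0 hr] := test_supp tphi.
have [C C0 hC] := continuous_supp_bounded (test_continuous tphi) hr.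
have hr' := partial_supp (i := i) hr.
have [C' C'0 hC'] := continuous_supp_bounded (test_partial (i := i) tphi) hr'.
have mphi : measurable_fun setT phi.
  by apply: continuous_measurable_rVT; exact: test_continuous.
have mpart : measurable_fun setT (partial i phi).
  by apply: continuous_measurable_rVT; exact: test_partial.
have e0 n : 0 < n.+1%:R^-1 :> R by rewrite invr_gt0.
have msg := measurable_sg mw.
have L1 : \int[leb]_x ((sabs n.+1%:R^-1 (w x) - n.+1%:R^-1) * partial i phi x)
    @[n --> \oo] --> \int[leb]_x (`|w x| * partial i phi x).
  apply: (@dominated_Rintegral _ _ _ _ _ _ (fun x => C' * `|w x| * \1_(cube N r) x)).
  - move=> n; apply: measurable_funM => //; apply: measurable_funB => //.
    exact: measurableT_comp (measurable_sabs _) mw.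
  - by apply: measurable_funM => //; exact: measurableT_comp.
  - apply: aeW => x; apply: cvgMl; rewrite -[X in _ --> X]subr0.
    by apply: cvgB; [exact: sabs_cvg0|exact: cvg_harmonic].
  - exact: locint_dom.
  - move=> n x; rewrite normrM; apply: (@le_trans _ _ (`|w x| * `|partial i phi x|)).
      rewrite ler_wpM2r// ger0_norm.
        by rewrite lerBlDr sabs_le// ltW.
      by rewrite subr_ge0 sabs_ge_eps// ltW.
    by rewrite -normrM; apply: le_dom => //; exact: hr'.
have L2 : \int[leb]_x ((dabs n.+1%:R^-1 (w x) (w x) * g x) * phi x)
    @[n --> \oo] --> \int[leb]_x ((Num.sg (w x) * g x) * phi x).
  apply: (@dominated_Rintegral _ _ _ _ _ _ (fun x => C * `|g x| * \1_(cube N r) x)).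
  - move=> n; apply: measurable_funM => //; apply: measurable_funM => //.
    exact: measurable_dabs.
  - by apply: measurable_funM => //; exact: measurable_funM.
  - by apply: aeW => x; apply: cvgMl; apply: cvgMl; exact: dabs_cvg0.
  - exact: locint_dom.
  - move=> n x; rewrite -mulrA normrM.
    apply: (@le_trans _ _ `|g x * phi x|); first by rewrite ler_piMl// dabs_le1.
    by apply: le_dom => //; exact: hr.
have L3 : \int[leb]_x ((sabs n.+1%:R^-1 (w x) - n.+1%:R^-1) * partial i phi x)
    @[n --> \oo] --> - \int[leb]_x ((Num.sg (w x) * g x) * phi x).
  by under eq_fun do rewrite weakD_sabs//; exact: cvgN.
exact: (cvg_unique _ L1 L3).
Qed.

End chain_rule.

(** * Monotonicity of the Finsler field *)

Section dot.
Context {R : realType} {N : nat}.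
Implicit Types x y z : 'rV[R]_N.

Lemma dotDl x y z : dot (x + y) z = dot x z + dot y z.
Proof. by rewrite /dot -big_split; apply: eq_bigr => i _; rewrite mxE mulrDl. Qed.

Lemma dotZl (a : R) x y : dot (a *: x) y = a * dot x y.
Proof. by rewrite /dot mulr_sumr; apply: eq_bigr => i _; rewrite mxE mulrA. Qed.

Lemma dotC x y : dot x y = dot y x.
Proof. by apply: eq_bigr => i _; rewrite mulrC. Qed.

Lemma dotZr (a : R) x y : dot x (a *: y) = a * dot x y.
Proof. by rewrite dotC dotZl dotC. Qed.

Lemma dotDr x y z : dot x (y + z) = dot x y + dot x z.
Proof. by rewrite dotC dotDl !(dotC x). Qed.

Lemma dotBr x y z : dot x (y - z) = dot x y - dot x z.
Proof. by rewrite dotDr -(scaleN1r z) dotZr mulN1r. Qed.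

Lemma enorm_le_sum x : enorm x <= \sum_i `|x ord0 i|.
Proof.
have S0 : 0 <= \sum_i `|x ord0 i| by exact: sumr_ge0.
rewrite -[leRHS]ger0_norm// -sqrtr_sqr ler_wsqrtr// expr2 mulr_suml.
apply: ler_sum => i _; rewrite -expr2 -real_normK ?num_real// expr2.
by rewrite ler_wpM2l// (bigD1 i)//= lerDl sumr_ge0.
Qed.

End dot.

Section finsler.
Context {R : realType} {N : nat}.
Notation V := ('rV[R]_N).
Variables (H : V -> R) (p : R).
Hypotheses (p1 : 1 < p) (hH : finsler_minkowski H).
Implicit Types xi eta : V.

Let H0 x : 0 <= H x. Proof. by case: hH => -[]. Qed.
Let HZ (t : R) x : H (t *: x) = `|t| * H x. Proof. by case: hH => -[]. Qed.
Let HC : C1_on (~` [set 0]) H. Proof. by case: hH => -[]. Qed.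
Let H00 : H 0 = 0. Proof. by rewrite -(scale0r (0 : V)) HZ normr0 mul0r. Qed.

(** Strict convexity gives the inequality for independent vectors; for dependent ones
    it is homogeneity. *)
Lemma finsler_triangle x y : H (x + y) <= H x + H y.
Proof.
have [f|] := boolP (free [:: x; y]); first by apply: ltW; case: hH => _ [_]; apply.
rewrite free_cons seq1_free span_seq1 negb_and !negbK => /orP[/vlineP[k ->]|/eqP->].
  have -> : k *: y + y = (k + 1) *: y by rewrite scalerDl scale1r.
  rewrite !HZ -[X in _ <= _ + X]mul1r -mulrDl ler_wpM2r//.
  by rewrite (le_trans (ler_normD _ _))// normr1.
by rewrite addr0 H00 addr0.
Qed.

Let hn (n : nat) : R := n.+1%:R^-1.
Let hn0 n : hn n != 0. Proof. by rewrite invr_eq0 pnatr_eq0. Qed.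
Let hn_gt0 n : 0 < hn n. Proof. by rewrite invr_gt0. Qed.
Let hn_cvg : hn n @[n --> \oo] --> (0 : R). Proof. exact: cvg_harmonic. Qed.

Lemma dot_grad xi eta : xi != 0 -> dot (grad H xi) eta = 'D_eta H xi.
Proof.
move=> /eqP x0; have [dH _] := HC x0.
rewrite deriveE// {2}[eta]row_sum_delta linear_sum.
apply: eq_bigr => i _; rewrite linearZ mxE /partial deriveE//.
by rewrite /GRing.scale/= mulrC.
Qed.

(** The difference quotients of H at xi in the direction eta are at most H eta by the
    triangle inequality. *)
Lemma dot_grad_le xi eta : xi != 0 -> dot (grad H xi) eta <= H eta.
Proof.
move=> x0; rewrite dot_grad//.
have [dH _] := HC (elimN eqP x0).
have c := difference_cvg (diff_derivable (v:=eta) dH) hn0 hn_cvg.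
apply: (cvgr_to_le c); apply: nearW => n.
rewrite ler_pdivrMr// lerBlDl (le_trans (finsler_triangle _ _))// HZ.
by rewrite gtr0_norm// mulrC.
Qed.

(** Euler's relation for a function homogeneous of degree 1. *)
Lemma dot_grad_self xi : xi != 0 -> dot (grad H xi) xi = H xi.
Proof.
move=> x0; rewrite dot_grad//.
have [dH _] := HC (elimN eqP x0).
have c := difference_cvg (diff_derivable (v:=xi) dH) hn0 hn_cvg.
suff qE : (fun n => (H (xi + hn n *: xi) - H xi) / hn n) = fun=> H xi.
  by move: c; rewrite qE => c; exact: (cvg_unique _ c (@cvg_cst _ (H xi) _ _ _)).
apply/funext => n; rewrite -[X in H (X + _)]scale1r -scalerDl HZ.
have := hn_gt0 n; move: (hn n) => h h0.
rewrite ger0_norm; last by rewrite addr_ge0// ltW.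
by field; rewrite gt_eqF.
Qed.

Lemma dot_grad_norm_le xi eta : xi != 0 -> `|dot (grad H xi) eta| <= H eta.
Proof.
move=> x0; rewrite ler_norml dot_grad_le// andbT lerNl -mulN1r -dotZr.
by rewrite (le_trans (dot_grad_le _ x0))// scaleN1r -scaleN1r HZ normrN1 mul1r.
Qed.

Lemma finsler_field_le xi eta :
  `|dot (finsler_field H p xi) eta| <= H xi `^ (p - 1) * H eta.
Proof.
rewrite /finsler_field; case: eqVneq => [_|x0].
  by rewrite /dot big1 ?normr0 ?mulr_ge0 ?powR_ge0// => i _; rewrite mxE mul0r.
by rewrite dotZl normrM ger0_norm ?powR_ge0// ler_wpM2l ?powR_ge0// dot_grad_norm_le.
Qed.

Lemma finsler_field_self xi :
  dot (finsler_field H p xi) xi = H xi `^ (p - 1) * H xi.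
Proof.
rewrite /finsler_field; case: eqVneq => [->|x0].
  by rewrite H00 mulr0 /dot big1// => i _; rewrite mxE mul0r.
by rewrite dotZl dot_grad_self.
Qed.

Lemma powR_mono_mul (a b : R) : 0 <= a -> 0 <= b ->
  0 <= (a `^ (p - 1) - b `^ (p - 1)) * (a - b).
Proof.
have p10 : 0 <= p - 1 by rewrite subr_ge0 ltW.
move=> a0 b0; have [ab|/ltW ba] := leP a b.
  by rewrite mulr_le0 ?subr_le0// ge0_ler_powR.
by rewrite mulr_ge0 ?subr_ge0// ge0_ler_powR.
Qed.

(** Expanding, the diagonal terms are H(xi)^p + H(eta)^p and the mixed ones at most
    H(xi)^(p-1) H(eta) + H(eta)^(p-1) H(xi), so that the expression is at least
    (H(xi)^(p-1) - H(eta)^(p-1)) (H(xi) - H(eta)). *)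
Lemma finsler_monotone xi eta :
  0 <= dot (finsler_field H p xi) (xi - eta) - dot (finsler_field H p eta) (xi - eta).
Proof.
rewrite 2!dotBr 2!finsler_field_self.
have h1 := finsler_field_le xi eta; have h2 := finsler_field_le eta xi.
have h3 := le_trans (ler_norm _) h1; have h4 := le_trans (ler_norm _) h2.
apply: (le_trans (powR_mono_mul (H0 xi) (H0 eta))).
rewrite mulrBr !mulrBl; lra.
Qed.

Lemma finsler_monotone_scale (k : R) xi eta : 0 <= k ->
  0 <= dot (finsler_field H p xi) (k *: (xi - eta)) -
       dot (finsler_field H p eta) (k *: (xi - eta)).
Proof.
move=> k0; rewrite (dotZr k (finsler_field H p xi)) (dotZr k (finsler_field H p eta)).
by rewrite -mulrBr mulr_ge0// finsler_monotone.
Qed.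

Lemma finsler_young xi eta :
  `|dot (finsler_field H p xi) eta| <= H xi `^ p + H eta `^ p.
Proof.
apply: (le_trans (finsler_field_le _ _)).
have p0 : 0 < p by exact: lt_trans p1.
have [ab|/ltW ba] := leP (H xi) (H eta).
  apply: (@le_trans _ _ (H eta `^ (p - 1) * H eta)).
    by rewrite ler_wpM2r// ge0_ler_powR ?nnegrE// subr_ge0 ltW.
  by rewrite mulrC mulr_powRB1// lerDr powR_ge0.
apply: (@le_trans _ _ (H xi `^ (p - 1) * H xi)).
  by rewrite ler_wpM2l ?powR_ge0.
by rewrite mulrC mulr_powRB1// lerDl powR_ge0.
Qed.

Lemma measurable_finsler_coord j :
  measurable_fun setT (fun xi => finsler_field H p xi ord0 j).
Proof.
have o0 : open (~` [set (0 : V)]).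
  by apply: closed_openC; apply: compact_closed; [exact: norm_hausdorff|exact: compact_set1].
have m0 := open_measurable_rV o0.
rewrite -(setvU [set 0]); apply/measurable_funU => //.
  by rewrite -[X in measurable X]setCK; exact: measurableC.
split; last exact: measurable_fun_set1.
have mHp : measurable_fun (~` [set (0 : V)]) (fun xi => H xi `^ (p - 1)).
  apply: (measurableT_comp (measurable_powR _)).
  apply: continuous_measurable_rV => // x x0.
  by apply: differentiable_continuous; have [] := HC x0.
have mPj : measurable_fun (~` [set (0 : V)]) (partial j H).
  apply: continuous_measurable_rV => // x x0.
  by have [_] := HC x0; apply.
apply: eq_measurable_fun (measurable_funM mHp mPj) => x.
rewrite inE /= => /eqP x0.
by rewrite /finsler_field (negbTE x0) !mxE.
Qed.

Lemma measurable_dot_finsler (U Phi : V -> V) :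
  measurable_fun setT U -> measurable_fun setT Phi ->
  measurable_fun setT (fun x => dot (finsler_field H p (U x)) (Phi x)).
Proof.
move=> mU mPhi; rewrite /dot; elim: (index_enum _) => [|i l IH].
  by under eq_fun do rewrite big_nil; exact: measurable_cst.
under eq_fun do rewrite big_cons.
apply: measurable_funD => //; apply: measurable_funM.
  exact: measurableT_comp (measurable_finsler_coord i) mU.
exact: measurableT_comp (measurable_coord i) mPhi.
Qed.

End finsler.

(** * Weak gradients and W^{1,p} *)

Section weak_gradient.
Context {R : realType} {N : nat}.
Notation leb := (@lebesgue_rV R N).
Notation V := ('rV[R]_N).
Implicit Types (u w : V -> R) (G : V -> V).

Lemma weakD_lin i (a b : R) (w1 w2 g1 g2 : V -> R) : locint w1 -> locint w2 -> locint g1 ->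
  locint g2 -> weakD i w1 g1 -> weakD i w2 g2 ->
  weakD i (fun x => a * w1 x + b * w2 x) (fun x => a * g1 x + b * g2 x).
Proof.
move=> l1 l2 k1 k2 d1 d2 phi tphi.
have [r r0 hr] := test_supp tphi.
have cp := test_continuous tphi; have cd := test_partial (i := i) tphi.
have [C C0 hC] := continuous_supp_bounded cp hr.
have hr' := partial_supp (i := i) hr.
have [C' C'0 hC'] := continuous_supp_bounded cd hr'.
have lin f1 f2 (eta : V -> R) : leb.-integrable setT (EFin \o (fun x => f1 x * eta x)) ->
    leb.-integrable setT (EFin \o (fun x => f2 x * eta x)) ->
    \int[leb]_x ((a * f1 x + b * f2 x) * eta x) =
    a * \int[leb]_x (f1 x * eta x) + b * \int[leb]_x (f2 x * eta x).
  move=> i1 i2.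
  have ia : leb.-integrable setT (EFin \o (fun x => a * (f1 x * eta x))).
    by have := integrableZl measurableT a i1; apply: eq_integrable.
  have ib : leb.-integrable setT (EFin \o (fun x => b * (f2 x * eta x))).
    by have := integrableZl measurableT b i2; apply: eq_integrable.
  rewrite -!RintegralZl// -RintegralD//.
  by apply: eq_Rintegral => x _; ring.
have mp := continuous_measurable_rVT cp; have md := continuous_measurable_rVT cd.
rewrite !lin; last 4 first.
- exact: integrable_locintM k1 mp hC hr.
- exact: integrable_locintM k2 mp hC hr.
- exact: integrable_locintM l1 md hC' hr'.
- exact: integrable_locintM l2 md hC' hr'.
by rewrite d1// d2// !mulrN -opprD.
Qed.

Lemma compact_sub_cube (K : set V) : compact K -> exists r, K `<=` cube N r.
Proof.
move=> /compact_bounded[M [_ hM]]; exists (`|M| + 1) => x Kx.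
by apply: (hM (`|M| + 1)) => //; rewrite ltr_pwDr// ler_norm.
Qed.

Lemma locint_locally_integrable (f : V -> R) : locint f -> locally_integrable_rV f.
Proof.
move=> [mf fi]; split => // K cK; have [r Kr] := compact_sub_cube cK.
apply: integrableS (fi r) => //; first exact: measurable_cube.
rewrite -[K]setCK; apply: measurableC; apply: open_measurable_rV.
by apply: closed_openC; apply: compact_closed cK; exact: norm_hausdorff.
Qed.

Lemma locally_integrable_locint (f : V -> R) : locally_integrable_rV f -> locint f.
Proof. by move=> [mf fi]; split => // r; apply: fi; exact: compact_cube. Qed.

Lemma is_weak_gradientP u G : is_weak_gradient u G <->
  forall i, locint (fun x => G x ord0 i) /\ weakD i u (fun x => G x ord0 i).
Proof.
split => h i; have [li wi] := h i; split => //.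
  exact: locally_integrable_locint.
exact: locint_locally_integrable.
Qed.

Lemma weak_gradP u : (exists G, is_weak_gradient u G) ->
  is_weak_gradient u (weak_grad u).
Proof. by move=> [G hG]; rewrite /weak_grad; case: xgetP => [|/(_ G)]. Qed.

(** The difference of two weak derivatives is orthogonal to every tensor. *)
Lemma weakD_unique i w (g1 g2 : V -> R) : locint g1 -> locint g2 -> weakD i w g1 ->
  weakD i w g2 -> {ae leb, forall x, g1 x = g2 x}.
Proof.
move=> l1 l2 d1 d2.
have ld := locintD l1 (locintZ (-1) l2).
have := @fundamental_lemma R N _ ld.
have h : forall (r : R) F, 0 <= r -> tensor_test r F ->
    \int[leb]_x ((g1 x + -1 * g2 x) * tensor F x) = 0.
  move=> r F r0 tF; have tT := tensor_test_test r0 tF.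
  have hr : forall x, tensor F x != 0 -> cube N r x by move=> x; exact: tensor_test_supp.
  have cp := test_continuous tT; have mp := continuous_measurable_rVT cp.
  have [C C0 hC] := continuous_supp_bounded cp hr.
  have := d1 _ tT; rewrite d2// => /oppr_inj e.
  have i1 := integrable_locintM l1 mp hC hr; have i2 := integrable_locintM l2 mp hC hr.
  under eq_Rintegral do rewrite mulrDl mulN1r mulNr.
  by rewrite RintegralB// e subrr.
move=> /(_ h); apply: filterS => x; rewrite mulN1r => /eqP.
by rewrite subr_eq0 => /eqP.
Qed.

Lemma inLp_ae_eq (p : R) (f g : V -> R) : 0 <= p -> inLp p f -> measurable_fun setT g ->
  {ae leb, forall x, f x = g x} -> inLp p g.
Proof.
by move=> p0 fp mg fg; apply: (inLp_le p0 fp mg); apply: filterS fg => x ->.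
Qed.

Variables (p : R).
Hypothesis p1 : 1 < p.
Let p0 : 0 < p. Proof. exact: lt_trans p1. Qed.

(** Membership in W^{1,p} can be checked on any weak gradient, although the
    definition refers to the chosen one. *)
Lemma W1pP u : W1p p u <-> inLp p u /\ exists G, is_weak_gradient u G /\
  forall i, inLp p (fun x => G x ord0 i).
Proof.
split.
  move=> [/(LfunP_inLp _ p0) up ex hG]; split => //.
  exists (weak_grad u); split; first exact: weak_gradP.
  by move=> i; apply/(LfunP_inLp _ p0); exact: hG.
move=> [up [G [wG GLp]]]; split.
- by apply/(LfunP_inLp _ p0).
- by exists G.
- move=> i; apply/(LfunP_inLp _ p0).
  have /is_weak_gradientP /(_ i) [l1 d1] := wG.
  have /is_weak_gradientP /(_ i) [l2 d2] := weak_gradP (ex_intro _ G wG).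
  by apply: (inLp_ae_eq (ltW p0) (GLp i)); [case: l2|exact: weakD_unique l1 l2 d1 d2].
Qed.

Lemma weak_grad_unique u G : is_weak_gradient u G ->
  {ae leb, forall x, weak_grad u x = G x}.
Proof.
move=> wG; have wG' := weak_gradP (ex_intro _ G wG).
have h i : {ae leb, forall x, weak_grad u x ord0 i = G x ord0 i}.
  have /is_weak_gradientP /(_ i) [l1 d1] := wG.
  have /is_weak_gradientP /(_ i) [l2 d2] := wG'.
  exact: weakD_unique l2 l1 d2 d1.
have : {ae leb, forall x, forall i, weak_grad u x ord0 i = G x ord0 i}.
  have : forall s : seq 'I_N, {ae leb, forall x, forall i, i \in s ->
     weak_grad u x ord0 i = G x ord0 i}.
    elim=> [|i s IH]; first by apply: aeW.
    apply: filterS2 (h i) IH => x xi xs j; rewrite inE => /orP[/eqP->//|]; exact: xs.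
  by move=> /(_ (index_enum 'I_N)); apply: filterS => x hx i; apply: hx; rewrite mem_index_enum.
by apply: filterS => x hx; apply/rowP.
Qed.

End weak_gradient.

(** * Integrability of the local and nonlocal densities *)

Section plaplace_field.
Context {R : realType}.
Variable p : R.
Hypothesis p1 : 1 < p.
Implicit Types a b : R.

Definition pfield a := `|a| `^ (p - 2) * a.

Let p10 : 0 < p - 1. Proof. by rewrite subr_gt0. Qed.

Lemma pfield_ge0 a : 0 <= a -> pfield a = a `^ (p - 1).
Proof.
move=> a0; rewrite /pfield ger0_norm// mulrC -(mulr_powRB1 a0 p10).
by congr (_ * _ `^ _); ring.
Qed.

Lemma pfieldN a : pfield (- a) = - pfield a.
Proof. by rewrite /pfield normrN mulrN. Qed.

Lemma pfield_lt a b : a < b -> pfield a < pfield b.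
Proof.
have pos x y : 0 <= x -> x < y -> pfield x < pfield y.
  move=> x0 xy; have y0 := ltW (le_lt_trans x0 xy).
  by rewrite !pfield_ge0// gt0_ltr_powR.
move=> ab; have [a0|a0] := leP 0 a; first exact: pos.
have [b0|b0] := leP b 0.
  by have := pos (- b) (- a); rewrite !pfieldN oppr_ge0 !ltrN2; apply.
apply: (@lt_trans _ _ 0).
  by rewrite /pfield pmulr_rlt0// powR_gt0// normr_gt0 lt_eqF.
by rewrite /pfield pmulr_rgt0// powR_gt0// normr_gt0 gt_eqF.
Qed.

Lemma pfield_young a b : `|pfield a * b| <= `|a| `^ p + `|b| `^ p.
Proof.
have p0 : 0 < p by exact: lt_trans p1.
have -> : `|pfield a * b| = `|a| `^ (p - 1) * `|b|.
  have <- : pfield `|a| = `|a| `^ (p - 1) by rewrite pfield_ge0.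
  by rewrite /pfield !normrM normr_id ger0_norm ?powR_ge0.
have [ab|/ltW ba] := leP `|a| `|b|.
  apply: (@le_trans _ _ (`|b| `^ (p - 1) * `|b|)).
    by rewrite ler_wpM2r// ge0_ler_powR ?nnegrE// ltW.
  by rewrite mulrC mulr_powRB1// lerDr powR_ge0.
apply: (@le_trans _ _ (`|a| `^ (p - 1) * `|a|)).
  by rewrite ler_wpM2l ?powR_ge0.
by rewrite mulrC mulr_powRB1// lerDl powR_ge0.
Qed.

(** If f (a - c) > f (b - d) then a - c > b - d, that is a - b > c - d, so both factors
    are positive, and symmetrically; the product is thus zero only when the second
    factor is. *)
Lemma pfield_pos_part a b c d :
  let f x := (x + `|x|) / 2 in
  0 <= (pfield (a - b) - pfield (c - d)) * (f (a - c) - f (b - d)) ?= iff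
       (f (a - c) == f (b - d)).
Proof.
move=> f.
have fmono x y : x <= y -> f x <= f y.
  move=> xy; rewrite /f ler_wpM2r//.
  have := ler_normB y (y - x); rewrite subKr (ger0_norm (x := y - x)) ?subr_ge0//.
  by move=> h; lra.
have flt x y : f x < f y -> x < y.
  by move=> fxy; rewrite ltNge; apply/negP => /fmono; rewrite leNgt fxy.
apply/leifP; case: eqVneq => [->|].
  by rewrite subrr mulr0.
rewrite neq_lt => /orP[h|h].
  rewrite nmulr_lgt0 ?subr_lt0//; apply: pfield_lt.
  by have := flt _ _ h; lra.
rewrite pmulr_lgt0 ?subr_gt0//; apply: pfield_lt.
by have := flt _ _ h; lra.
Qed.

End plaplace_field.

Section nonlocal.
Context {R : realType} {N : nat}.
Notation leb := (@lebesgue_rV R N).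
Notation V := ('rV[R]_N).
Variables (p s : R).
Hypotheses (p1 : 1 < p) (s0 : 0 < s) (s1 : s < 1).

Definition nonlocal_density (u phi : V -> R) (z : V * V) : R :=
  `|u z.1 - u z.2| `^ (p - 2) * (u z.1 - u z.2) * (phi z.1 - phi z.2)
      * enorm (z.1 - z.2) `^ (- (N%:R + p * s)).

Lemma measurable_diff2 (w : V -> R) : measurable_fun setT w ->
  measurable_fun setT (fun z : V * V => w z.1 - w z.2).
Proof.
move=> mw; apply: measurable_funB; first exact: (measurableT_comp mw measurable_fst).
exact: (measurableT_comp mw measurable_snd).
Qed.

Lemma measurable_kernel : measurable_fun setT
  (fun z : V * V => enorm (z.1 - z.2) `^ (- (N%:R + p * s))).
Proof.
apply: (measurableT_comp (measurable_powR _)).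
exact: (measurableT_comp measurable_enorm measurable_sub_rV).
Qed.

Lemma measurable_nonlocal_density u phi : measurable_fun setT u ->
  measurable_fun setT phi -> measurable_fun setT (nonlocal_density u phi).
Proof.
move=> mu mphi; apply: measurable_funM; last exact: measurable_kernel.
apply: measurable_funM; last exact: measurable_diff2.
apply: measurable_funM; last exact: measurable_diff2.
by apply: measurable_powR_norm; exact: measurable_diff2.
Qed.

(** The Young inequality bounds the density by the sum of the Gagliardo densities of
    u and phi. *)
Lemma integrable_nonlocal u phi : W1p p u -> W1p p phi ->
  (leb \x leb)%E.-integrable setT (EFin \o nonlocal_density u phi).
Proof.
move=> /(W1pP p1 _)[lu [Gu [/is_weak_gradientP wGu lGu]]].
move=> /(W1pP p1 _)[lp [Gp [/is_weak_gradientP wGp lGp]]].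
have [mu _] := lu; have [mp _] := lp.
have fu := gagliardo_finite p1 s0 s1 lu lGu (fun i => (wGu i).2).
have fp := gagliardo_finite p1 s0 s1 lp lGp (fun i => (wGp i).2).
pose K (z : V * V) := enorm (z.1 - z.2) `^ (- (N%:R + p * s)).
have mgag (w : V -> R) : measurable_fun setT w -> measurable_fun setT
    (fun z : V * V => (`|w z.1 - w z.2| `^ p * K z)%:E).
  move=> mw; apply/measurable_EFinP; apply: measurable_funM; last exact: measurable_kernel.
  by apply: measurable_powR_norm; exact: measurable_diff2.
apply/integrableP; split.
  by apply/measurable_EFinP; exact: measurable_nonlocal_density.
apply: (@le_lt_trans _ _ (\int[(leb \x leb)%E]_z
  ((`|u z.1 - u z.2| `^ p * K z)%:E + (`|phi z.1 - phi z.2| `^ p * K z)%:E))%E).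
  apply: ge0_le_integral => //.
  - apply: measurableT_comp => //; apply/measurable_EFinP.
    exact: measurable_nonlocal_density.
  - by apply: emeasurable_funD; exact: mgag.
  - move=> z _; rewrite /= -EFinD lee_fin -mulrDl normrM [in leLHS](ger0_norm (powR_ge0 _ _)).
    by rewrite ler_wpM2r ?powR_ge0//; exact: (pfield_young p1).
rewrite ge0_integralD//; [|by move=> z _; rewrite lee_fin mulr_ge0 ?powR_ge0|exact: mgag
  |by move=> z _; rewrite lee_fin mulr_ge0 ?powR_ge0|exact: mgag].
exact: lte_add_pinfty fu fp.
Qed.

End nonlocal.

Section local.
Context {R : realType} {N : nat}.
Notation leb := (@lebesgue_rV R N).
Notation V := ('rV[R]_N).
Variables (p : R) (H : V -> R).
Hypotheses (p1 : 1 < p) (hH : finsler_minkowski H).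

Lemma measurable_coords (G : V -> V) :
  (forall i, measurable_fun setT (fun x => G x ord0 i)) -> measurable_fun setT G.
Proof. by move=> mG; apply/measurable_fun_coordP. Qed.

Lemma inLp_sum_coord (G : V -> V) : (forall i, inLp p (fun x => G x ord0 i)) ->
  inLp p (fun x => \sum_i `|G x ord0 i|).
Proof.
move=> lG; have p0 : 0 < p by exact: lt_trans p1.
elim: (index_enum _) => [|i l IH].
  under eq_fun do rewrite big_nil; split; first exact: measurable_cst.
  rewrite /pint; under eq_integral do rewrite normr0 powR0 ?gt_eqF//.
  by rewrite integral0.
under eq_fun do rewrite big_cons.
have [mG _] := lG i.
have lGi : inLp p (fun x => `|G x ord0 i|).
  apply: (inLp_le (ltW p0) (lG i)); first exact: measurableT_comp.
  by apply: aeW => x; rewrite normr_id.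
exact: inLpD (ltW p0) lGi IH.
Qed.

Lemma integrable_finsler (G F : V -> V) :
  (forall i, inLp p (fun x => G x ord0 i)) ->
  (forall i, inLp p (fun x => F x ord0 i)) ->
  leb.-integrable setT (EFin \o (fun x => dot (finsler_field H p (G x)) (F x))).
Proof.
move=> lG lF; have p0 : 0 < p by exact: lt_trans p1.
have [_ [[C1 [C2 [_ C20 HC2]]] _]] := hH.
have HS (xi : V) : `|H xi| <= `|C2 * \sum_i `|xi ord0 i| |.
  have H0 : 0 <= H xi by case: hH => -[].
  have S0 : 0 <= C2 * \sum_i `|xi ord0 i| by rewrite mulr_ge0 ?sumr_ge0// ltW.
  rewrite (ger0_norm H0) (ger0_norm S0).
  have /andP[_ h] := HC2 xi; apply: (le_trans h).
  by rewrite ler_wpM2l ?enorm_le_sum// ltW.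
have i1 := inLp_integrable (inLpZ C2 (ltW p0) (inLp_sum_coord lG)).
have i2 := inLp_integrable (inLpZ C2 (ltW p0) (inLp_sum_coord lF)).
apply: le_integrable (integrableD measurableT i1 i2) => //.
  apply/measurable_EFinP; apply: measurable_dot_finsler => //.
    by apply: measurable_coords => i; case: (lG i).
  by apply: measurable_coords => i; case: (lF i).
move=> x _; rewrite /= lee_fin [leRHS]ger0_norm ?addr_ge0 ?powR_ge0//.
apply: (le_trans (finsler_young p1 hH _ _)).
have H0 (xi : V) : 0 <= H xi by case: hH => -[].
have Hp (xi : V) : H xi `^ p <= `|C2 * \sum_i `|xi ord0 i| | `^ p.
  have h := HS xi; rewrite (ger0_norm (H0 xi)) in h.
  by apply: ge0_ler_powR; rewrite ?nnegrE//; exact: ltW.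
exact: lerD.
Qed.

End local.

(** * The positive part of a difference *)

Section positive_part.
Context {R : realType} {N : nat}.
Notation leb := (@lebesgue_rV R N).
Notation V := ('rV[R]_N).
Variables (p : R).
Hypothesis p1 : 1 < p.
Let p0 : 0 < p. Proof. exact: lt_trans p1. Qed.

(** The positive part of w = u - v is (w + |w|) / 2, so its gradient follows from that
    of |w|; on the set w = 0 this writes it as half of grad w instead of 0, which is
    the same almost everywhere and is still a nonnegative multiple of grad w. *)
Lemma is_weak_gradient_sub_pos_part (u v : V -> R) : W1p p u -> W1p p v ->
  is_weak_gradient (fun x => (u x - v x + `|u x - v x|) / 2)
    (fun x => ((1 + Num.sg (u x - v x)) / 2) *: (weak_grad u x - weak_grad v x)) /\
  W1p p (fun x => (u x - v x + `|u x - v x|) / 2).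
Proof.
move=> Wu Wv.
have [/(LfunP_inLp _ p0) lu exu hGu] := Wu.
have [/(LfunP_inLp _ p0) lv exv hGv] := Wv.
have /is_weak_gradientP dGu := weak_gradP exu.
have /is_weak_gradientP dGv := weak_gradP exv.
have lGu i : inLp p (fun x => weak_grad u x ord0 i) by apply/(LfunP_inLp _ p0).
have lGv i : inLp p (fun x => weak_grad v x ord0 i) by apply/(LfunP_inLp _ p0).
pose w x := 1 * u x + -1 * v x.
have lin (a b : R) (f1 f2 : V -> R) : inLp p f1 -> inLp p f2 ->
    inLp p (fun x => a * f1 x + b * f2 x).
  by move=> l1 l2; apply: inLpD (inLpZ a _ l1) (inLpZ b _ l2); exact: ltW.
have lw : inLp p w := lin 1 (-1) _ _ lu lv.
have wE x : u x - v x = w x by rewrite /w mul1r mulN1r.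
pose g i x := 1 * weak_grad u x ord0 i + -1 * weak_grad v x ord0 i.
have lg i : inLp p (g i) := lin 1 (-1) _ _ (lGu i) (lGv i).
have li (f : V -> R) : inLp p f -> locint f by exact: inLp_locint (ltW p1).
have dlin i (a b : R) (w1 w2 g1 g2 : V -> R) : inLp p w1 -> inLp p w2 ->
    inLp p g1 -> inLp p g2 -> weakD i w1 g1 -> weakD i w2 g2 ->
    weakD i (fun x => a * w1 x + b * w2 x) (fun x => a * g1 x + b * g2 x).
  by move=> /li l1 /li l2 /li k1 /li k2; exact: weakD_lin l1 l2 k1 k2.
have dw i : weakD i w (g i) :=
  dlin i 1 (-1) _ _ _ _ lu lv (lGu i) (lGv i) (dGu i).2 (dGv i).2.
have [mw _] := lw.
have da i := weakD_abs p1 lw (lg i) (dw i).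
have la : inLp p (fun x => `|w x|).
  apply: (inLp_le (ltW p0) lw); first exact: measurableT_comp.
  by apply: aeW => x; rewrite normr_id.
have msg := measurable_sg mw.
have lsg i : inLp p (fun x => Num.sg (w x) * g i x).
  have [mg _] := lg i.
  apply: (inLp_le (ltW p0) (lg i)); first exact: measurable_funM.
  apply: aeW => x; rewrite normrM normr_sg; case: (_ == 0); rewrite ?mul0r ?mul1r//.
have lphi := lin 2^-1 2^-1 _ _ lw la.
have lG i := lin 2^-1 2^-1 _ _ (lg i) (lsg i).
have dphi i := dlin i 2^-1 2^-1 _ _ _ _ lw la (lg i) (lsg i) (dw i) (da i).
have phiE : (fun x => (u x - v x + `|u x - v x|) / 2) =
    (fun x => 2^-1 * w x + 2^-1 * `|w x|).
  by apply/funext => x; rewrite wE -mulrDr mulrC.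
have GE i : (fun x => (((1 + Num.sg (u x - v x)) / 2) *:
     (weak_grad u x - weak_grad v x)) ord0 i) =
    (fun x => 2^-1 * g i x + 2^-1 * (Num.sg (w x) * g i x)).
  by apply/funext => x; rewrite wE !mxE /g; ring.
have wG : is_weak_gradient (fun x => (u x - v x + `|u x - v x|) / 2)
    (fun x => ((1 + Num.sg (u x - v x)) / 2) *: (weak_grad u x - weak_grad v x)).
  by apply/is_weak_gradientP => i; rewrite GE phiE; split; [exact: li (lG i)|exact: dphi].
split; first exact: wG.
apply/(W1pP p1 _); split; first by rewrite phiE; exact: lphi.
by eexists; split; [exact: wG|move=> i; rewrite GE; exact: lG].
Qed.

End positive_part.

Section measure_complement.
Context {R : realType} {N : nat}.
Notation leb := (@lebesgue_rV R N).
Notation V := ('rV[R]_N).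

Lemma bounded_compl_not_negligible (A : set V) : (0 < N)%N -> bounded_set A ->
  measurable A -> leb (~` A) != 0%E.
Proof.
move=> N0 [M [_ hM]] mA; apply/negP => /eqP A0.
pose r := `|M| + 1.
have r0 : 0 <= r by rewrite addr_ge0.
have Ar : A `<=` cube N r by move=> x Ax; apply: (hM r) => //; rewrite ltr_pwDr// ler_norm.
have r10 : 0 <= r + 1 by rewrite addr_ge0.
have : (leb (cube N (r + 1)) <= leb (cube N r))%E.
  apply: (@le_trans _ _ (leb (cube N r `|` ~` A))).
    apply: le_measure; rewrite ?inE; [exact: measurable_cube| |].
      by apply: measurableU; [exact: measurable_cube|exact: measurableC].
    by move=> x _; have [/Ar|] := pselect (A x); [left|right].
  apply: (le_trans (measureU2 _ _ _)); [exact: measurable_cube|exact: measurableC|].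
  by rewrite [X in (_ + X)%E]A0 adde0.
rewrite !lebesgue_cube// lee_fin leNgt => /negP; apply.
by rewrite ltr_pXn2r ?nnegrE ?mulr_ge0// ltr_pM2l// ltrDl ltr01.
Qed.

End measure_complement.

Section vanishing_integrals.
Context d (T : measurableType d) (R : realType) (mu : {measure set T -> \bar R}).

Lemma ge0_integral_eq0_ae (f : T -> \bar R) : measurable_fun setT f ->
  (forall x, (0 <= f x)%E) -> (\int[mu]_x f x = 0)%E ->
  {ae mu, forall x, f x = 0%E}.
Proof.
move=> mf f0 If.
have /(ae_eq_integral_abs mu measurableT mf) : (\int[mu]_x `|f x| = 0)%E.
  by rewrite -If; apply: eq_integral => x _; rewrite gee0_abs.
by apply: filterS => x /(_ I).
Qed.

Lemma ae_not_null (P : T -> Prop) (Z : set T) : measurable Z -> mu Z != 0%E ->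
  {ae mu, forall x, P x} -> exists2 x, Z x & P x.
Proof.
move=> mZ Z0 [A [mA A0 hA]]; apply: contrapT => hn; move/eqP: Z0; apply.
apply: (subset_measure0 _ _ _ A0) => // y Zy; apply: hA => /= Py.
by apply: hn; exists y.
Qed.

End vanishing_integrals.

Section symmetric_difference_zero.
Context {R : realType} {N : nat}.
Notation leb := (@lebesgue_rV R N).
Notation V := ('rV[R]_N).

(** By Fubini almost every y satisfies phi x = phi y for almost all x, and Z, not
    being null, contains such a y with phi y = 0. *)
Lemma ae_diff_eq0 (phi : V -> R) (Z : set V) : measurable_fun setT phi ->
  measurable Z -> leb Z != 0%E ->
  {ae leb, forall x, Z x -> phi x = 0} ->
  {ae (leb \x leb)%E, forall z, phi z.1 = phi z.2} ->
  {ae leb, forall x, phi x = 0}.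
Proof.
move=> mphi mZ Z0 phiZ pp.
pose q (z : V * V) : \bar R := (`|phi z.1 - phi z.2|)%:E.
have mq : measurable_fun setT q.
  by apply/measurable_EFinP; apply: measurableT_comp => //; exact: measurable_diff2.
have q0 z : (0 <= q z)%E by rewrite lee_fin.
have Iq : (\int[(leb \x leb)%E]_z q z = 0)%E.
  rewrite (ae_eq_integral (cst 0%E))//; first by rewrite integral0.
  by apply: filterS pp => z pz _; rewrite /q pz subrr normr0.
rewrite fubini_tonelli2// in Iq.
have mG := @measurable_fun_fubini_tonelli_G _ _ _ _ _ leb q mq q0.
have aeG : {ae leb, forall y, (\int[leb]_x q (x, y) = 0)%E}.
  apply: ge0_integral_eq0_ae Iq => // y; exact: integral_ge0.
have [y Zy [phiy Gy]] : exists2 y, Z y & phi y = 0 /\ (\int[leb]_x q (x, y) = 0)%E.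
  have ph : {ae leb, forall y, (Z y -> phi y = 0) /\ (\int[leb]_x q (x, y) = 0)%E}.
    by apply: filterS2 phiZ aeG => y h1 h2; split.
  have [y Zy [h1 h2]] := ae_not_null mZ Z0 ph.
  by exists y => //; split => //; exact: h1.
have : {ae leb, forall x, q (x, y) = 0%E}.
  apply: ge0_integral_eq0_ae Gy => //.
  by apply: (measurableT_comp mq); exact: pair2_measurable.
by apply: filterS => x; rewrite /q/= phiy subr0 => -[] /eqP; rewrite normr_eq0 => /eqP.
Qed.

End symmetric_difference_zero.

(** * Comparison *)

Section integral_positivity.
Context d (T : measurableType d) (R : realType) (mu : {measure set T -> \bar R}).

Lemma Rintegral_ae_ge0 (D : set T) (f : T -> R) : measurable D ->
  measurable_fun D f -> {ae mu, forall x, D x -> 0 <= f x} ->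
  0 <= \int[mu]_(x in D) f x.
Proof.
move=> mD mf f0; rewrite /Rintegral (ae_eq_integral (fun x => `|f x|%:E))//.
- by apply: fine_ge0; apply: integral_ge0 => x _; rewrite lee_fin.
- exact/measurable_EFinP.
- by apply/measurable_EFinP; exact: measurableT_comp.
- by apply: filterS f0 => x fx Dx; rewrite ger0_norm//; exact: fx.
Qed.

Lemma Rintegral_le0_ae (f : T -> R) : mu.-integrable setT (EFin \o f) ->
  (forall x, 0 <= f x) -> \int[mu]_x f x <= 0 -> {ae mu, forall x, f x = 0}.
Proof.
move=> fi f0 If.
have mf : measurable_fun setT (EFin \o f) := measurable_int _ fi.
have : {ae mu, forall x, (EFin \o f) x = 0%E}.
  apply: ge0_integral_eq0_ae => //=.
  rewrite -[LHS]fineK; last exact: integrable_fin_num.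
  congr (_%:E); apply/eqP; rewrite eq_le [X in X && _]If/=.
  by apply: fine_ge0; apply: integral_ge0 => x _; rewrite lee_fin.
by apply: filterS => x [].
Qed.

End integral_positivity.

Section comparison.
Context {R : realType} {N : nat}.
Notation leb := (@lebesgue_rV R N).
Notation V := ('rV[R]_N).
Variables (p s : R) (H : V -> R) (u v : V -> R).
Hypotheses (p1 : 1 < p) (s0 : 0 < s) (s1 : s < 1) (hH : finsler_minkowski H).
Hypotheses (hu : W1p p u) (hv : W1p p v).

Definition sub_pos_part (x : V) : R := (u x - v x + `|u x - v x|) / 2.

Lemma sub_pos_part_ge0 x : 0 <= sub_pos_part x.
Proof.
rewrite /sub_pos_part divr_ge0// -(opprK (u x - v x)) normrN addrC subr_ge0.
exact: ler_norm.
Qed.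

Lemma sub_pos_part_eq0 x : (sub_pos_part x == 0) = (u x <= v x).
Proof.
rewrite /sub_pos_part mulf_eq0 invr_eq0 pnatr_eq0 orbF addrC addr_eq0.
by rewrite -ler0_def subr_le0.
Qed.

Lemma W1p_sub_pos_part : W1p p sub_pos_part.
Proof. exact: (is_weak_gradient_sub_pos_part p1 hu hv).2. Qed.

(** The gradient of the positive part is a nonnegative multiple of grad u - grad v, so
    the difference of the integrands is nonnegative by monotonicity of the field. *)
Lemma local_form_sub_pos_part (Omega : set V) : measurable Omega ->
  local_form H p Omega v sub_pos_part <= local_form H p Omega u sub_pos_part.
Proof.
move=> mO.
have gE : {ae leb, forall x, weak_grad sub_pos_part x =
    ((1 + Num.sg (u x - v x)) / 2) *: (weak_grad u x - weak_grad v x)} :=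
  weak_grad_unique (is_weak_gradient_sub_pos_part p1 hu hv).1.
have Lp (w : V -> R) : W1p p w -> forall i, inLp p (fun x => weak_grad w x ord0 i).
  by move=> [_ _ hG] i; apply/LfunP_inLp => //; exact: lt_trans p1.
have Lphi := Lp _ W1p_sub_pos_part.
have Ii (w : V -> R) : W1p p w -> leb.-integrable Omega (EFin \o (fun x =>
    dot (finsler_field H p (weak_grad w x)) (weak_grad sub_pos_part x))).
  by move=> /Lp Lw; apply: (integrableS _ _ _ (integrable_finsler p1 hH Lw Lphi)).
rewrite -subr_ge0 /local_form -RintegralB//; [|exact: Ii..].
apply: Rintegral_ae_ge0 => //.
  by apply: measurable_funB; apply/measurable_EFinP; apply: measurable_int (Ii _ _).
apply: filterS gE => x gx _; rewrite gx.
apply: finsler_monotone_scale => //.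
by apply: divr_ge0 => //; case: sgrP => _; rewrite ?addr0 ?subrr.
Qed.

(** The difference of the two forms is the integral of a nonnegative function, so the
    hypothesis forces this function to vanish almost everywhere; off the diagonal the
    kernel is positive and can be divided out, and on the diagonal the conclusion is
    trivial. *)
Lemma nonlocal_form_sub_pos_part :
  nonlocal_form p s u sub_pos_part <= nonlocal_form p s v sub_pos_part ->
  {ae (leb \x leb)%E, forall z, sub_pos_part z.1 = sub_pos_part z.2}.
Proof.
pose D (z : V * V) : R := nonlocal_density p s u sub_pos_part z -
  nonlocal_density p s v sub_pos_part z.
pose K (z : V * V) : R := enorm (z.1 - z.2) `^ (- (N%:R + p * s)).
pose M (z : V * V) : R := (pfield p (u z.1 - u z.2) - pfield p (v z.1 - v z.2)) *
  (sub_pos_part z.1 - sub_pos_part z.2).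
have DE z : D z = M z * K z.
  by rewrite /D /M /K /nonlocal_density /pfield; ring.
have MP z := pfield_pos_part p1 (u z.1) (u z.2) (v z.1) (v z.2).
have iu := integrable_nonlocal p1 s0 s1 hu W1p_sub_pos_part.
have iv := integrable_nonlocal p1 s0 s1 hv W1p_sub_pos_part.
rewrite -subr_le0 -RintegralB// => I0.
have : {ae (leb \x leb)%E, forall z, D z = 0}.
  apply: Rintegral_le0_ae I0; first exact: (integrableB _ iu iv).
  by move=> z; rewrite -/(D z) DE mulr_ge0 ?powR_ge0//; exact: (MP z).1.
move=> D0; apply: filterS D0 => z Dz; have /esym/eqP := DE z; rewrite Dz.
have [->//|z12] := eqVneq z.1 z.2.
rewrite mulf_eq0 orbC gt_eqF/=; last first.
  rewrite powR_gt0// (lt_le_trans _ (norm_le_enorm _))// normr_gt0 subr_eq0//.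
by rewrite eq_sym (MP z).2 => /eqP.
Qed.

End comparison.

Theorem theorem2p12 (R : realType) (N : nat) (hN : (2 <= N)%N)
    (Omega : set 'rV[R]_N) (hOmega : bounded_C1_domain Omega)
    (p s : R) (hp : 1 < p) (hs0 : 0 < s) (hs1 : s < 1)
    (H : 'rV[R]_N -> R) (hH : finsler_minkowski H)
    (u v : 'rV[R]_N -> R) (hu : W1p p u) (hv : W1p p v)
    (huv : weak_le H p s Omega u v)
    (hout : {ae @lebesgue_rV R N, forall x, ~ Omega x -> u x <= v x}) :
  {ae @lebesgue_rV R N, forall x, Omega x -> u x <= v x}.
Proof.
have cancel (a b c d : R) : a + b <= c + d -> c <= a -> b <= d by lra.
have [oO _ _ bO _] := hOmega.
have mO : measurable Omega := open_measurable_rV oO.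
have Wphi := W1p_sub_pos_part hp hu hv.
have out0 : {ae @lebesgue_rV R N, forall x, ~ Omega x -> sub_pos_part u v x = 0}.
  by apply: filterS hout => x h /h; rewrite -sub_pos_part_eq0 => /eqP.
have /huv : W01p p Omega (sub_pos_part u v) by [].
have /[swap]/[apply] : {ae @lebesgue_rV R N, forall x, 0 <= sub_pos_part u v x}.
  by apply: aeW => x; exact: sub_pos_part_ge0.
move=> huv'.
have /(nonlocal_form_sub_pos_part hp hs0 hs1 hu hv) :=
  cancel _ _ _ _ huv' (local_form_sub_pos_part hp hH hu hv mO).
have mphi : measurable_fun setT (sub_pos_part u v).
  by have /(W1pP hp _)[[]] := Wphi.
have O'0 : @lebesgue_rV R N (~` Omega) != 0%E.
  by apply: bounded_compl_not_negligible => //; exact: ltn_trans hN.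
move=> /(ae_diff_eq0 mphi (measurableC mO) O'0 out0).
by apply: filterS => x phi0 _; rewrite -sub_pos_part_eq0 phi0.
Qed.
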